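(* Let $w\in\mathbb{C}\setminus\{0\}$, $a>0$ and $1<\mathrm{Re}(s)<2$. Then $$\zeta_w(s,a+1)=-\frac{a^{-s}}{2}A_w(s-1)+\frac{a^{1-s}}{s-1}A_{iw}(1-s)+\frac{2^{s+2}a^{1-s}}{w^2\Gamma\left(1-\frac{s}{2}\right)\Gamma(s)}\int_0^\infty\int_1^\infty\int_{0}^\infty \frac{u^{s-2}e^{-(u^2+v^2)}\sin(wv)\sinh(wu)}{\left(e^{\frac{2\pi avt}{u}}-1\right)(t^2-1)^{\frac{s}{2}}}\,dv\,dt\,du.$$
   Context: For $w\in\mathbb{C}\setminus\{0\}$, $\mathrm{Re}(s)>1$ and real $a$, $$\zeta_w(s,a):=\frac{4}{w^2\sqrt{\pi}\,\Gamma\left(\frac{s+1}{2}\right)}\sum_{n=1}^{\infty}\int_{0}^{\infty}\int_{0}^{\infty}\frac{(uv)^{s-1}e^{-(u^2+v^2)}\sin(wv)\sinh(wu)}{\left(n^2u^2+(a-1)^2v^2\right)^{s/2}}\,du\,dv.$$ For $z\in\mathbb{C}$, $$A_w(z):=e^{-\frac{w^2}{4}}{}_1F_{1}\left(1;\tfrac{3}{2};\tfrac{w^2}{4}\right){}_1F_{1}\left(1+\tfrac{z}{2};\tfrac{3}{2};\tfrac{w^2}{4}\right)=\frac{\sqrt{\pi}}{w}\mathrm{erf}\left(\tfrac{w}{2}\right){}_1F_{1}\left(1+\tfrac{z}{2};\tfrac{3}{2};\tfrac{w^2}{4}\right),$$ where ${}_1F_1$ is the confluent hypergeometric function and $\mathrm{erf}(w)=\frac{2}{\sqrt\pi}\int_0^we^{-t^2}dt$.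 *)

(* Defs.v *)
From mathcomp Require Import all_boot all_order all_algebra.
From mathcomp Require Import all_classical all_reals all_analysis.
From mathcomp Require Export complex.

Set Implicit Arguments.
Unset Strict Implicit.
Unset Printing Implicit Defensive.

Import Order.TTheory GRing.Theory Num.Theory.
Import numFieldNormedType.Exports.

Local Open Scope classical_set_scope.
Local Open Scope ring_scope.
Local Open Scope complex_scope.

Section ComplexFunctions.
Context {R : realType}.
Implicit Types (w z s : R[i]) (x a : R).

Definition cexp z : R[i] :=
  (expR (complex.Re z) * cos (complex.Im z)) +i* (expR (complex.Re z) * sin (complex.Im z)).

Definition csin z : R[i] := (cexp ('i%C * z) - cexp (- ('i%C * z))) / (2%:R * 'i%C).

Definition csinh z : R[i] := (cexp z - cexp (- z)) / 2%:R.

(* The principal power x ^ z of a positive real x; since [ln] is extended by 0,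
   the value is meaningless for x <= 0. *)
Definition cpow x z : R[i] := cexp (z * (ln x)%:C).

(* Like [Rintegral], this is a junk value when f is not integrable on D. *)
Definition cintegral (D : set R) (f : R -> R[i]) : R[i] :=
  (\int[lebesgue_measure]_(x in D) complex.Re (f x)) +i*
  (\int[lebesgue_measure]_(x in D) complex.Im (f x)).

(* R[i]^o carries the topology of the modulus. *)
Definition cseries (u : nat -> R[i]) : R[i] :=
  limn (series (u : nat -> R[i]^o)).

(* Euler's integral: this is the Gamma function on the half-plane Re z > 0. *)
Definition cGamma z : R[i] :=
  cintegral `]0, +oo[ (fun t => cpow t (z - 1) * (expR (- t))%:C).

Definition pochhammer z (n : nat) : R[i] := \prod_(i < n) (z + i%:R).

(* Confluent hypergeometric 1F1(b; c; z), the sum of (b)_n / (c)_n * z^n / n!. *)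
Definition hyp1F1 (b c z : R[i]) : R[i] :=
  cseries (fun n => pochhammer b n / pochhammer c n * (z ^+ n / n`!%:R)).

Definition A_ w z : R[i] :=
  cexp (- (w ^+ 2 / 4%:R)) * hyp1F1 1 (3%:R / 2%:R) (w ^+ 2 / 4%:R)
  * hyp1F1 (1 + z / 2%:R) (3%:R / 2%:R) (w ^+ 2 / 4%:R).

(* The index n of the series starts at 1, hence [n.+1] below. *)
Definition zeta_ w s a : R[i] :=
  4%:R / (w ^+ 2 * (Num.sqrt pi)%:C * cGamma ((s + 1) / 2%:R))
  * cseries (fun n =>
      cintegral `]0, +oo[ (fun v =>
      cintegral `]0, +oo[ (fun u =>
        cpow (u * v) (s - 1) * (expR (- (u ^+ 2 + v ^+ 2)))%:C
        * csin (w * v%:C) * csinh (w * u%:C)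
        / cpow (n.+1%:R ^+ 2 * u ^+ 2 + (a - 1) ^+ 2 * v ^+ 2) (s / 2%:R)))).

End ComplexFunctions.

(* Main.v *)
(** Factoring u^2 out of the denominator of the n-th term and putting x = a v / u reduces the
    claim to a closed form for the sum over n of (n^2 + x^2)^(-s/2).  Write
    A^(-s/2) = (Gamma(s/2) Gamma(1 - s/2))^(-1) int_0^oo r^(-s/2) / (r + A) dr with A = n^2 + x^2
    and sum under the integral with the partial fractions of coth at y = sqrt(r + x^2):
    sum_n 1 / (n^2 + y^2) = - 1 / (2 y^2) + pi / (2 y) + (pi / y) / (e^(2 pi y) - 1).
    The three summands yield the three terms of the theorem; in the last one r = x^2 (t^2 - 1).
    The first two double integrals factor into int u^p e^(-u^2) sinh(w u) du and its sine
    analogue, which are 1F1's that Kummer's transformation turns into A_w(s - 1) and A_{iw}(1 - s);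
    the constants match by Legendre's duplication formula. *)

(* The limit under two integral signs shapes the proof. For each r, [coth_partial_le] bounds the
   partial sums over n by pi / (2 y); integrated against r^(-s/2) this becomes K x^(1 - Re s), and a
   power of x = a v / u splits into powers of u and of v. So one product majorant serves dominated
   convergence and Fubini at once. The order of integration changes twice: u and v in the n-th term,
   since the series has u innermost, and v and t in the last term, since the goal has v innermost.
   Both bounds on Re s are conditions of convergence: r^(-s/2) is integrable at 0 when Re s < 2, and
   r^(-s/2) / sqrt(r + x^2) at infinity when Re s > 1. [cGamma] is Euler's integral, meaningful on
   Re z > 0. That it does not vanish, which divisions by it require, and the duplication formula are
   both drawn from Gamma (N + z) ~ N^z Gamma (N). The product Gamma (s/2) Gamma (1 - s/2) is never
   evaluated: in the last term duplication absorbs the first factor and the second survives. As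
   [cintegral] has a junk value off the integrable functions, evaluations come paired with
   integrability. *)
Require Import Defs.
From mathcomp Require Import all_boot all_order all_algebra.
From mathcomp Require Import all_classical all_reals all_analysis.
From mathcomp Require Import measurable_realfun lebesgue_integral gauss_integral.
From mathcomp Require Import ring lra.
Import Order.TTheory GRing.Theory Num.Theory.
Import numFieldNormedType.Exports.
Local Open Scope classical_set_scope.
Local Open Scope ring_scope.
Local Open Scope complex_scope.

Set Implicit Arguments.
Unset Strict Implicit.
Unset Printing Implicit Defensive.

(** * Complex numbers *)

Notation cabs := ComplexField.Normc.normc.

Section ComplexBasics.
Context {R : realType}.
Implicit Types (x y z w : R[i]) (a b r : R).

Lemma complexP x y : complex.Re x = complex.Re y -> complex.Im x = complex.Im y -> x = y.
Proof. by case: x => ? ?; case: y => ? ? /= -> ->. Qed.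

Lemma cReD x y : complex.Re (x + y) = complex.Re x + complex.Re y.
Proof. by case: x; case: y. Qed.

Lemma cImD x y : complex.Im (x + y) = complex.Im x + complex.Im y.
Proof. by case: x; case: y. Qed.

Lemma cReN x : complex.Re (- x) = - complex.Re x.
Proof. by case: x. Qed.

Lemma cImN x : complex.Im (- x) = - complex.Im x.
Proof. by case: x. Qed.

Lemma cReM x y : complex.Re (x * y) =
  complex.Re x * complex.Re y - complex.Im x * complex.Im y.
Proof. by case: x; case: y. Qed.

Lemma cImM x y : complex.Im (x * y) =
  complex.Re x * complex.Im y + complex.Im x * complex.Re y.
Proof. by case: x; case: y. Qed.

Lemma cRe_sum (F : nat -> R[i]) n :
  complex.Re (\sum_(i < n) F i) = \sum_(i < n) complex.Re (F i).
Proof. by elim: n => [|n IH]; rewrite ?big_ord0 // !big_ord_recr /= cReD IH. Qed.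

Lemma cIm_sum (F : nat -> R[i]) n :
  complex.Im (\sum_(i < n) F i) = \sum_(i < n) complex.Im (F i).
Proof. by elim: n => [|n IH]; rewrite ?big_ord0 // !big_ord_recr /= cImD IH. Qed.

Lemma normcC x : `|x| = (cabs x)%:C.
Proof. by []. Qed.

Lemma cabs_ge0 x : 0 <= cabs x.
Proof. by case: x => a b; rewrite /= sqrtr_ge0. Qed.

Lemma cabsD x y : cabs (x + y) <= cabs x + cabs y.
Proof. by rewrite -lecR rmorphD /= -!normcC ler_normD. Qed.

Lemma cabsN x : cabs (- x) = cabs x.
Proof. by apply: complexI; rewrite -!normcC normrN. Qed.

Lemma cabsM x y : cabs (x * y) = cabs x * cabs y.
Proof. exact: ComplexField.Normc.normcM. Qed.

Lemma cabsV x : cabs x^-1 = (cabs x)^-1.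
Proof. exact: ComplexField.Normc.normcV. Qed.

Lemma cabs0 : cabs (0 : R[i]) = 0.
Proof. exact: ComplexField.Normc.normc0. Qed.

Lemma cabs1 : cabs (1 : R[i]) = 1.
Proof. exact: ComplexField.Normc.normc1. Qed.

Lemma cabsX x n : cabs (x ^+ n) = cabs x ^+ n.
Proof. by elim: n => [|n IH]; rewrite ?expr0 ?cabs1// !exprS cabsM IH. Qed.

Lemma cabs_eq0 x : (cabs x == 0) = (x == 0).
Proof.
apply/eqP/eqP => [/ComplexField.Normc.eq0_normc //|->]; exact: cabs0.
Qed.

Lemma cabs_real a : cabs (a%:C) = `|a|.
Proof. by rewrite /= expr0n /= addr0 sqrtr_sqr. Qed.

Lemma cabs_nat n : cabs (n%:R : R[i]) = n%:R.
Proof. by rewrite -(rmorph_nat (real_complex R)) cabs_real ger0_norm. Qed.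

Lemma cabs_sum (F : nat -> R[i]) n :
  cabs (\sum_(i < n) F i) <= \sum_(i < n) cabs (F i).
Proof.
elim: n => [|n IH]; first by rewrite !big_ord0 cabs0.
by rewrite !big_ord_recr /= (le_trans (cabsD _ _)) // lerD2r.
Qed.

Lemma Re_le_cabs x : `|complex.Re x| <= cabs x.
Proof.
case: x => a b /=; rewrite -sqrtr_sqr ler_sqrt ?addr_ge0 ?sqr_ge0 //.
by rewrite lerDl sqr_ge0.
Qed.

Lemma Im_le_cabs x : `|complex.Im x| <= cabs x.
Proof.
case: x => a b /=; rewrite -sqrtr_sqr ler_sqrt ?addr_ge0 ?sqr_ge0 //.
by rewrite lerDr sqr_ge0.
Qed.

Lemma cabs_le_ReIm x : cabs x <= `|complex.Re x| + `|complex.Im x|.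
Proof.
rewrite {1}(complexE x) (le_trans (cabsD _ _)) // cabsM !cabs_real.
have -> : cabs 'i%C = 1 :> R by rewrite /= expr0n /= add0r expr1n sqrtr1.
by rewrite mul1r.
Qed.

Lemma cabs_i : cabs ('i%C : R[i]) = 1.
Proof. by rewrite /= expr0n /= add0r expr1n sqrtr1. Qed.

Lemma cexpD x y : cexp (x + y) = cexp x * cexp y.
Proof.
apply: complexP; rewrite ?cReM ?cImM /= cReD cImD expRD ?cosD ?sinD; ring.
Qed.

Lemma cexp0 : cexp (0 : R[i]) = 1.
Proof. by rewrite /cexp /= expR0 cos0 sin0 mulr1 mulr0. Qed.

Lemma cexp_neq0 x : cexp x != 0.
Proof.
apply/negP => /eqP h; have := cexpD x (- x).
by rewrite h subrr cexp0 mul0r; apply/eqP; rewrite oner_eq0.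
Qed.

Lemma cexpN x : cexp (- x) = (cexp x)^-1.
Proof.
by apply: (mulfI (cexp_neq0 x)); rewrite -cexpD subrr cexp0 divff // cexp_neq0.
Qed.

Lemma cexp_real a : cexp (a%:C) = (expR a)%:C.
Proof. by rewrite /cexp /= cos0 sin0 mulr1 mulr0. Qed.

Lemma cabs_cexp x : cabs (cexp x) = expR (complex.Re x).
Proof.
rewrite /= !exprMn -mulrDr cos2Dsin2 mulr1 sqrtr_sqr ger0_norm //.
Qed.

Lemma cpowD a x y : cpow a (x + y) = cpow a x * cpow a y.
Proof. by rewrite /cpow mulrDl cexpD. Qed.

Lemma cpow_neq0 a x : cpow a x != 0.
Proof. exact: cexp_neq0. Qed.

Lemma cpowN a x : cpow a (- x) = (cpow a x)^-1.
Proof. by rewrite /cpow mulNr cexpN. Qed.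

Lemma cpow0 a : cpow a 0 = 1 :> R[i].
Proof. by rewrite /cpow mul0r cexp0. Qed.

Lemma cpowM a b x : 0 < a -> 0 < b -> cpow (a * b) x = cpow a x * cpow b x.
Proof. by move=> a0 b0; rewrite /cpow lnM // rmorphD mulrDr cexpD. Qed.

Lemma cpowVl a x : 0 < a -> cpow a^-1 x = cpow a (- x).
Proof. by move=> a0; rewrite /cpow lnV // rmorphN mulrN mulNr. Qed.

Lemma cpow_powR a b x : 0 < a -> cpow (a `^ b) x = cpow a (b%:C * x).
Proof.
by move=> a0; rewrite /cpow ln_powR rmorphM /= mulrA [x * _]mulrC.
Qed.

Lemma cpow_real a b : 0 < a -> cpow a (b%:C) = (a `^ b)%:C.
Proof.
by move=> a0; rewrite /cpow -rmorphM cexp_real /powR gt_eqF.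
Qed.

Lemma cpow_nat a n : 0 < a -> cpow a n%:R = (a ^+ n)%:C.
Proof.
move=> a0; rewrite -(rmorph_nat (real_complex R)) cpow_real //.
by rewrite powR_mulrn // ltW.
Qed.

Lemma cpow1 a : 0 < a -> cpow a 1 = a%:C.
Proof. by move=> /cpow_nat => /(_ 1%N); rewrite expr1. Qed.

Lemma cpowXl a n x : 0 < a -> cpow (a ^+ n) x = cpow a (n%:R * x).
Proof.
move=> a0; rewrite -powR_mulrn ?ltW // cpow_powR //.
by rewrite (rmorph_nat (real_complex R)).
Qed.

Lemma cabs_cpow a x : 0 < a -> cabs (cpow a x) = a `^ (complex.Re x).
Proof.
move=> a0; rewrite /cpow cabs_cexp cReM /= mulr0 subr0.
by rewrite /powR gt_eqF.
Qed.

End ComplexBasics.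

Section ComplexLimits.
Context {R : realType}.
Implicit Types (u v : nat -> R[i]) (l : R[i]).

(** Componentwise, so that real limit and integral theorems apply to each part; [ccvg_cvg]
    translates back to the modulus topology in which [cseries] takes its limit. *)
Definition ccvg u l :=
  ((fun n => complex.Re (u n)) @ \oo --> complex.Re l) /\
  ((fun n => complex.Im (u n)) @ \oo --> complex.Im l).

Lemma ccvg_cst l : ccvg (fun=> l) l.
Proof. by split; exact: cvg_cst. Qed.

Lemma ccvgD u v l m : ccvg u l -> ccvg v m -> ccvg (fun n => u n + v n) (l + m).
Proof.
move=> [u1 u2] [v1 v2]; split; rewrite ?cReD ?cImD.
  under eq_fun do rewrite cReD; exact: cvgD.
by under eq_fun do rewrite cImD; exact: cvgD.
Qed.

Lemma ccvgM u v l m : ccvg u l -> ccvg v m -> ccvg (fun n => u n * v n) (l * m).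
Proof.
move=> [u1 u2] [v1 v2]; split; rewrite ?cReM ?cImM.
  by under eq_fun do rewrite cReM; apply: cvgB; exact: cvgM.
by under eq_fun do rewrite cImM; apply: cvgD; exact: cvgM.
Qed.

Lemma ccvgZ c u l : ccvg u l -> ccvg (fun n => c * u n) (c * l).
Proof. by move=> ul; apply: ccvgM => //; exact: ccvg_cst. Qed.

Lemma ccvgN u l : ccvg u l -> ccvg (fun n => - u n) (- l).
Proof.
by move=> /(ccvgZ (-1)); under eq_fun do rewrite mulN1r; rewrite mulN1r.
Qed.

Lemma ccvg_unique u l m : ccvg u l -> ccvg u m -> l = m.
Proof.
move=> [u1 u2] [v1 v2]; apply: complexP.
  exact: (cvg_unique _ u1 v1).
exact: (cvg_unique _ u2 v2).
Qed.

Lemma ccvg_squeeze u l (e : nat -> R) :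
  (forall n, cabs (u n - l) <= e n) -> e @ \oo --> 0 -> ccvg u l.
Proof.
move=> h e0; split; apply/cvgrPdist_le => eps eps0;
  move/cvgrPdist_le : e0 => /(_ _ eps0); apply: filterS => n;
  rewrite sub0r normrN => /(le_trans (ler_norm _)) /(le_trans (h n)); apply: le_trans;
  rewrite distrC.
  by apply: le_trans (Re_le_cabs _); rewrite cReD cReN.
by apply: le_trans (Im_le_cabs _); rewrite cImD cImN.
Qed.

Lemma ccvg_cabs u l : ccvg u l -> (fun n => cabs (u n - l)) @ \oo --> 0.
Proof.
move=> [u1 u2].
apply: (@squeeze_cvgr _ _ _ _ (cst 0) (fun n =>
   `|complex.Re (u n) - complex.Re l| + `|complex.Im (u n) - complex.Im l|)).
- apply: nearW => n; rewrite cabs_ge0 /=.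
  by rewrite (le_trans (cabs_le_ReIm _)) // cReD cReN cImD cImN.
- exact: cvg_cst.
- have -> : 0 = `|complex.Re l - complex.Re l| + `|complex.Im l - complex.Im l|.
    by rewrite !subrr normr0 addr0.
  by apply: cvgD; apply: cvg_norm; apply: cvgB => //; exact: cvg_cst.
Qed.

Lemma ccvg_le u l (M : R) : ccvg u l -> (forall n, cabs (u n) <= M) -> cabs l <= M.
Proof.
move=> ul uM; apply/ler_addgt0Pl => e e0.
have /cvgrPdist_le /(_ _ e0) [N _ /(_ N (leqnn N))] := ccvg_cabs ul.
rewrite sub0r normrN ger0_norm ?cabs_ge0 // => h.
have -> : l = - (u N - l) + u N by ring.
by rewrite (le_trans (cabsD _ _)) // cabsN lerD.
Qed.

Lemma ccvg_cvg u l : ccvg u l -> (u : nat -> R[i]^o) @ \oo --> (l : R[i]^o).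
Proof.
move=> /ccvg_cabs h; apply/cvgrPdist_lt => -[e e'] /=.
(* In the order of [R[i]], [0 < e] forces the imaginary part of e to be 0, so the tolerance is a
   positive real. *)
rewrite ltcE /= => /andP[/eqP -> e0].
move/cvgrPdist_lt : h => /(_ _ e0); apply: filterS => n.
rewrite sub0r normrN ger0_norm ?cabs_ge0 // => h.
by rewrite distrC normcC ltcR.
Qed.

Lemma cseriesE u l : ccvg (fun N => \sum_(i < N) u i) l -> cseries u = l.
Proof.
move=> h.
have H : series (u : nat -> R[i]^o) @ \oo --> (l : R[i]^o).
  rewrite (_ : series _ = (fun N => \sum_(i < N) u i)); first exact: ccvg_cvg.
  by apply/funext => n; rewrite /series /= big_mkord.
exact: (cvg_lim (@norm_hausdorff _ (R[i]^o)) H).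
Qed.

End ComplexLimits.

(** * Complex-valued integrals and dominated convergence *)

Section ComplexMeasurable.
Context d (T : measurableType d) {R : realType} (D : set T).
Implicit Types (f g : T -> R[i]) (h : T -> R).

Definition cmeas f := measurable_fun D (fun x => complex.Re (f x)) /\
  measurable_fun D (fun x => complex.Im (f x)).

(** [powR] with exponent -1 inverts only nonnegative reals, so it is applied to h^2; then h / h^2 is
    the inverse of h, also where h vanishes, because [0^-1 = 0]. *)
Lemma measurable_inv h : measurable_fun D h -> measurable_fun D (fun x => (h x)^-1).
Proof.
move=> mh; rewrite (_ : (fun x => _) = (fun x => h x * (h x * h x) `^ (-1))).
  apply: measurable_funM => //.
  by apply: (measurableT_comp (measurable_powR (-1))); exact: measurable_funM.
apply/funext => x; rewrite powR_inv1 -?expr2 ?sqr_ge0 // expr2 invfM.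
by have [->|h0] := eqVneq (h x) 0; rewrite ?invr0 ?mul0r // mulrA divff // mul1r.
Qed.

Lemma cmeas_cst c : cmeas (fun=> c).
Proof. by split; exact: measurable_cst. Qed.

Lemma cmeas_real h : measurable_fun D h -> cmeas (fun x => (h x)%:C).
Proof. by move=> mh; split => //=; exact: measurable_cst. Qed.

Lemma cmeasD f g : cmeas f -> cmeas g -> cmeas (fun x => f x + g x).
Proof.
move=> [f1 f2] [g1 g2]; split.
  by under eq_fun do rewrite cReD; exact: measurable_funD.
by under eq_fun do rewrite cImD; exact: measurable_funD.
Qed.

Lemma cmeasM f g : cmeas f -> cmeas g -> cmeas (fun x => f x * g x).
Proof.
move=> [f1 f2] [g1 g2]; split.
  by under eq_fun do rewrite cReM; apply: measurable_funB; exact: measurable_funM.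
by under eq_fun do rewrite cImM; apply: measurable_funD; exact: measurable_funM.
Qed.

Lemma cmeasN f : cmeas f -> cmeas (fun x => - f x).
Proof.
move=> mf; under eq_fun do rewrite -mulN1r.
by apply: cmeasM => //; exact: cmeas_cst.
Qed.

Lemma cmeas_sum (F : nat -> T -> R[i]) n :
  (forall i, cmeas (F i)) -> cmeas (fun x => \sum_(i < n) F i x).
Proof.
move=> mF; elim: n => [|n IH].
  by under eq_fun do rewrite big_ord0; exact: cmeas_cst.
by under eq_fun do rewrite big_ord_recr; exact: cmeasD.
Qed.

Lemma cmeas_cexp f : cmeas f -> cmeas (fun x => cexp (f x)).
Proof.
move=> [f1 f2]; have mcos : measurable_fun setT (@cos R).
  by apply: continuous_measurable_fun; exact: continuous_cos.
have msin : measurable_fun setT (@sin R).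
  by apply: continuous_measurable_fun; exact: continuous_sin.
split => /=; apply: measurable_funM.
- exact: (measurableT_comp (@measurable_expR R) f1).
- exact: (measurableT_comp mcos f2).
- exact: (measurableT_comp (@measurable_expR R) f1).
- exact: (measurableT_comp msin f2).
Qed.

Lemma cmeas_cpow h z : measurable_fun D h -> cmeas (fun x => cpow (h x) z).
Proof.
move=> mh; apply: cmeas_cexp; apply: cmeasM; first exact: cmeas_cst.
by apply: cmeas_real; exact: (measurableT_comp (@measurable_ln R) mh).
Qed.

Lemma cmeas_csinh f : cmeas f -> cmeas (fun x => csinh (f x)).
Proof.
move=> mf; apply: cmeasM; last exact: cmeas_cst.
apply: cmeasD; first exact: cmeas_cexp.
by apply: cmeasN; apply: cmeas_cexp; exact: cmeasN.
Qed.

Lemma cmeas_csin f : cmeas f -> cmeas (fun x => csin (f x)).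
Proof.
move=> mf; apply: cmeasM; last exact: cmeas_cst.
apply: cmeasD; first by apply: cmeas_cexp; apply: cmeasM => //; exact: cmeas_cst.
apply: cmeasN; apply: cmeas_cexp; apply: cmeasN.
by apply: cmeasM => //; exact: cmeas_cst.
Qed.

Lemma cmeas_cabs f : cmeas f -> measurable_fun D (fun x => cabs (f x)).
Proof.
move=> [f1 f2].
rewrite (_ : (fun x => _) =
  fun x => (complex.Re (f x) * complex.Re (f x) + complex.Im (f x) * complex.Im (f x)) `^ 2^-1).
  apply: (measurableT_comp (measurable_powR 2^-1)).
  by apply: measurable_funD; exact: measurable_funM.
apply/funext => x; rewrite powR12_sqrt -?expr2 ?addr_ge0 ?sqr_ge0 //.
by case: (f x).
Qed.

End ComplexMeasurable.

Lemma cmeas_setT d (T : measurableType d) {R : realType} (D : set T) (f : T -> R[i]) :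
  cmeas setT f -> cmeas D f.
Proof. by move=> [f1 f2]; split; exact: measurable_funTS. Qed.

Lemma cmeas_comp d1 d2 (T1 : measurableType d1) (T2 : measurableType d2) {R : realType}
    (f : T2 -> R[i]) (g : T1 -> T2) (D : set T1) :
  cmeas setT f -> measurable_fun D g -> cmeas D (fun x => f (g x)).
Proof. by move=> [f1 f2] mg; split; [exact: (measurableT_comp f1)|exact: (measurableT_comp f2)]. Qed.

Section ComplexIntegral.
Context {R : realType}.
Notation mu := (@lebesgue_measure R).
Implicit Types (f g : R -> R[i]).

Definition rintble D (h : R -> R) := mu.-integrable D (EFin \o h).

Definition cintble D f := rintble D (fun x => complex.Re (f x)) /\
  rintble D (fun x => complex.Im (f x)).

Lemma rintble_le D (h k : R -> R) : measurable D -> measurable_fun D h ->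
  rintble D k -> (forall x, D x -> `|h x| <= k x) -> rintble D h.
Proof.
move=> mD mh ik hk; apply: le_integrable ik => //; first exact/measurable_EFinP.
move=> x Dx; rewrite !abse_EFin lee_fin (le_trans (hk x Dx)) //.
exact: ler_norm.
Qed.

Lemma rintble_meas D (h : R -> R) : rintble D h -> measurable_fun D h.
Proof. by move=> /measurable_int /measurable_EFinP. Qed.

Lemma eq_rintble D (h k : R -> R) : measurable D ->
  (forall x, D x -> h x = k x) -> rintble D h -> rintble D k.
Proof.
move=> mD hk; apply: eq_integrable => // x; rewrite inE => Dx.
by rewrite /= hk.
Qed.

Lemma rintbleZ D (h : R -> R) c : measurable D -> rintble D h ->
  rintble D (fun x => c * h x).
Proof.
rewrite /rintble => mD ih; have H := integrableZl mD c ih; 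
have := @eq_integrable _ _ R mu D mD _ (EFin \o (fun x => c * h x)) _ H; exact.
Qed.

Lemma rintbleD D (h k : R -> R) : measurable D -> rintble D h -> rintble D k ->
  rintble D (fun x => h x + k x).
Proof.
rewrite /rintble => mD ih ik; have H := integrableD mD ih ik; 
have := @eq_integrable _ _ R mu D mD _ (EFin \o (fun x => h x + k x)) _ H; exact.
Qed.

Lemma rintbleB D (h k : R -> R) : measurable D -> rintble D h -> rintble D k ->
  rintble D (fun x => h x - k x).
Proof.
rewrite /rintble => mD ih ik; have H := integrableB mD ih ik; 
have := @eq_integrable _ _ R mu D mD _ (EFin \o (fun x => h x - k x)) _ H; exact.
Qed.

Lemma cintble_meas D f : cintble D f -> cmeas D f.
Proof. by move=> [f1 f2]; split; exact: rintble_meas. Qed.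

Lemma cintble_le D f (k : R -> R) : measurable D -> cmeas D f ->
  rintble D k -> (forall x, D x -> cabs (f x) <= k x) -> cintble D f.
Proof.
move=> mD [f1 f2] ik fk; split; apply: rintble_le ik _ => // x Dx.
  exact: le_trans (Re_le_cabs _) (fk x Dx).
exact: le_trans (Im_le_cabs _) (fk x Dx).
Qed.

Lemma cintble_cabs D f : measurable D -> cintble D f -> rintble D (fun x => cabs (f x)).
Proof.
move=> mD fi; have [f1 f2] := fi.
apply: (@rintble_le D _ (fun x => `|complex.Re (f x)| + `|complex.Im (f x)|)) => //.
- by apply: cmeas_cabs; exact: cintble_meas.
- by apply: rintbleD => //; [exact: integrable_norm f1|exact: integrable_norm f2].
- by move=> x Dx; rewrite ger0_norm ?cabs_ge0 // cabs_le_ReIm.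
Qed.

Lemma eq_cintble D f g : measurable D -> (forall x, D x -> f x = g x) ->
  cintble D f -> cintble D g.
Proof.
by move=> mD fg [f1 f2]; split; [apply: eq_rintble f1|apply: eq_rintble f2] => //
  x Dx; rewrite fg.
Qed.

Lemma cintbleD D f g : measurable D -> cintble D f -> cintble D g ->
  cintble D (fun x => f x + g x).
Proof.
move=> mD [f1 f2] [g1 g2]; split.
  by under eq_fun do rewrite cReD; exact: rintbleD.
by under eq_fun do rewrite cImD; exact: rintbleD.
Qed.

Lemma cintbleZ D f c : measurable D -> cintble D f -> cintble D (fun x => c * f x).
Proof.
move=> mD [f1 f2]; split.
  by under eq_fun do rewrite cReM; apply: rintbleB => //; exact: rintbleZ.
by under eq_fun do rewrite cImM; apply: rintbleD => //; exact: rintbleZ.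
Qed.

Lemma eq_cintegral (D : set R) f g : (forall x, D x -> f x = g x) -> cintegral D f = cintegral D g.
Proof.
move=> fg; rewrite /cintegral; congr (_ +i* _); apply: eq_Rintegral => x;
  by rewrite inE => Dx; rewrite fg.
Qed.

Lemma cintegralD D f g : measurable D -> cintble D f -> cintble D g ->
  cintegral D (fun x => f x + g x) = cintegral D f + cintegral D g.
Proof.
move=> mD [f1 f2] [g1 g2]; rewrite /cintegral; apply: complexP => /=.
  by under eq_Rintegral do rewrite cReD; rewrite RintegralD.
by under eq_Rintegral do rewrite cImD; rewrite RintegralD.
Qed.

Lemma cintegralZ D f c : measurable D -> cintble D f ->
  cintegral D (fun x => c * f x) = c * cintegral D f.
Proof.
move=> mD [f1 f2]; rewrite /cintegral; apply: complexP; rewrite ?cReM ?cImM /=.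
  under eq_Rintegral do rewrite cReM.
  by rewrite RintegralB ?RintegralZl //; exact: rintbleZ.
under eq_Rintegral do rewrite cImM.
by rewrite RintegralD ?RintegralZl //; exact: rintbleZ.
Qed.

Lemma cintegral0 (D : set R) : cintegral D (fun=> 0) = 0 :> R[i].
Proof.
rewrite /cintegral /Rintegral /=.
by rewrite (_ : (fun=> 0%:E) = cst 0%E) // integral0.
Qed.

Lemma cintegral_sum D (F : nat -> R -> R[i]) n : measurable D ->
  (forall i, cintble D (F i)) ->
  cintble D (fun x => \sum_(i < n) F i x) /\
  cintegral D (fun x => \sum_(i < n) F i x) = \sum_(i < n) cintegral D (F i).
Proof.
move=> mD iF; elim: n => [|n [IH1 IH2]].
  under eq_fun do rewrite big_ord0; rewrite big_ord0 cintegral0; split => //.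
  by split; exact: integrable0.
under eq_fun do rewrite big_ord_recr /=; rewrite big_ord_recr /= -IH2.
by split; [exact: cintbleD|rewrite cintegralD].
Qed.

Lemma cintegral_real D (h : R -> R) :
  cintegral D (fun x => (h x)%:C) = (\int[mu]_(x in D) h x)%:C.
Proof.
rewrite /cintegral; congr (_ +i* _); rewrite /Rintegral /=.
by rewrite (_ : (fun=> 0%:E) = cst 0%E) // integral0.
Qed.

(** Real and imaginary parts are bounded separately, whence the factor 2, which is harmless in
    majorants and error terms. *)
Lemma cabs_cintegral D f (k : R -> R) : measurable D -> cintble D f -> rintble D k ->
  (forall x, D x -> cabs (f x) <= k x) ->
  cabs (cintegral D f) <= 2 * \int[mu]_(x in D) k x.
Proof.
move=> mD [f1 f2] ik fk; rewrite (le_trans (cabs_le_ReIm _)) //=.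
rewrite mulr_natl mulr2n; apply: lerD.
  refine (le_trans (le_normr_Rintegral mD f1) _); apply: le_Rintegral => //.
    exact: integrable_norm f1.
  by move=> x Dx; rewrite (le_trans (Re_le_cabs _)) // fk.
refine (le_trans (le_normr_Rintegral mD f2) _); apply: le_Rintegral => //.
  exact: integrable_norm f2.
by move=> x Dx; rewrite (le_trans (Im_le_cabs _)) // fk.
Qed.

Lemma rintegral_lim D (u : nat -> R -> R) (v k : R -> R) : measurable D ->
  (forall n, measurable_fun D (u n)) -> rintble D k ->
  (forall n x, D x -> `|u n x| <= k x) ->
  (forall x, D x -> (fun n => u n x) @ \oo --> v x) ->
  rintble D v /\
  (fun n => \int[mu]_(x in D) u n x) @ \oo --> \int[mu]_(x in D) v x.
Proof.
move=> mD mu_ ik uk uv.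
have mv : measurable_fun D v by apply: measurable_fun_cvg mu_ uv.
have := @dominated_convergence _ _ R mu D mD (fun n => EFin \o u n) (EFin \o v) (EFin \o k).
case => //.
- by move=> n; apply/measurable_EFinP; exact: mu_.
- exact/measurable_EFinP.
- by apply/aeW => x Dx; apply: cvg_EFin; [exact: nearW|exact: uv].
- by apply/aeW => x n Dx; rewrite /= lee_fin uk.
move=> iv _ h; split => //.
have fv : (\int[mu]_(x in D) (EFin \o v) x)%E \is a fin_num by exact: integrable_fin_num.
by move: h; rewrite -(fineK fv) => /fine_cvgP[].

Qed.

Lemma cintegral_lim D (u : nat -> R -> R[i]) f (k : R -> R) : measurable D ->
  (forall n, cmeas D (u n)) -> rintble D k ->
  (forall n x, D x -> cabs (u n x) <= k x) ->
  (forall x, D x -> ccvg (u ^~ x) (f x)) ->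
  cintble D f /\ ccvg (fun n => cintegral D (u n)) (cintegral D f).
Proof.
move=> mD um ik uk uf.
have [i1 c1] : rintble D (fun x => complex.Re (f x)) /\
    (fun n => \int[mu]_(x in D) complex.Re (u n x)) @ \oo -->
      \int[mu]_(x in D) complex.Re (f x).
  apply: (rintegral_lim mD _ ik) => [n|n x Dx|x /uf []//]; first exact: (um n).1.
  exact: le_trans (Re_le_cabs _) (uk n x Dx).
have [i2 c2] : rintble D (fun x => complex.Im (f x)) /\
    (fun n => \int[mu]_(x in D) complex.Im (u n x)) @ \oo -->
      \int[mu]_(x in D) complex.Im (f x).
  apply: (rintegral_lim mD _ ik) => [n|n x Dx|x /uf []//]; first exact: (um n).2.
  exact: le_trans (Im_le_cabs _) (uk n x Dx).
by split; split.
Qed.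

(** Domination is required of the partial sums rather than of the terms, since this is what
    [csinh_sum_le] and [coth_partial_le] provide. *)
Lemma cintegral_series D (F : nat -> R -> R[i]) f (k : R -> R) : measurable D ->
  (forall n, cintble D (F n)) -> rintble D k ->
  (forall n x, D x -> cabs (\sum_(i < n) F i x) <= k x) ->
  (forall x, D x -> ccvg (fun n => \sum_(i < n) F i x) (f x)) ->
  cintble D f /\ ccvg (fun n => \sum_(i < n) cintegral D (F i)) (cintegral D f).
Proof.
move=> mD iF ik Fk Ff.
have [i1 c1] : cintble D f /\
    ccvg (fun n => cintegral D (fun x => \sum_(i < n) F i x)) (cintegral D f).
  apply: (cintegral_lim mD _ ik) => // n.
  by apply: cmeas_sum => i; exact: cintble_meas.
split => //; move: c1; congr ccvg; apply/funext => n.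
by have [_ ->] := cintegral_sum n mD iF.
Qed.

End ComplexIntegral.

(** * Fubini's theorem for iterated integrals over measurable sets *)

Section ComplexFubini.
Context {R : realType}.
Notation mu := (@lebesgue_measure R).

(** Fubini's theorem speaks of inner integrals with values in the extended reals, [Rintegral] of
    their images under [fine]. The two agree almost everywhere because an integrable function is
    finite almost everywhere. *)
Lemma fine_integrable D (G : R -> \bar R) : measurable D -> mu.-integrable D G ->
  rintble D (fun x => fine (G x)) /\
  (\int[mu]_(x in D) fine (G x) = fine (\int[mu]_(x in D) G x)).
Proof.
move=> mD iG; have mG := measurable_int _ iG.
have mfG : measurable_fun D (fun x => fine (G x)).
  exact: (measurableT_comp (fine_measurable measurableT) mG).
split.
  apply: (le_integrable mD _ _ iG); first exact/measurable_EFinP.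
  by move=> x Dx /=; case: (G x) => [r| |] //=; rewrite ?normr0 ?lee_fin ?leey.
congr fine; apply: ae_eq_integral => //; first exact/measurable_EFinP.
by apply: filterS (integrable_ae mD iG) => x /= h Dx; rewrite fineK // h.
Qed.

(** Fubini's theorem is applied on the whole plane to a function cut off outside a rectangle; after
    the inner integration the cutoff survives as an indicator in the outer variable. *)
Lemma integral_indic_prod (D1 D2 : set R) (f : R * R -> R) x :
  (\int[mu]_y (f (x, y) * \1_(D1 `*` D2) (x, y))%:E =
   (\1_D1 x)%:E * \int[mu]_(y in D2) (f (x, y))%:E)%E.
Proof.
rewrite [in RHS]integral_mkcond.
have [xD|xD] := boolP (x \in D1).
  rewrite indicE xD mul1e; apply: eq_integral => y _.
  rewrite /patch indicE in_setX /= xD /=.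
  by case: (y \in D2); rewrite ?mulr1 ?mulr0.
rewrite indicE (negbTE xD) mul0e; under eq_integral => y _.
  rewrite indicE in_setX /= (negbTE xD) mulr0; over.
by rewrite integral0.
Qed.

Lemma integral_indic_prod2 (D1 D2 : set R) (f : R * R -> R) y :
  (\int[mu]_x (f (x, y) * \1_(D1 `*` D2) (x, y))%:E =
   (\1_D2 y)%:E * \int[mu]_(x in D1) (f (x, y))%:E)%E.
Proof.
rewrite [in RHS]integral_mkcond.
have [yD|yD] := boolP (y \in D2).
  rewrite indicE yD mul1e; apply: eq_integral => x _.
  rewrite /patch indicE in_setX /= yD /= andbT.
  by case: (x \in D1); rewrite ?mulr1 ?mulr0.
rewrite indicE (negbTE yD) mul0e; under eq_integral => x _.
  rewrite indicE in_setX /= (negbTE yD) andbF mulr0; over.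
by rewrite integral0.
Qed.

Lemma integrable_indic_mul D (G : R -> \bar R) : measurable D ->
  mu.-integrable setT (fun x => (\1_D x)%:E * G x)%E -> mu.-integrable D G.
Proof.
move=> mD H; have := integrableS measurableT mD (@subsetT _ D) H.
apply: eq_integrable => // x xD; by rewrite indicE xD mul1e.
Qed.

Lemma integral_indic_mul D (G : R -> \bar R) :
  (\int[mu]_x ((\1_D x)%:E * G x) = \int[mu]_(x in D) G x)%E.
Proof.
rewrite [RHS]integral_mkcond; apply: eq_integral => x _.
by rewrite /patch indicE; case: (x \in D); rewrite ?mul1e ?mul0e.
Qed.

(** Tonelli's criterion: as h bounds the inner integrals of the modulus, f times the indicator of
    the rectangle is integrable on the plane. *)
Lemma rfubini D1 D2 (f : R * R -> R) (h : R -> R) :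
  measurable D1 -> measurable D2 -> measurable_fun setT f -> rintble D1 h ->
  (forall x, D1 x -> (\int[mu]_(y in D2) `|(f (x, y))%:E| <= (h x)%:E)%E) ->
  [/\ rintble D1 (fun x => \int[mu]_(y in D2) f (x, y)),
      rintble D2 (fun y => \int[mu]_(x in D1) f (x, y)) &
      \int[mu]_(x in D1) (\int[mu]_(y in D2) f (x, y)) =
      \int[mu]_(y in D2) (\int[mu]_(x in D1) f (x, y))].
Proof.
move=> mD1 mD2 mf ih fh.
pose g (p : R * R) := (f p * \1_(D1 `*` D2) p).
have mg : measurable_fun setT g.
  by apply: measurable_funM => //; apply: measurable_indic; exact: measurableX.
have mEg : measurable_fun setT (EFin \o g) by exact/measurable_EFinP.
have ig : (mu \x mu)%E.-integrable setT (EFin \o g).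
  apply/(@integrable12ltyP _ _ _ _ R mu mu _ mEg).
  have -> : (fun x : R => (\int[mu]_y `|(EFin \o g) (x, y)|)%E) =
            (fun x => ((\1_D1 x)%:E * \int[mu]_(y in D2) (`|f (x, y)|)%:E)%E).
    apply/funext => x; rewrite -(integral_indic_prod _ _ (fun p => `|f p|)).
    apply: eq_integral => y _; rewrite /= normrM; congr (_ * _)%:E.
    by rewrite indicE; case: (_ \in _); rewrite ?normr0 ?normr1.
  rewrite integral_indic_mul.
  apply: (@le_lt_trans _ _ (\int[mu]_(x in D1) (h x)%:E)%E); last first.
    exact: integrable_lty.
  apply: ge0_le_integral => //.
  - by move=> x _; exact: integral_ge0.
  (* Measurability in x of the inner integral of |f| is taken from Tonelli's theorem on the strip of
     all (x, y) with y in [D2]. *)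
  - have m1 : measurable_fun setT (fun p : R * R => (`|f p| * \1_(setT `*` D2) p)%:E).
      apply/measurable_EFinP; apply: measurable_funM.
        exact: (measurableT_comp (@normr_measurable R setT) mf).
      by apply: measurable_indic; exact: measurableX.
    have := measurable_fun_fubini_tonelli_F (m2 := mu) _ m1.
    rewrite /fubini_F => h1; apply: measurable_funTS.
    have -> : (fun x : R => (\int[mu]_(y in D2) `|f (x, y)|%:E)%E) =
      (fun x => \int[mu]_y (`|f (x, y)| * \1_(setT `*` D2) (x, y))%:E)%E.
      apply/funext => x; rewrite (integral_indic_prod _ _ (fun p => `|f p|)).
      by rewrite indicT mul1e.
    by apply: h1 => p; rewrite lee_fin mulr_ge0 // indicE ler0n.
  - exact: measurable_int ih.
have F1 := integrable_fubini_F ig.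
(* [integrable_fubini_F] treats integration over the second coordinate; exchanging the coordinates
   of g gives the statement about the other inner integral. *)
have mEg' : measurable_fun setT (fun p : R * R => (g (p.2, p.1))%:E).
  apply/measurable_EFinP; apply: (measurableT_comp mg).
  exact: measurable_fun_pair measurable_snd measurable_fst.
have ig' : (mu \x mu)%E.-integrable setT (fun p : R * R => (g (p.2, p.1))%:E).
  apply/(@integrable12ltyP _ _ _ _ R mu mu _ mEg').
  exact: (@integrable21ltyP _ _ _ _ R mu mu _ mEg).1 ig.
have F2 := integrable_fubini_F ig'.
have FE := Fubini ig.
have F1' : mu.-integrable setT (fun x => ((\1_D1 x)%:E * \int[mu]_(y in D2) (f (x, y))%:E)%E).
  by apply: eq_integrable F1 => // x _; rewrite /fubini_F /= integral_indic_prod.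
have F2' : mu.-integrable setT (fun y => ((\1_D2 y)%:E * \int[mu]_(x in D1) (f (x, y))%:E)%E).
  by apply: eq_integrable F2 => // y _; rewrite /fubini_F /= integral_indic_prod2.
have [I1 J1] := fine_integrable mD1 (integrable_indic_mul mD1 F1').
have [I2 J2] := fine_integrable mD2 (integrable_indic_mul mD2 F2').
split => //; rewrite [LHS]J1 [RHS]J2; congr fine.
rewrite -integral_indic_mul -[RHS]integral_indic_mul.
transitivity (\int[mu]_x \int[mu]_y (EFin \o g) (x, y))%E.
  by apply: eq_integral => x _; rewrite /= integral_indic_prod.
rewrite FE; apply: eq_integral => y _.
by rewrite /= integral_indic_prod2.
Qed.

Lemma cfubini D1 D2 (F : R -> R -> R[i]) (h : R -> R) :
  measurable D1 -> measurable D2 -> cmeas setT (fun p : R * R => F p.1 p.2) -> rintble D1 h ->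
  (forall x, D1 x -> (\int[mu]_(y in D2) (cabs (F x y))%:E <= (h x)%:E)%E) ->
  [/\ cintble D1 (fun x => cintegral D2 (F x)),
      cintble D2 (fun y => cintegral D1 (F ^~ y)) &
      cintegral D1 (fun x => cintegral D2 (F x)) =
      cintegral D2 (fun y => cintegral D1 (F ^~ y))].
Proof.
move=> mD1 mD2 mF ih Fh; have [mF1 mF2] := mF.
have mFx x : cmeas D2 (F x).
  apply: (@cmeas_comp _ _ _ _ _ (fun p => F p.1 p.2) (fun y => (x, y))) => //.
  by apply: measurable_funTS; exact: pair1_measurable.
have [|I1 I2 I3] := rfubini mD1 mD2 mF1 ih.
  move=> x Dx; apply: le_trans (Fh x Dx); apply: ge0_le_integral => //.
  - by apply/measurable_EFinP; apply: (measurableT_comp (@normr_measurable R setT)); exact: (mFx x).1.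
  - by apply/measurable_EFinP; exact: cmeas_cabs.
  - by move=> y _; rewrite lee_fin Re_le_cabs.
have [|J1 J2 J3] := rfubini mD1 mD2 mF2 ih.
  move=> x Dx; apply: le_trans (Fh x Dx); apply: ge0_le_integral => //.
  - by apply/measurable_EFinP; apply: (measurableT_comp (@normr_measurable R setT)); exact: (mFx x).2.
  - by apply/measurable_EFinP; exact: cmeas_cabs.
  - by move=> y _; rewrite lee_fin Im_le_cabs.
split => //.
by rewrite /cintegral /=; congr (_ +i* _).
Qed.

(** Serves wherever a majorant separates; the kernel e^(-t r) in [stieltjes] does not, and calls for
    [cfubini] itself. *)
Lemma cfubini_prod D1 D2 (F : R -> R -> R[i]) (g1 g2 : R -> R) :
  measurable D1 -> measurable D2 -> cmeas setT (fun p : R * R => F p.1 p.2) ->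
  rintble D1 g1 -> rintble D2 g2 ->
  (forall x y, D1 x -> D2 y -> cabs (F x y) <= g1 x * g2 y) ->
  [/\ cintble D1 (fun x => cintegral D2 (F x)),
      cintble D2 (fun y => cintegral D1 (F ^~ y)) &
      cintegral D1 (fun x => cintegral D2 (F x)) =
      cintegral D2 (fun y => cintegral D1 (F ^~ y))].
Proof.
move=> mD1 mD2 mF i1 i2 Fg.
apply: (cfubini (h := fun x => (\int[mu]_(y in D2) g2 y) * g1 x)) => //.
  exact: rintbleZ.
move=> x Dx; rewrite mulrC -RintegralZl //.
have iF : rintble D2 (fun y => g1 x * g2 y) by exact: rintbleZ.
rewrite /Rintegral fineK; last exact: integrable_fin_num.
apply: ge0_le_integral => //.
- by move=> y _; rewrite lee_fin cabs_ge0.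
- apply/measurable_EFinP; apply: cmeas_cabs.
  apply: (@cmeas_comp _ _ _ _ _ (fun p => F p.1 p.2) (fun y => (x, y))) => //.
  by apply: measurable_funTS; exact: pair1_measurable.
- exact: measurable_int iF.
- by move=> y Dy; rewrite lee_fin Fg.
Qed.

End ComplexFubini.

(** * Substitution and improper integrals *)

Section Continuity.
Context {R : realType}.
Implicit Types (f g : R -> R[i]) (h : R -> R) (x : R).

Definition ccont f x := ((fun y => complex.Re (f y)) @ x --> complex.Re (f x)) /\
  ((fun y => complex.Im (f y)) @ x --> complex.Im (f x)).

Lemma ccont_cst c x : ccont (fun=> c) x.
Proof. by split; exact: cvg_cst. Qed.

Lemma ccont_real h x : {for x, continuous h} -> ccont (fun y => (h y)%:C) x.
Proof. by split => //; exact: cvg_cst. Qed.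

Lemma ccontD f g x : ccont f x -> ccont g x -> ccont (fun y => f y + g y) x.
Proof.
move=> [f1 f2] [g1 g2]; split; rewrite ?cReD ?cImD.
  by under eq_fun do rewrite cReD; exact: cvgD.
by under eq_fun do rewrite cImD; exact: cvgD.
Qed.

Lemma ccontM f g x : ccont f x -> ccont g x -> ccont (fun y => f y * g y) x.
Proof.
move=> [f1 f2] [g1 g2]; split; rewrite ?cReM ?cImM.
  by under eq_fun do rewrite cReM; apply: cvgB; exact: cvgM.
by under eq_fun do rewrite cImM; apply: cvgD; exact: cvgM.
Qed.

Lemma ccont_cexp f x : ccont f x -> ccont (fun y => cexp (f y)) x.
Proof.
move=> [f1 f2]; split => /=; apply: cvgM; apply: continuous_cvg => //.
- exact: continuous_expR.
- exact: continuous_cos.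
- exact: continuous_expR.
- exact: continuous_sin.
Qed.

Lemma ccont_cpow h z x : 0 < h x -> {for x, continuous h} ->
  ccont (fun y => cpow (h y) z) x.
Proof.
move=> h0 ch; apply: ccont_cexp; apply: ccontM; first exact: ccont_cst.
by apply: ccont_real; apply: (continuous_comp ch); exact: continuous_ln.
Qed.

End Continuity.

Section Substitution.
Context {R : realType}.
Notation mu := (@lebesgue_measure R).
Variables (phi phi' psi : R -> R) (a b : R).
Hypothesis dphi : forall x : R, is_derive x (1 : R) phi (phi' x).
Hypothesis cphi' : continuous phi'.
Hypothesis incr : {in `]a, +oo[ &, {homo phi : x y / x < y}}.
Hypothesis phib : forall x, a < x -> b < phi x.
Hypothesis phi'0 : forall x, a < x -> 0 <= phi' x.
Hypothesis psia : forall y, b < y -> a < psi y.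
Hypothesis psiK : forall y, b < y -> phi (psi y) = y.

Let cphi : continuous phi.
Proof. by move=> x; apply: differentiable_continuous; apply/derivable1_diffP. Qed.

Let phi1E : derive1 phi = phi'.
Proof. by apply/funext => x; rewrite derive1E; exact: derive_val. Qed.

Let psi_lt y z : b < y -> y < z -> psi y < psi z.
Proof.
move=> yb yz; have zb := lt_trans yb yz.
rewrite ltNge le_eqVlt; apply/negP => /orP[/eqP E|h].
  by move: yz; rewrite -(psiK yb) -(psiK zb) E ltxx.
have := incr _ _ h; rewrite !in_itv /= !andbT !psia // => /(_ erefl erefl).
by rewrite !psiK // ltNge ltW.
Qed.

(** The segments from [yn n] to [zn n] exhaust the half-line beyond b, and those between their
    images under psi exhaust the one beyond a. The shift by 2 in [zn] keeps [yn 0 < zn 0]. *)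
Let yn n : R := b + n.+1%:R^-1.
Let zn n : R := b + n.+2%:R.

Let ynb n : b < yn n. Proof. by rewrite ltrDl invr_gt0. Qed.
Let ynzn n : yn n < zn n.
Proof.
rewrite ltrD2l (@le_lt_trans _ _ 1) ?ltr1n //.
by rewrite invf_le1 ?ler1n.
Qed.
Let znb n : b < zn n. Proof. exact: lt_trans (ynb n) (ynzn n). Qed.
Let ynS n m : (n <= m)%N -> yn m <= yn n.
Proof. by move=> nm; rewrite lerD2l lef_pV2 ?posrE // ler_nat. Qed.
Let znS n m : (n <= m)%N -> zn n <= zn m.
Proof. by move=> nm; rewrite lerD2l ler_nat ltnS. Qed.

Let psi_le y z : b < y -> y <= z -> psi y <= psi z.
Proof. by move=> yb; rewrite le_eqVlt => /orP[/eqP -> //|/(psi_lt yb)/ltW]. Qed.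

Let in_yz y : b < y -> exists n, yn n <= y <= zn n.
Proof.
move=> yb; have y0 : 0 < y - b by rewrite subr_gt0.
pose n := maxn (Num.truncn (y - b)^-1) (Num.truncn (y - b)).
exists n; apply/andP; split.
  rewrite /yn -lerBrDl -[leRHS]invrK lef_pV2 ?posrE ?invr_gt0 //.
  rewrite ltW // (lt_le_trans (truncnS_gt _)) // ler_nat ltnS leq_maxl //.
rewrite /zn -lerBlDl ltW // (lt_le_trans (truncnS_gt _)) // ler_nat.
by rewrite ltnS leqW // leq_maxr.
Qed.

(** Substitution on each segment of the exhaustion, then monotone convergence on both sides. The
    values are extended reals, so that [rsubst] can deduce integrability from this equality. *)
Lemma ge0_subst (G : R -> R) : {in `]b, +oo[, continuous G} ->
  (forall y, b < y -> 0 <= G y) ->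
  (\int[mu]_(y in `]b, +oo[) (G y)%:E = \int[mu]_(x in `]a, +oo[) (phi' x * G (phi x))%:E)%E.
Proof.
move=> cG G0.
have mG : measurable_fun `]b, +oo[ G.
  by apply: open_continuous_measurable_fun => // x; rewrite inE; exact: cG.
have mH : measurable_fun `]a, +oo[ (fun x => phi' x * G (phi x)).
  apply: open_continuous_measurable_fun => // x; rewrite inE /= in_itv /= andbT => ax.
  apply: continuousM; first exact: cphi'.
  apply: continuous_comp; first exact: cphi.
  by apply: cG; rewrite in_itv /= andbT phib.
have EA : `]b, +oo[%classic = \bigcup_n `[yn n, zn n]%classic.
  apply/seteqP; split => x /=; rewrite in_itv /= andbT.
    by move=> /in_yz [n h]; exists n => //=; rewrite in_itv.
  by move=> [n _] /=; rewrite in_itv /= => /andP[h _]; exact: lt_le_trans (ynb n) h.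
have EB : `]a, +oo[%classic = \bigcup_n `[psi (yn n), psi (zn n)]%classic.
  apply/seteqP; split => x /=; rewrite in_itv /= andbT.
    move=> ax; have [n /andP[h1 h2]] := in_yz (phib ax).
    exists n => //=; rewrite in_itv /= !leNgt; apply/andP; split; apply/negP => h.
      have := incr _ _ h; rewrite !in_itv /= !andbT ax psia // psiK //.
      by move=> /(_ erefl erefl); rewrite ltNge h1.
    have := incr _ _ h; rewrite !in_itv /= !andbT ax psia // psiK //.
    by move=> /(_ erefl erefl); rewrite ltNge h2.
  move=> [n _] /=; rewrite in_itv /= => /andP[h _].
  exact: lt_le_trans (psia (ynb n)) h.
have H1 : (\int[mu]_(x in `[yn n, zn n]) (G x)%:E)%E @[n --> \oo] -->
    (\int[mu]_(x in `]b, +oo[) (G x)%:E)%E.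
  rewrite EA; apply: ge0_nondecreasing_set_cvg_integral => //.
  - move=> n m nm; apply/subsetPset => x /=; rewrite !in_itv /= => /andP[h1 h2].
    by rewrite (le_trans (ynS nm) h1) (le_trans h2 (znS nm)).
  - move=> n; apply/measurable_EFinP; apply: measurable_funS mG => //.
    by rewrite EA; move=> x ?; exists n.
  - move=> n x /=; rewrite in_itv /= => /andP[h _]; rewrite lee_fin G0 //.
    exact: lt_le_trans (ynb n) h.
have H2 : (\int[mu]_(x in `[psi (yn n), psi (zn n)]) (phi' x * G (phi x))%:E)%E @[n --> \oo] -->
    (\int[mu]_(x in `]a, +oo[) (phi' x * G (phi x))%:E)%E.
  rewrite EB; apply: ge0_nondecreasing_set_cvg_integral => //.
  - move=> n m nm; apply/subsetPset => x /=; rewrite !in_itv /= => /andP[h1 h2].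
    rewrite (le_trans _ h1) ?(le_trans h2) ?psi_le ?znS ?ynS //.
  - move=> n; apply/measurable_EFinP; apply: measurable_funS mH => //.
    by rewrite EB; move=> x ?; exists n.
  - move=> n x /=; rewrite in_itv /= => /andP[h _].
    have ax : a < x by exact: lt_le_trans (psia (ynb n)) h.
    by rewrite lee_fin mulr_ge0 ?phi'0 ?G0 ?phib.
suff E : (fun n => \int[mu]_(x in `[yn n, zn n]) (G x)%:E)%E =
    (fun n => \int[mu]_(x in `[psi (yn n), psi (zn n)]) (phi' x * G (phi x))%:E)%E.
  by rewrite E in H1; exact: (cvg_unique _ H1 H2).
apply/funext => n.
have lt1 := psi_lt (ynb n) (ynzn n).
rewrite -{1}(psiK (ynb n)) -{1}(psiK (znb n)).
rewrite (@integration_by_substitution_increasing _ phi G (psi (yn n)) (psi (zn n))) ?ltW //.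
- by apply: eq_integral => x _; rewrite phi1E /= mulrC.
- move=> x y; rewrite !in_itv /= => /andP[x1 _] /andP[y1 _]; apply: incr;
    rewrite in_itv /= andbT; [exact: lt_le_trans (psia (ynb n)) x1|
                              exact: lt_le_trans (psia (ynb n)) y1].
- by move=> x _; rewrite phi1E; exact: cphi'.
- by rewrite phi1E; apply/cvg_ex; eexists; apply: cvg_at_right_filter; exact: cphi'.
- by rewrite phi1E; apply/cvg_ex; eexists; apply: cvg_at_left_filter; exact: cphi'.
- split.
  + by move=> x _; exact: (@ex_derive _ _ _ _ _ _ _ (dphi x)).
  + by apply: cvg_at_right_filter; exact: cphi.
  + by apply: cvg_at_left_filter; exact: cphi.
- apply: continuous_in_subspaceT => x; rewrite inE /= in_itv /= !psiK // => /andP[h _].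
  by apply: cG; rewrite in_itv /= andbT; exact: lt_le_trans (ynb n) h.
Qed.

Lemma rsubst (h : R -> R) : {in `]b, +oo[, continuous h} -> rintble `]b, +oo[ h ->
  rintble `]a, +oo[ (fun x => phi' x * h (phi x)) /\
  \int[mu]_(y in `]b, +oo[) h y = \int[mu]_(x in `]a, +oo[) (phi' x * h (phi x)).
Proof.
move=> ch ih.
have cabs_h : {in `]b, +oo[, continuous (fun y => `|h y|)}.
  by move=> y /ch; apply: cvg_norm.
have mH : measurable_fun `]a, +oo[ (fun x => phi' x * h (phi x)).
  apply: open_continuous_measurable_fun => // x; rewrite inE /= in_itv /= andbT => ax.
  apply: continuousM; first exact: cphi'.
  apply: continuous_comp; first exact: cphi.
  by apply: ch; rewrite in_itv /= andbT phib.
have iabs : rintble `]a, +oo[ (fun x => phi' x * `|h (phi x)|).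
  apply/integrableP; split.
    apply/measurable_EFinP; apply: open_continuous_measurable_fun => // x.
    rewrite inE /= in_itv /= andbT => ax.
    have H : (fun y => `|h (phi y)|) @ x --> `|h (phi x)|.
      apply: cvg_norm; apply: (continuous_comp (@cphi x)).
      by apply: ch; rewrite in_itv /= andbT phib.
    exact: cvgM (@cphi' x) H.
  have /integrableP[_] := integrable_norm ih.
  apply: le_lt_trans; rewrite le_eqVlt; apply/orP; left; apply/eqP.
  transitivity (\int[mu]_(y in `]b, +oo[) `|h y|%:E)%E; last first.
    by apply: eq_integral => y _; rewrite /= normr_id.
  rewrite (ge0_subst cabs_h) //; apply: eq_integral => x.
  rewrite inE /= in_itv /= andbT => ax.
  by rewrite ger0_norm // mulr_ge0 // phi'0.
have iH : rintble `]a, +oo[ (fun x => phi' x * h (phi x)).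
  apply: rintble_le iabs _ => // x; rewrite /= in_itv /= andbT => ax.
  by rewrite normrM (ger0_norm (phi'0 ax)).
split => //.
have ih' : rintble `]b, +oo[ (fun y => `|h y|) by exact: integrable_norm ih.
(* |h| + h and |h| are nonnegative and continuous, so [ge0_subst] applies to each. *)
have -> : \int[mu]_(y in `]b, +oo[) h y =
   \int[mu]_(y in `]b, +oo[) (`|h y| + h y) - \int[mu]_(y in `]b, +oo[) `|h y|.
  by rewrite RintegralD // addrC addKr.
have -> : \int[mu]_(x in `]a, +oo[) (phi' x * h (phi x)) =
   \int[mu]_(x in `]a, +oo[) (phi' x * (`|h (phi x)| + h (phi x))) -
   \int[mu]_(x in `]a, +oo[) (phi' x * `|h (phi x)|).
  under [X in X - _]eq_Rintegral do rewrite mulrDr.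
  by rewrite RintegralD // addrC addKr.
congr (_ - _); congr fine; apply: ge0_subst => // y.
  by move=> yb; exact: cvgD (cabs_h y yb) (ch y yb).
by move=> _; rewrite -lerBlDr sub0r -normrN ler_norm.
Qed.

Lemma csubst (f : R -> R[i]) : (forall y, b < y -> ccont f y) -> cintble `]b, +oo[ f ->
  cintble `]a, +oo[ (fun x => (phi' x)%:C * f (phi x)) /\
  cintegral `]b, +oo[ f = cintegral `]a, +oo[ (fun x => (phi' x)%:C * f (phi x)).
Proof.
move=> cf [f1 f2].
have c1 : {in `]b, +oo[, continuous (fun y => complex.Re (f y))}.
  by move=> y; rewrite in_itv /= andbT => /cf[].
have c2 : {in `]b, +oo[, continuous (fun y => complex.Im (f y))}.
  by move=> y; rewrite in_itv /= andbT => /cf[].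
have [i1 e1] := rsubst c1 f1.
have [i2 e2] := rsubst c2 f2.
split.
  split.
    rewrite (_ : (fun x => _) = (fun x => phi' x * complex.Re (f (phi x)))) //.
    by apply/funext => x; rewrite cReM /= mul0r subr0.
  rewrite (_ : (fun x => _) = (fun x => phi' x * complex.Im (f (phi x)))) //.
  by apply/funext => x; rewrite cImM /= mul0r addr0.
rewrite /cintegral e1 e2; congr (_ +i* _); apply: eq_Rintegral => x _.
  by rewrite cReM /= mul0r subr0.
by rewrite cImM /= mul0r addr0.
Qed.

End Substitution.

Section ImproperFTC.
Context {R : realType}.
Notation mu := (@lebesgue_measure R).

Lemma ftc_segment (F f : R -> R) (y z : R) : 0 < y -> y < z ->
  (forall x : R, 0 < x -> is_derive x (1 : R) F (f x)) -> {in `]0, +oo[, continuous f} ->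
  (\int[mu]_(x in `[y, z]) (f x)%:E = (F z - F y)%:E)%E.
Proof.
move=> y0 yz dF cf; have z0 := lt_trans y0 yz.
have cF x : 0 < x -> {for x, continuous F}.
  move=> x0; apply: differentiable_continuous; apply/derivable1_diffP.
  exact: (@ex_derive _ _ _ _ _ _ _ (dF x x0)).
rewrite (@continuous_FTC2 _ f F) //.
- apply: continuous_in_subspaceT => x; rewrite inE /= in_itv /= => /andP[h _].
  by apply: cf; rewrite in_itv /= andbT (lt_le_trans y0).
- split.
  + move=> x; rewrite in_itv /= => /andP[h _].
    exact: (@ex_derive _ _ _ _ _ _ _ (dF x (lt_trans y0 h))).
  + by apply: cvg_at_right_filter; exact: cF.
  + by apply: cvg_at_left_filter; exact: cF.
- move=> x; rewrite in_itv /= => /andP[h _].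
  have dFx := dF x (lt_trans y0 h).
  by rewrite derive1E; exact: derive_val.
Qed.

Let yn n : R := n.+1%:R^-1.
Let zn n : R := n.+2%:R.

Let yn0 n : 0 < yn n. Proof. by rewrite invr_gt0. Qed.
Let ynzn n : yn n < zn n.
Proof. by rewrite (@le_lt_trans _ _ 1) ?ltr1n // invf_le1 ?ler1n. Qed.

Let in_yz y : 0 < y -> \forall n \near \oo, yn n <= y <= zn n.
Proof.
move=> y0; exists (maxn (Num.truncn y^-1) (Num.truncn y)) => // n /= hn.
apply/andP; split.
  rewrite /yn -[leRHS]invrK lef_pV2 ?posrE ?invr_gt0 //.
  rewrite ltW // (lt_le_trans (truncnS_gt _)) // ler_nat ltnS.
  by apply: leq_trans hn; rewrite leq_maxl.
rewrite /zn ltW // (lt_le_trans (truncnS_gt _)) // ler_nat ltnS leqW //.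
by apply: leq_trans hn; rewrite leq_maxr.
Qed.

Let cvg_trunc (f : R -> R) : measurable_fun (`]0, +oo[%classic : set R) f -> rintble `]0, +oo[ f ->
  (fun n => \int[mu]_(x in `]0, +oo[) (f x * \1_(`[yn n, zn n]%classic) x)) @ \oo -->
  \int[mu]_(x in `]0, +oo[) f x.
Proof.
move=> mf fi; apply: (rintegral_lim _ _ (integrable_norm fi) _ _).2 => //.
- by move=> n; apply: measurable_funM => //; exact: measurable_indic.
- move=> n x _ /=; rewrite normrM ler_piMr // indicE.
  by case: (_ \in _); rewrite ?normr1 ?normr0.
- move=> x; rewrite /= in_itv /= andbT => /in_yz h.
  apply: cvg_near_cst; move: h; apply: filterS => n h.
  by rewrite indicE mem_set ?mulr1 //= in_itv.
Qed.

Let trunc_integral (F f : R -> R) n :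
  (forall x : R, 0 < x -> is_derive x (1 : R) F (f x)) -> {in `]0, +oo[, continuous f} ->
  (\int[mu]_(x in `]0%R, +oo[) (f x * \1_(`[yn n, zn n]%classic) x)%:E =
   (F (zn n) - F (yn n))%:E)%E.
Proof.
move=> dF cf; rewrite -(ftc_segment (yn0 n) (ynzn n) dF cf).
rewrite integral_mkcond [RHS]integral_mkcond; apply: eq_integral => x _.
rewrite /patch indicE.
have [|h] := boolP (x \in `[yn n, zn n]%classic); last by rewrite mulr0; case: ifP.
rewrite mulr1 => /[!inE] /=; rewrite in_itv /= => /andP[h _].
by rewrite mem_set //= in_itv /= andbT (lt_le_trans (yn0 n)).
Qed.

(** With f integrable, dominated convergence identifies its integral with the limit over the
    segments from 1 / (n + 1) to n + 2, so F is examined along these two sequences only. *)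
Lemma rftc0y (F f : R -> R) l :
  (forall x : R, 0 < x -> is_derive x (1 : R) F (f x)) -> {in `]0, +oo[, continuous f} ->
  rintble `]0, +oo[ f ->
  (fun n => F n.+2%:R - F n.+1%:R^-1) @ \oo --> l ->
  \int[mu]_(x in `]0, +oo[) f x = l.
Proof.
move=> dF cf fi Fl.
have mf : measurable_fun (`]0, +oo[%classic : set R) f.
  by apply: open_continuous_measurable_fun => // x; rewrite inE; exact: cf.
have := cvg_trunc mf fi; rewrite (_ : (fun n => _) = (fun n => F n.+2%:R - F n.+1%:R^-1)).
  by move=> h; exact: (cvg_unique _ h Fl).
by apply/funext => n; rewrite /Rintegral (trunc_integral n dF cf).
Qed.

(** Each truncated integral is a difference of two values of F in [0, M], hence at most M, and
    monotone convergence keeps the bound. *)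
Lemma ge0_ftc_intble (F f : R -> R) (M : R) :
  (forall x : R, 0 < x -> is_derive x (1 : R) F (f x)) -> {in `]0, +oo[, continuous f} ->
  (forall x, 0 < x -> 0 <= f x) -> (forall x, 0 < x -> 0 <= F x <= M) ->
  rintble `]0, +oo[ f.
Proof.
move=> dF cf f0 FM.
have mf : measurable_fun (`]0, +oo[%classic : set R) f.
  by apply: open_continuous_measurable_fun => // x; rewrite inE; exact: cf.
apply/integrableP; split; first exact/measurable_EFinP.
apply: (@le_lt_trans _ _ M%:E); last exact: ltry.
have -> : (\int[mu]_(x in `]0%R, +oo[) `|(EFin \o f) x|)%E = (\int[mu]_(x in `]0%R, +oo[) (f x)%:E)%E.
  apply: eq_integral => x; rewrite inE /= in_itv /= andbT => x0.
  by rewrite ger0_norm ?f0.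
have EA : `]0, +oo[%classic = \bigcup_n `[yn n, zn n]%classic.
  apply/seteqP; split => x /=; rewrite in_itv /= andbT.
    by move=> /in_yz [n _ /(_ n (leqnn n)) h]; exists n => //=; rewrite in_itv.
  by move=> [n _] /=; rewrite in_itv /= => /andP[h _]; exact: lt_le_trans (yn0 n) h.
have H1 : (\int[mu]_(x in `[yn n, zn n]) (f x)%:E)%E @[n --> \oo] -->
    (\int[mu]_(x in `]0%R, +oo[) (f x)%:E)%E.
  rewrite EA; apply: ge0_nondecreasing_set_cvg_integral => //.
  - move=> n m nm; apply/subsetPset => x /=; rewrite !in_itv /= => /andP[h1 h2].
    rewrite (le_trans _ h1) ?(le_trans h2) // ?ler_nat ?ltnS //.
    by rewrite lef_pV2 ?posrE // ler_nat.
  - move=> n; apply/measurable_EFinP; apply: measurable_funS mf => //.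
    by rewrite EA; move=> x ?; exists n.
  - move=> n x /=; rewrite in_itv /= => /andP[h _]; rewrite lee_fin f0 //.
    exact: lt_le_trans (yn0 n) h.
apply: (@closed_cvg _ _ _ _ _ (fun x => (x <= M%:E)%E) _ _ _ H1).
  exact: closed_ereal_ge_ereal.
apply: nearW => n; rewrite (ftc_segment (yn0 n) (ynzn n) dF cf) lee_fin.
have /andP[h1 h2] := FM _ (yn0 n).
have /andP[h3 h4] := FM _ (lt_trans (yn0 n) (ynzn n)).
by rewrite lerBlDr (le_trans h4) // lerDl.
Qed.

End ImproperFTC.

(** * The Gamma function *)

Notation pos R := (`]0%R, +oo[%classic : set R).

Section GammaFunction.
Context {R : realType}.
Notation mu := (@lebesgue_measure R).
Implicit Types (t q c : R) (z w : R[i]) (n : nat).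

Lemma posP t : pos R t -> 0 < t.
Proof. by rewrite /= in_itv /= andbT. Qed.

Lemma is_derive_mul (f g : R -> R) (t df dg : R) :
  is_derive t (1 : R) f df -> is_derive t (1 : R) g dg ->
  is_derive t (1 : R) (fun x => f x * g x) (df * g t + f t * dg).
Proof.
move=> hf hg; have H := is_deriveM hf hg.
by apply: (is_derive_eq H); rewrite /GRing.scale /= addrC [df * _]mulrC.
Qed.

Lemma is_derive_scale (f : R -> R) (t c df : R) :
  is_derive t (1 : R) f df -> is_derive t (1 : R) (fun x => c * f x) (c * df).
Proof. by move=> hf; have H := is_deriveZ c hf. Qed.

Lemma is_derive_expRN t : is_derive t (1 : R) (fun x => expR (- x)) (- expR (- t)).
Proof.
have h1 : is_derive t (1 : R) (fun x : R => - x) (- 1).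
  exact: (is_deriveN (is_derive_id t (1 : R))).
have H := @is_derive1_comp R expR (fun x => - x) t _ _ (is_derive_expR (- t)) h1.
by apply: (is_derive_eq H); rewrite mulrN1.
Qed.

Lemma is_derive_cpow z t : 0 < t ->
  is_derive t (1 : R) (fun r => complex.Re (cpow r z)) (complex.Re (z * cpow t (z - 1))) /\
  is_derive t (1 : R) (fun r => complex.Im (cpow r z)) (complex.Im (z * cpow t (z - 1))).
Proof.
move=> t0; case: z => x y.
have hl (c : R) : is_derive t (1 : R) (fun r => c * ln r) (c * t^-1).
  by apply: is_derive_scale; exact: is_derive1_ln.
have he := @is_derive1_comp R expR (fun r => x * ln r) t _ _ (is_derive_expR (x * ln t)) (hl x).
have hc := @is_derive1_comp R cos (fun r => y * ln r) t _ _ (is_derive_cos (y * ln t)) (hl y).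
have hs := @is_derive1_comp R sin (fun r => y * ln r) t _ _ (is_derive_sin (y * ln t)) (hl y).
have E : cpow t (x +i* y - 1) = cpow t (x +i* y) * (t^-1)%:C.
  by rewrite cpowD cpowN cpow1 // fmorphV.
have E1 : (fun r => complex.Re (cpow r (x +i* y))) = (fun r => expR (x * ln r) * cos (y * ln r)).
  by apply/funext => r; rewrite /cpow /= !mulr0 subr0 add0r.
have E2 : (fun r => complex.Im (cpow r (x +i* y))) = (fun r => expR (x * ln r) * sin (y * ln r)).
  by apply/funext => r; rewrite /cpow /= !mulr0 subr0 add0r.
rewrite E1 E2 E /cpow /= !mulr0 !subr0 ?add0r ?addr0.
split.
  by apply: (is_derive_eq (is_derive_mul he hc)); rewrite /=; ring.
by apply: (is_derive_eq (is_derive_mul he hs)); rewrite /=; ring.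
Qed.

(* [(t / (1 + t)) ^ (q + 1)] is a bounded primitive of a function that
   dominates the integrand up to a constant. *)
Lemma gamma_rintble q : -1 < q -> rintble (pos R) (fun t => t `^ q * expR (- t)).
Proof.
move=> q1; have M1 : 1 < q + 2 by lra.
have q10 : 0 < q + 1 by lra.
pose F t : R := (1 - (1 + t)^-1) `^ (q + 1).
pose f t : R := (q + 1) * (1 - (1 + t)^-1) `^ q * (1 + t)^-1 ^+ 2.
have g0 t : 0 < t -> 0 < 1 - (1 + t)^-1.
  by move=> t0; rewrite subr_gt0 invf_lt1 ?ltrDl // addr_gt0.
have gE t : 0 < t -> 1 - (1 + t)^-1 = t * (1 + t)^-1.
  by move=> t0; field; rewrite gt_eqF // addr_gt0.
have dF : forall t, 0 < t -> is_derive t (1 : R) F (f t).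
  move=> t t0; have t1 : 1 + t != 0 by rewrite gt_eqF // addr_gt0.
  have h1 : is_derive t (1 : R) (fun x => 1 + x) 1.
    have H : is_derive t (1 : R) ((cst 1 : R -> R) + id) (0 + 1).
      exact: is_deriveD.
    by rewrite add0r in H.
  have h2 := is_deriveV t1 h1.
  have h3 : is_derive t (1 : R) (fun x => 1 - (1 + x)^-1) ((1 + t) ^- 2).
    have H : is_derive t (1 : R) ((cst 1 : R -> R) - (fun x => (1 + x)^-1))
        (0 - (- (1 + t) ^- 2 *: 1)) by exact: is_deriveB.
    by apply: (is_derive_eq H); rewrite sub0r /GRing.scale /= mulr1 opprK.
  have h4 := @is_derive1_comp R (fun y => y `^ (q + 1)) (fun x => 1 - (1 + x)^-1) t _ _
    (is_derive1_powR (q + 1) (g0 t t0)) h3.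
  by apply: (is_derive_eq h4); rewrite /f addrK exprVn.
have cf : {in `]0, +oo[, continuous f}.
  move=> t; rewrite in_itv /= andbT => t0.
  have t1 : 1 + t != 0 by rewrite gt_eqF // addr_gt0.
  have c1 : (fun x : R => (1 + x)^-1) @ t --> (1 + t)^-1.
    by apply: cvgV => //; apply: cvgD; [exact: cvg_cst|exact: cvg_id].
  have c2 : (fun x : R => 1 - (1 + x)^-1) @ t --> 1 - (1 + t)^-1.
    by apply: cvgB => //; exact: cvg_cst.
  have c3 : {for 1 - (1 + t)^-1, continuous (fun y : R => y `^ q)}.
    have H := is_derive1_powR q (g0 t t0).
    apply: differentiable_continuous; apply/derivable1_diffP.
    exact: (@ex_derive _ _ _ _ _ _ _ H).
  have c4 : (fun x : R => (1 - (1 + x)^-1) `^ q) @ t --> (1 - (1 + t)^-1) `^ q.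
    exact: continuous_cvg c3 c2.
  exact: (cvgM (cvgM (cvg_cst (q + 1)) c4) (cvgM c1 c1)).
have If : rintble (pos R) f.
  apply: (ge0_ftc_intble (M := 1) dF cf).
    by move=> t t0; rewrite /f mulr_ge0 ?sqr_ge0 // mulr_ge0 ?powR_ge0 // ltW.
  move=> t t0; rewrite /F powR_ge0 /=.
  suff : (1 - (1 + t)^-1) `^ (q + 1) <= 1 `^ (q + 1) by rewrite powR1.
  apply: ge0_ler_powR; first exact: ltW.
  - by rewrite nnegrE ltW // g0.
  - by rewrite nnegrE.
  - by rewrite lerBlDr lerDl invr_ge0 ltW // addr_gt0.
(* By [gE], f t = (q + 1) t^q (1 + t)^(-M), so e^(-t) must be bounded by a multiple of (1 + t)^(-M).
   In [bnd] this is 1 + t <= M (1 + t / M) <= M e^(t / M), raised to the power M. *)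
pose M := q + 2.
have bnd t : 0 < t -> (1 + t) `^ M <= M `^ M * expR t.
  move=> t0; have M0 : 0 < M by rewrite /M; lra.
  have -> : expR t = expR (t / M) `^ M by rewrite -expRM divfK // gt_eqF.
  rewrite -powRM ?expR_ge0 ?(ltW M0) //; apply: ge0_ler_powR.
  - exact: ltW.
  - by rewrite nnegrE ltW // addr_gt0.
  - by rewrite nnegrE mulr_ge0 ?expR_ge0 // ltW.
  apply: (@le_trans _ _ (M * (1 + t / M))).
    by rewrite mulrDr mulr1 mulrCA divff ?gt_eqF // mulr1 lerD2r /M; lra.
  by rewrite ler_pM2l // expR_ge1Dx.
apply: (@rintble_le _ (pos R) _ (fun t => M `^ M / (q + 1) * f t)) => //.
- apply: measurable_funTS; apply: measurable_funM; first exact: measurable_powR.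
  by apply: (measurableT_comp (@measurable_expR R)); exact: oppr_measurable.
- exact: rintbleZ.
- move=> t /posP t0.
  have t1 : 0 < 1 + t by rewrite addr_gt0.
  rewrite ger0_norm ?mulr_ge0 ?powR_ge0 ?expR_ge0 // /f gE // powRM ?invr_ge0 ?(ltW t0) ?(ltW t1) //.
  have -> : M `^ M / (q + 1) * ((q + 1) * (t `^ q * (1 + t)^-1 `^ q) * (1 + t)^-1 ^+ 2) =
      t `^ q * (M `^ M * ((1 + t)^-1 `^ q * (1 + t)^-1 ^+ 2)).
    by field; rewrite !gt_eqF.
  rewrite ler_pM2l ?powR_gt0 //.
  have -> : (1 + t)^-1 `^ q * (1 + t)^-1 ^+ 2 = ((1 + t) `^ M)^-1.
    rewrite -powR_mulrn ?invr_ge0 ?(ltW t1) // -powRD; last first.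
      by rewrite invr_eq0 (gt_eqF t1) implybT.
    by rewrite -/M -(powR_inv1 (ltW t1)) -!powRrM mulN1r powRN.
  rewrite ler_pdivlMr ?powR_gt0 // expRN mulrC ler_pdivrMr ?expR_gt0 //.
  exact: bnd.
Qed.

Lemma gamma_cintble z : 0 < complex.Re z ->
  cintble (pos R) (fun t => cpow t (z - 1) * (expR (- t))%:C).
Proof.
move=> z0; have q1 : -1 < complex.Re z - 1 by lra.
apply: cintble_le (gamma_rintble q1) _ => //.
  apply: cmeas_setT; apply: cmeasM; first by apply: cmeas_cpow.
  apply: cmeas_real; apply: (measurableT_comp (@measurable_expR R)).
  exact: oppr_measurable.
move=> t /posP t0.
by rewrite cabsM cabs_cpow // cabs_real cReD /= (ger0_norm (expR_ge0 _)).
Qed.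

(** The estimate 1 + u <= e^u at u = t / (q + 1), raised to the power q + 1. It disposes of the
    boundary term at infinity in [gamma_bound_cvg]. *)
Lemma powR_expRN_le q t : 0 < q -> 0 < t ->
  t `^ q * expR (- t) <= (q + 1) `^ (q + 1) / t.
Proof.
move=> q0 t0; have M0 : 0 < q + 1 by lra.
rewrite ler_pdivlMr // expRN mulrAC ler_pdivrMr ?expR_gt0 //.
have -> : t `^ q * t = t `^ (q + 1).
  by rewrite powRD ?powRr1 ?ltW // gt_eqF.
have -> : expR t = expR (t / (q + 1)) `^ (q + 1) by rewrite -expRM divfK // gt_eqF.
rewrite -powRM ?expR_ge0 ?(ltW M0) //; apply: ge0_ler_powR.
- exact: ltW.
- by rewrite nnegrE ltW.
- by rewrite nnegrE mulr_ge0 ?expR_ge0 // ltW.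
apply: (@le_trans _ _ ((q + 1) * (1 + t / (q + 1)))).
  by rewrite mulrDr mulr1 mulrCA divff ?gt_eqF // mulr1; lra.
by rewrite ler_pM2l // expR_ge1Dx.
Qed.

Lemma cabs_le_cvg0 (u : nat -> R[i]) (e : nat -> R) :
  (forall n, cabs (u n) <= e n) -> e @ \oo --> 0 -> ccvg u 0.
Proof. by move=> h he; apply: ccvg_squeeze he => n; rewrite subr0. Qed.

Lemma cvg_inv_nat (k : nat) : (fun n => (n + k).+1%:R^-1 : R) @ \oo --> 0.
Proof.
have H := @cvg_harmonic R.
by have := cvg_comp _ _ (cvg_addnr k) H.
Qed.

Lemma gamma_bound_cvg z : 0 < complex.Re z ->
  ccvg (fun n => cpow n.+2%:R z * (expR (- n.+2%:R))%:C -
                 cpow n.+1%:R^-1 z * (expR (- n.+1%:R^-1))%:C) 0.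
Proof.
move=> z0; set x := complex.Re z.
have cE t : 0 < t -> cabs (cpow t z * (expR (- t))%:C) = t `^ x * expR (- t).
  by move=> t0; rewrite cabsM cabs_cpow // cabs_real (ger0_norm (expR_ge0 _)).
apply: (@cabs_le_cvg0 _ (fun n => (x + 1) `^ (x + 1) * (n + 1).+1%:R^-1 + n.+1%:R^-1 `^ x)).
  move=> n; rewrite (le_trans (cabsD _ _)) // cabsN !cE ?invr_gt0 // lerD //.
    by rewrite addn1 powR_expRN_le.
  by rewrite ler_piMr ?powR_ge0 // -expR0 ler_expR oppr_le0 invr_ge0.
have L1 : (fun n => (x + 1) `^ (x + 1) * (n + 1).+1%:R^-1) @ \oo --> (x + 1) `^ (x + 1) * 0.
  by apply: cvgM; [exact: cvg_cst|exact: cvg_inv_nat].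
have L2 : (fun n => n.+1%:R^-1 `^ x) @ \oo --> (0 : R).
  have /cvg_at_rightP H := powR_cvg0 z0.
  apply: (H (fun n => n.+1%:R^-1)); split => [n|]; first by rewrite invr_gt0.
  exact: (@cvg_harmonic R).
by have := cvgD L1 L2; rewrite mulr0 addr0; exact.
Qed.

(** Integration by parts: [g1 + g2] is the derivative of t^z e^(-t), whose values at both ends tend
    to 0 because Re z > 0, so its integral vanishes. *)
Lemma cGammaS z : 0 < complex.Re z -> cGamma (z + 1) = z * cGamma z.
Proof.
move=> z0.
pose g1 t := z * (cpow t (z - 1) * (expR (- t))%:C).
pose g2 t := (-1) * (cpow t (z + 1 - 1) * (expR (- t))%:C).
have i1 : cintble (pos R) g1 by apply: cintbleZ => //; exact: gamma_cintble.
have i2 : cintble (pos R) g2.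
  apply: cintbleZ => //; apply: gamma_cintble; rewrite cReD /=; lra.
pose g t := g1 t + g2 t.
have ig : cintble (pos R) g by exact: cintbleD.
have cg t : 0 < t -> ccont g t.
  move=> t0; have ce : ccont (fun t : R => (expR (- t))%:C) t.
    by apply: ccont_real; apply: continuous_comp; [exact: continuousN|exact: continuous_expR].
  by apply: ccontD; apply: ccontM; try exact: ccont_cst; apply: ccontM => //; apply: ccont_cpow.
pose F t := cpow t z * (expR (- t))%:C.
have [L1 L2] := gamma_bound_cvg z0.
have d t : 0 < t -> is_derive t (1 : R) (fun r => complex.Re (F r)) (complex.Re (g t)) /\
   is_derive t (1 : R) (fun r => complex.Im (F r)) (complex.Im (g t)).
  move=> t0; have [d1 d2] := is_derive_cpow z t0.
  have E1 : (fun r => complex.Re (F r)) = (fun r => complex.Re (cpow r z) * expR (- r)).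
    by apply/funext => r; rewrite /F cReM /= mulr0 subr0.
  have E2 : (fun r => complex.Im (F r)) = (fun r => complex.Im (cpow r z) * expR (- r)).
    by apply/funext => r; rewrite /F cImM /= mulr0 add0r.
  have Eg : g t = (z * cpow t (z - 1)) * (expR (- t))%:C + cpow t z * (- expR (- t))%:C.
    by rewrite /g /g1 /g2 addrK rmorphN /=; ring.
  rewrite E1 E2 Eg cReD cImD !cReM !cImM; split.
    by apply: (is_derive_eq (is_derive_mul d1 (is_derive_expRN t))); rewrite ?cReM ?cImM /=; ring.
  by apply: (is_derive_eq (is_derive_mul d2 (is_derive_expRN t))); rewrite ?cReM ?cImM /=; ring.
have E0 : cintegral (pos R) g = 0.
  apply: complexP => /=.
    apply: (rftc0y (F := fun r => complex.Re (F r))) => //.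
    - by move=> t t0; exact: (d t t0).1.
    - by move=> t; rewrite in_itv /= andbT => /cg [].
    - exact: ig.1.
  apply: (rftc0y (F := fun r => complex.Im (F r))) => //.
  - by move=> t t0; exact: (d t t0).2.
  - by move=> t; rewrite in_itv /= andbT => /cg [].
  - exact: ig.2.
move: E0; rewrite cintegralD // !cintegralZ //; first last.
- exact: gamma_cintble.
- by apply: gamma_cintble; rewrite cReD /=; lra.
by move=> /eqP; rewrite mulN1r subr_eq0 => /eqP h; rewrite /cGamma h.
Qed.

Lemma cGamma1 : cGamma 1 = 1 :> R[i].
Proof.
have i1 : cintble (pos R) (fun t => cpow t (1 - 1) * (expR (- t))%:C).
  by apply: gamma_cintble; rewrite /= ltr01.
rewrite /cGamma (@eq_cintegral _ _ _ (fun t => (expR (- t))%:C)); last first.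
  by move=> t _; rewrite subrr cpow0 mul1r.
rewrite cintegral_real; congr (_ %:C).
apply: (rftc0y (F := fun t => - expR (- t))).
- move=> t _; have := is_deriveN (is_derive_expRN t).
  by rewrite opprK.
- move=> t _; apply: continuous_comp; [exact: continuousN|exact: continuous_expR].
- by case: (eq_cintble _ (g := fun t => (expR (- t))%:C) _ i1) => // t _; rewrite subrr cpow0 mul1r.
- have h1 : (fun n => - expR (- n.+2%:R) : R) @ \oo --> - (0 : R).
    apply: cvgN; rewrite (_ : (fun n => _) = (fun n => expR (- (n + 2)%:R) : R)).
      by have := cvg_comp _ _ (cvg_addnr 2) (@cvgn_expR R); exact.
    by apply/funext => n; rewrite addn2.
  have h2 : (fun n => - expR (- n.+1%:R^-1) : R) @ \oo --> - expR (- 0 : R).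
    apply: cvgN; apply: continuous_cvg; first exact: continuous_expR.
    by apply: cvgN; exact: (@cvg_harmonic R).
  have h3 : (fun n => - expR (- n.+2%:R) - - expR (- n.+1%:R^-1) : R) @ \oo -->
    - (0 : R) - - expR (- 0 : R) by exact: cvgB.
  by move: h3; rewrite !oppr0 expR0 opprK add0r; exact.
Qed.

Lemma cGamma_nat n : cGamma n.+1%:R = n`!%:R :> R[i].
Proof.
elim: n => [|n IH]; first exact: cGamma1.
rewrite -[n.+2]addn1 natrD cGammaS; last first.
  by rewrite -(rmorph_nat (real_complex R)) /= ltr0Sn.
by rewrite IH factS natrM.
Qed.

End GammaFunction.

Section GammaSubstitutions.
Context {R : realType}.
Notation mu := (@lebesgue_measure R).
Implicit Types (t q c : R) (z w : R[i]) (n : nat).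

Lemma is_derive_sqr t : is_derive t (1 : R) (fun x : R => x ^+ 2) (2 * t).
Proof.
have H := is_derive_mul (is_derive_id t (1 : R)) (is_derive_id t (1 : R)).
by apply: (is_derive_eq H); ring.
Qed.

Lemma ccont_gamma z t : 0 < t -> ccont (fun t => cpow t (z - 1) * (expR (- t))%:C) t.
Proof.
move=> t0; apply: ccontM; first exact: ccont_cpow.
by apply: ccont_real; apply: continuous_comp; [exact: continuousN|exact: continuous_expR].
Qed.

Lemma cGamma_scale z c : 0 < complex.Re z -> 0 < c ->
  cintble (pos R) (fun r => cpow r (z - 1) * (expR (- (c * r)))%:C) /\
  cintegral (pos R) (fun r => cpow r (z - 1) * (expR (- (c * r)))%:C) =
  cGamma z * cpow c (- z).
Proof.
move=> z0 c0.
have [] := @csubst R (fun x => c * x) (fun=> c) (fun y => c^-1 * y) 0 0 _ _ _ _ _ _ _ _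
  (@ccont_gamma z) (gamma_cintble z0).
- move=> x; have H := is_derive_scale c (is_derive_id x (1 : R)).
  by apply: (is_derive_eq H); rewrite mulr1.
- by move=> x; exact: cvg_cst.
- by move=> x y _ _; rewrite ltr_pM2l.
- by move=> x; exact: mulr_gt0.
- by move=> x _; exact: ltW.
- by move=> y y0; rewrite mulr_gt0 // invr_gt0.
- by move=> y _; rewrite mulrA divff ?mul1r // gt_eqF.
have E x : 0 < x -> cpow c (- z) * (c%:C * (cpow (c * x) (z - 1) * (expR (- (c * x)))%:C)) =
    cpow x (z - 1) * (expR (- (c * x)))%:C.
  move=> x0; have H : cpow c (- z) * (c%:C * cpow c (z - 1)) = 1.
    rewrite -(cpow1 c0) -(cpowD c 1) -(cpowD c (- z)).
    have -> : - z + (1 + (z - 1)) = 0 by ring.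
    exact: cpow0.
  rewrite (cpowM _ c0 x0).
  transitivity (cpow c (- z) * (c%:C * cpow c (z - 1)) * (cpow x (z - 1) * (expR (- (c * x)))%:C)).
    by rewrite !mulrA.
  by rewrite H mul1r.
move=> i1 i2; have i3 := cintbleZ (cpow c (- z)) _ i1.
split.
  by apply: eq_cintble (i3 _) => // x /posP; exact: E.
rewrite /cGamma i2 [RHS]mulrC -cintegralZ //; apply: eq_cintegral => x /posP x0.
by rewrite E.
Qed.

Lemma cGamma_sqr z : 0 < complex.Re z ->
  cintble (pos R) (fun u => cpow u (2%:R * z - 1) * (expR (- u ^+ 2))%:C) /\
  cintegral (pos R) (fun u => cpow u (2%:R * z - 1) * (expR (- u ^+ 2))%:C) =
  cGamma z / 2%:R.
Proof.
move=> z0.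
have [] := @csubst R (fun x => x ^+ 2) (fun x => 2 * x) (fun y => Num.sqrt y) 0 0 _ _ _ _ _ _ _ _
  (@ccont_gamma z) (gamma_cintble z0).
- exact: is_derive_sqr.
- by move=> x; apply: cvgM; [exact: cvg_cst|exact: cvg_id].
- move=> x y; rewrite !in_itv /= !andbT => x0 y0 xy.
  by rewrite ltr_pXn2r // nnegrE ltW.
- by move=> x x0; rewrite exprn_gt0.
- by move=> x x0; rewrite mulr_ge0 // ltW.
- by move=> y; rewrite sqrtr_gt0.
- by move=> y y0; rewrite sqr_sqrtr // ltW.
have E x : 0 < x -> 2%:R^-1 * ((2 * x)%:C * (cpow (x ^+ 2) (z - 1) * (expR (- x ^+ 2))%:C)) =
    cpow x (2%:R * z - 1) * (expR (- x ^+ 2))%:C.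
  move=> x0; rewrite (cpowXl _ _ x0).
  have -> : (2 * x)%:C = 2%:R * cpow x 1 by rewrite cpow1 // rmorphM (rmorph_nat (real_complex R)).
  rewrite -[2%:R * _ * _]mulrA mulKf; last by rewrite pnatr_eq0.
  rewrite mulrA -(cpowD x); congr (cpow x _ * _); ring.
move=> i1 i2; have i3 := cintbleZ 2%:R^-1 _ i1.
split.
  by apply: eq_cintble (i3 _) => // x /posP; exact: E.
rewrite /cGamma i2 [RHS]mulrC -cintegralZ //; apply: eq_cintegral => x /posP x0.
by rewrite E.
Qed.

(** Completing the square gives c u - u^2 <= c^2 / 2 - u^2 / 2, and t = u^2 / 2 turns u^q e^(-u^2 /
    2) into the Gamma integrand with exponent p = (q - 1) / 2. The linear term c u is there to
    absorb the growth e^(|w| u) of sin(w u) and sinh(w u). *)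
Lemma gauss_rintble q c : -1 < q ->
  rintble (pos R) (fun u => u `^ q * expR (c * u - u ^+ 2)).
Proof.
move=> q1; pose p := (q - 1) / 2.
have p1 : -1 < p by rewrite /p; lra.
have [] := @rsubst R (fun x => x ^+ 2 / 2) (fun x => x) (fun y => Num.sqrt (2 * y)) 0 0 _ _ _ _ _ _ _
  (fun t => t `^ p * expR (- t)) _ (gamma_rintble p1).
- move=> x; have H := is_derive_scale 2^-1 (is_derive_sqr x).
  have -> : (fun x : R => x ^+ 2 / 2) = (fun x => 2^-1 * x ^+ 2).
    by apply/funext => y; rewrite mulrC.
  by apply: (is_derive_eq H); rewrite mulKf.
- by move=> x; exact: cvg_id.
- move=> x y; rewrite !in_itv /= !andbT => x0 y0 xy.
  by rewrite ltr_pM2r // ltr_pXn2r // nnegrE ltW.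
- by move=> x x0; rewrite divr_gt0 // exprn_gt0.
- by move=> x /ltW.
- by move=> y y0; rewrite sqrtr_gt0 mulr_gt0.
- by move=> y y0; rewrite sqr_sqrtr ?mulr_ge0 ?(ltW y0) // mulrC mulKf.
- move=> t; rewrite in_itv /= andbT => t0.
  have c1 : {for t, continuous (fun y : R => y `^ p)}.
    have H := is_derive1_powR p t0.
    apply: differentiable_continuous; apply/derivable1_diffP.
    exact: (@ex_derive _ _ _ _ _ _ _ H).
  have c2 : (fun x : R => expR (- x)) @ t --> expR (- t).
    by apply: continuous_cvg; [exact: continuous_expR|apply: cvgN; exact: cvg_id].
  exact: (cvgM c1 c2).
move=> i1 _.
apply: (@rintble_le _ (pos R) _ (fun x => 2 `^ p * expR (c ^+ 2 / 2) *
   (x * ((x ^+ 2 / 2) `^ p * expR (- (x ^+ 2 / 2)))))) => //.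
- apply: measurable_funTS; apply: measurable_funM; first exact: measurable_powR.
  apply: (measurableT_comp (@measurable_expR R)); apply: measurable_funB.
    by apply: measurable_funM.
  exact: exprn_measurable.
- exact: rintbleZ.
- move=> x /posP x0; rewrite ger0_norm ?mulr_ge0 ?powR_ge0 ?expR_ge0 //.
  have -> : 2 `^ p * expR (c ^+ 2 / 2) * (x * ((x ^+ 2 / 2) `^ p * expR (- (x ^+ 2 / 2)))) =
      x `^ q * (expR (c ^+ 2 / 2) * expR (- (x ^+ 2 / 2))).
    rewrite [(x ^+ 2 / 2) `^ p]powRM ?sqr_ge0 ?invr_ge0 //.
    have -> : x `^ q = x * (x ^+ 2) `^ p.
      rewrite -powR_mulrn ?(ltW x0) // -powRrM -{2}(powRr1 (ltW x0)) -powRD.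
        by congr (_ `^ _); rewrite /p; field.
      by rewrite (gt_eqF x0) implybT.
    have -> : 2^-1 `^ p = (2 `^ p)^-1 by rewrite -powR_inv1 // -powRrM mulN1r powRN.
    by field; rewrite gt_eqF // powR_gt0.
  rewrite ler_pM2l ?powR_gt0 // -expRD ler_expR.
  rewrite -subr_ge0; have -> : c ^+ 2 / 2 - x ^+ 2 / 2 - (c * x - x ^+ 2) = (c - x) ^+ 2 / 2.
    by field.
  by rewrite divr_ge0 // sqr_ge0.
Qed.

Lemma cGamma_half : cGamma (2%:R^-1) = (Num.sqrt pi)%:C :> R[i].
Proof.
have z0 : 0 < complex.Re (2%:R^-1 : R[i]).
  by rewrite -(rmorph_nat (real_complex R)) -fmorphV /= invr_gt0.
have [i1 E] := cGamma_sqr z0.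
have EX x : cpow x (2%:R * 2%:R^-1 - 1) * (expR (- x ^+ 2))%:C = (expR (- x ^+ 2))%:C.
  by rewrite divff ?pnatr_eq0 // subrr cpow0 mul1r.
have : cintegral (pos R) (fun u => (expR (- u ^+ 2))%:C) = cGamma 2%:R^-1 / 2%:R.
  by rewrite -E; apply: eq_cintegral => x _; rewrite EX.
rewrite cintegral_real /Rintegral integral_itv_obnd_cbnd; last first.
  apply/measurable_EFinP/measurable_funTS.
  apply: (measurableT_comp (@measurable_expR R)); apply: measurable_funN.
  exact: exprn_measurable.
have := @integral0y_gauss R; rewrite /gauss_fun => -> /= H.
have -> : cGamma 2%:R^-1 = cGamma 2%:R^-1 / 2%:R * 2%:R :> R[i].
  by rewrite divfK // pnatr_eq0.
by rewrite -H -(rmorph_nat (real_complex R)) -rmorphM /= divfK.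
Qed.

End GammaSubstitutions.

(** * Growth of Gamma (N + z) for integers N *)

Section GammaAsymptotics.
Context {R : realType}.
Notation mu := (@lebesgue_measure R).
Implicit Types (t q c : R) (z w : R[i]) (n : nat).

Lemma lipschitz1 (f df : R -> R) b : (forall x : R, is_derive x (1 : R) f (df x)) ->
  (forall x, `|df x| <= 1) -> 0 <= b -> `|f b - f 0| <= b.
Proof.
move=> hf hdf b0; have [|c _ ->] := @MVT_segment R f df 0 b b0 (fun x _ => hf x).
  apply: continuous_subspaceT => x; apply: differentiable_continuous.
  apply/derivable1_diffP; exact: (@ex_derive _ _ _ _ _ _ _ (hf x)).
by rewrite subr0 normrM (ger0_norm b0) ler_piMl.
Qed.

(** Writing w = a + i b, e^w - 1 = e^a (e^(i b) - 1) + (e^a - 1); the first difference is controlled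
    by the mean value theorem, the second by 1 + a <= e^a. The resulting bound is linear in w near
    0. *)
Lemma cabs_cexp_sub1 w : cabs (cexp w - 1) <=
  2 * (`|complex.Re w| + `|complex.Im w|) * (1 + expR (complex.Re w)).
Proof.
set a := complex.Re w; set b := complex.Im w.
have hs : `|sin b| <= `|b|.
  have -> : `|sin b| = `|sin `|b| - sin 0|.
    by rewrite sin0 subr0; have [//|] := ger0P b; rewrite sinN normrN.
  by apply: (lipschitz1 (@is_derive_sin R)) => // x; exact: cos_max.
have hc : `|cos b - 1| <= `|b|.
  have -> : `|cos b - 1| = `|cos `|b| - cos 0| by rewrite cos0 cos_norm.
  by apply: (lipschitz1 (@is_derive_cos R)) => // x; rewrite normrN sin_max.
have he : `|expR a - 1| <= `|a| * (1 + expR a).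
  have e0 := expR_gt0 a; have h1 := expR_ge1Dx a; have h2 := expR_ge1Dx (- a).
  have h3 : expR (- a) * expR a = 1 by rewrite -expRD addNr expR0.
  have h4 : expR a - 1 <= a * expR a.
    have := ler_wpM2r (ltW e0) h2; rewrite h3.
    lra.
  have h5 : 0 <= `|a| * expR a by rewrite mulr_ge0 // ltW.
  have h6 : a * expR a <= `|a| * expR a by rewrite ler_pM2r // ler_norm.
  have h7 : - `|a| <= a by rewrite lerNl -normrN ler_norm.
  have h8 := normr_ge0 a.
  rewrite ler_norml; apply/andP; split; lra.
have -> : cexp w - 1 =
   (expR a)%:C * ((cos b - 1) +i* sin b) + (expR a - 1)%:C.
  by apply: complexP; rewrite /= ?cReD ?cImD ?cReM ?cImM /=; ring.
apply: (le_trans (cabsD _ _)); rewrite cabsM !cabs_real (ger0_norm (expR_ge0 _)).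
have h : cabs ((cos b - 1) +i* sin b) <= 2 * `|b|.
  by apply: (le_trans (cabs_le_ReIm _)) => /=; lra.
have e0 := expR_gt0 a; have := normr_ge0 a; have := normr_ge0 b => b0 a0.
have : expR a * cabs ((cos b - 1) +i* sin b) <= expR a * (2 * `|b|) by rewrite ler_pM2l.
have : 0 <= `|a| * expR a by rewrite mulr_ge0 // ltW.
lra.
Qed.

(** From 1 - 1 / t <= ln t <= t - 1. *)
Lemma ln_bound t : 0 < t -> `|ln t| <= `|t - 1| * (1 + t^-1).
Proof.
move=> t0; have ti : 0 < t^-1 by rewrite invr_gt0.
have h1 : ln t <= t - 1.
  by have := @le_ln1Dx R (t - 1); rewrite addrCA subrr addr0; apply; lra.
have h2 : - ln t <= t^-1 - 1.
  have := @le_ln1Dx R (t^-1 - 1); rewrite addrCA subrr addr0 lnV ?posrE //.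
  by apply; lra.
have h3 : t * t^-1 = 1 by rewrite divff // gt_eqF.
have [t1|t1] := leP 1 t.
  rewrite (ger0_norm (ln_ge0 t1)) ger0_norm ?subr_ge0 //.
  have : 0 <= (t - 1) * t^-1 by rewrite mulr_ge0 ?subr_ge0 // ltW.
  lra.
rewrite ler0_norm ?ln_le0 ?(ltW t1) // ltr0_norm ?subr_lt0 // mulrDr mulr1 mulNr mulrBl h3; lra.
Qed.

Lemma powR_le_sqr t q : 0 < t -> 0 <= q <= 2 -> t `^ q <= 1 + t ^+ 2.
Proof.
move=> t0 /andP[q0 q2]; have [t1|t1] := leP t 1.
  have : t `^ q <= t `^ 0 by apply: ger_powR => //; rewrite t0.
  rewrite powRr0 => h; rewrite (le_trans h) // lerDl sqr_ge0 //.
have : t `^ q <= t `^ 2%:R by apply: ler_powR => //; exact: ltW.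
by rewrite powR_mulrn ?(ltW t0) // => h; rewrite (le_trans h) // lerDr.
Qed.

(** With x = t / N, the coefficients of t^(j - 1) in 2 / x + 2 + x + x^2 ([acoef]) and in the same
    expression times (x - 1)^2, which is 2 / x - 2 - x + x^2 - x^3 + x^4 ([bcoef]). The shift by one
    accounts for the term 2 / x. *)
Let acoef (N : R) (j : nat) : R :=
  if j == 0%N then 2 * N else if j == 1%N then 2 else if j == 2%N then N^-1
  else if j == 3%N then N^-1 ^+ 2 else 0.

Let bcoef (N : R) (j : nat) : R :=
  if j == 0%N then 2 * N else if j == 1%N then - 2 else if j == 2%N then - N^-1
  else if j == 3%N then N^-1 ^+ 2 else if j == 4%N then - N^-1 ^+ 3 else N^-1 ^+ 4.

(** The inequality |t - 1| <= (d + (t - 1)^2 / d) / 2 trades the modulus in [ln_bound] for a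
    polynomial, whose mean under a Gamma density is explicit, and leaves d to be optimised. The last
    factor is (1 + 1 / t) (2 + t^2), where Re z <= 2 served to bound t^(Re z) by 1 + t^2. *)
Lemma cpow_sub1_bound z t d : 0 < t -> 0 < d -> 0 <= complex.Re z <= 2 ->
  cabs (cpow t z - 1) <= (`|complex.Re z| + `|complex.Im z|) *
    (d + (t - 1) ^+ 2 / d) * (2 / t + 2 + t + t ^+ 2).
Proof.
move=> t0 d0 hz; set K := `|complex.Re z| + `|complex.Im z|.
have K0 : 0 <= K by rewrite addr_ge0.
have ti : 0 < t^-1 by rewrite invr_gt0.
rewrite /cpow; apply: (le_trans (cabs_cexp_sub1 _)).
rewrite cReM cImM /= !mulr0 subr0 add0r !normrM -mulrDl -/K.
have -> : expR (complex.Re z * ln t) = t `^ complex.Re z by rewrite /powR gt_eqF.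
have h1 := ln_bound t0; have h2 := powR_le_sqr t0 hz.
have h3 : `|t - 1| <= (d + (t - 1) ^+ 2 / d) / 2.
  rewrite -subr_ge0.
  have -> : (d + (t - 1) ^+ 2 / d) / 2 - `|t - 1| = (d - `|t - 1|) ^+ 2 / d / 2.
    by rewrite -(real_normK (num_real (t - 1))); field; rewrite gt_eqF.
  by rewrite !divr_ge0 ?sqr_ge0 // ltW.
set e := d + _ in h3 *.
have -> : K * e * (2 / t + 2 + t + t ^+ 2) = 2 * (K * (e / 2 * (1 + t^-1))) * (2 + t ^+ 2).
  by field; rewrite gt_eqF.
have p1 : 0 <= 1 + t `^ complex.Re z by rewrite addr_ge0 // powR_ge0.
apply: ler_pM => //.
- by rewrite mulr_ge0 // mulr_ge0.
- rewrite ler_pM2l // ler_wpM2l // (le_trans h1) // ler_wpM2r //; lra.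
- lra.
Qed.

Lemma monomial_expRN_int n : rintble (pos R) (fun t => t ^+ n * expR (- t)) /\
  \int[mu]_(t in pos R) (t ^+ n * expR (- t)) = n`!%:R.
Proof.
have n0 : 0 < complex.Re (n.+1%:R : R[i]).
  by rewrite -(rmorph_nat (real_complex R)) /= ltr0Sn.
have E t : 0 < t -> cpow t (n.+1%:R - 1) * (expR (- t))%:C = (t ^+ n * expR (- t))%:C.
  by move=> t0; rewrite -addn1 natrD addrK cpow_nat // -rmorphM.
have i1 := gamma_cintble n0.
split.
  have i2 : cintble (pos R) (fun t => (t ^+ n * expR (- t))%:C).
    by apply: eq_cintble i1 => // t /posP; exact: E.
  exact: i2.1.
have := cGamma_nat n (R := R); rewrite /cGamma.
rewrite (eq_cintegral (g := fun t => (t ^+ n * expR (- t))%:C)); last by move=> t /posP; exact: E.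
by rewrite cintegral_real -(rmorph_nat (real_complex R)) => /complexI.
Qed.

Lemma sum_monomial_int n (c : nat -> R) m :
  rintble (pos R) (fun t => \sum_(j < m) c j * (t ^+ (n + j) * expR (- t))) /\
  \int[mu]_(t in pos R) (\sum_(j < m) c j * (t ^+ (n + j) * expR (- t))) =
  \sum_(j < m) c j * (n + j)`!%:R.
Proof.
elim: m => [|m [i1 E1]].
  have -> : (fun t => \sum_(j < 0) c j * (t ^+ (n + j) * expR (- t))) = cst 0.
    by apply/funext => t; rewrite big_ord0.
  split; first exact: integrable0.
  by rewrite big_ord0 /Rintegral (_ : (fun=> 0%:E) = cst 0%E) // integral0.
have [i2 E2] := monomial_expRN_int (n + m).
have i3 : rintble (pos R) (fun t => c m * (t ^+ (n + m) * expR (- t))) by exact: rintbleZ.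
have -> : (fun t => \sum_(j < m.+1) c j * (t ^+ (n + j) * expR (- t))) =
  (fun t => \sum_(j < m) c j * (t ^+ (n + j) * expR (- t)) + c m * (t ^+ (n + m) * expR (- t))).
  by apply/funext => t; rewrite big_ord_recr.
split; first exact: rintbleD.
by rewrite /= RintegralD // E1 RintegralZl // E2 big_ord_recr.
Qed.

(* The mean of [t ^ z] under the Gamma (n + 2) density, which is concentrated around [n + 2]. *)
Lemma gamma_asymp z n d : 0 < d -> 0 <= complex.Re z <= 2 ->
  cabs (cGamma (n.+2%:R + z) - cpow n.+2%:R z * n.+1`!%:R) <=
  2 * ((`|complex.Re z| + `|complex.Im z|) * n.+2%:R `^ complex.Re z *
    (n.+1`!%:R * (9 * d + 14 / n.+2%:R / d))).
Proof.
move=> d0 hz; set K := `|complex.Re z| + `|complex.Im z|; set N : R := n.+2%:R.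
have NE : n.+2%:R = N%:C by rewrite -(rmorph_nat (real_complex R)).
have N0 : 0 < N by rewrite ltr0Sn.
have N2 : 2 <= N by rewrite ler_nat.
have K0 : 0 <= K by rewrite addr_ge0.
have zN : 0 < complex.Re (n.+2%:R + z) by rewrite NE cReD /=; lra.
have z1 : 0 < complex.Re (n.+2%:R : R[i]) by rewrite NE.
have [i1 i2] := (gamma_cintble zN, gamma_cintble z1).
have Enat := cGamma_nat n.+1 (R := R).
have E1 : cGamma (n.+2%:R + z) - cpow N z * n.+1`!%:R =
  cintegral (pos R) (fun t => cpow t (n.+2%:R + z - 1) * (expR (- t))%:C +
    (- cpow N z) * (cpow t (n.+2%:R - 1) * (expR (- t))%:C)).
  rewrite cintegralD //; last exact: cintbleZ.
  by rewrite cintegralZ // -/(cGamma n.+2%:R) Enat mulNr.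
rewrite E1.
pose cf j := K * N `^ complex.Re z * (d * acoef N j + bcoef N j / d).
have [ik Ek] := sum_monomial_int n cf 6.
have bd t : 0 < t -> cabs (cpow t (n.+2%:R + z - 1) * (expR (- t))%:C +
    (- cpow N z) * (cpow t (n.+2%:R - 1) * (expR (- t))%:C)) <=
    \sum_(j < 6) cf j * (t ^+ (n + j) * expR (- t)).
  move=> t0; have tN : 0 < t / N by rewrite divr_gt0.
  have -> : cpow t (n.+2%:R + z - 1) * (expR (- t))%:C +
    (- cpow N z) * (cpow t (n.+2%:R - 1) * (expR (- t))%:C) =
    cpow N z * (cpow (t / N) z - 1) * (t ^+ n.+1)%:C * (expR (- t))%:C.
    have -> : cpow t (n.+2%:R - 1) = (t ^+ n.+1)%:C.
      by rewrite -[n.+2]addn1 natrD addrK cpow_nat.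
    have -> : cpow t (n.+2%:R + z - 1) = cpow N z * cpow (t / N) z * (t ^+ n.+1)%:C.
      have Et : N * (t / N) = t by rewrite mulrC divfK // gt_eqF.
      rewrite -(cpowM _ N0 tN) Et -(cpow_nat n.+1 t0) -(cpowD t).
      congr (cpow t _); rewrite -[n.+2]addn1 natrD; ring.
    ring.
  rewrite !cabsM !cabs_real cabs_cpow // !ger0_norm ?exprn_ge0 ?expR_ge0 ?(ltW t0) //.
  apply: (@le_trans _ _ (N `^ complex.Re z * (K * (d + (t / N - 1) ^+ 2 / d) *
     (2 / (t / N) + 2 + t / N + (t / N) ^+ 2)) * t ^+ n.+1 * expR (- t))).
    rewrite ler_wpM2r ?expR_ge0 // ler_wpM2r ?exprn_ge0 ?(ltW t0) //.
    by rewrite ler_wpM2l ?powR_ge0 // cpow_sub1_bound.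
  rewrite !big_ord_recr big_ord0 /= /cf /acoef /bcoef /=.
  rewrite !exprD ?addn0 !exprS !expr0 le_eqVlt; apply/orP; left; apply/eqP.
  by field; rewrite !gt_eqF.
apply: (le_trans (cabs_cintegral _ _ ik _)) => //.
- by apply: cintbleD => //; exact: cintbleZ.
- by move=> t /posP; exact: bd.
rewrite Ek ler_pM2l //.
set F : R := n.+1`!%:R.
have F0 : 0 < F by rewrite ltr0n fact_gt0.
have En : n%:R = N - 2 by rewrite /N -addn2 natrD addrK.
have f0 : (n + 0)`!%:R = F / (N - 1).
  rewrite /F factS natrM addn0 -addn1 natrD En; field.
  by apply/eqP; lra.
have f2 : (n + 2)`!%:R = F * N by rewrite addn2 factS natrM mulrC.
have f3 : (n + 3)`!%:R = F * N * (N + 1).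
  by rewrite addnS factS natrM f2 mulrC -[(n + 2).+1]addn1 !natrD En; ring.
have f4 : (n + 4)`!%:R = F * N * (N + 1) * (N + 2).
  by rewrite addnS factS natrM f3 mulrC -[(n + 3).+1]addn1 !natrD En; ring.
have f5 : (n + 5)`!%:R = F * N * (N + 1) * (N + 2) * (N + 3).
  by rewrite addnS factS natrM f4 mulrC -[(n + 4).+1]addn1 !natrD En; ring.
rewrite !big_ord_recr big_ord0 /= f0 f2 f3 f4 f5 addn1 -/F /cf /acoef /bcoef /=.
pose e := N^-1.
have e0 : 0 < e by rewrite invr_gt0.
have e2 : e <= 2^-1 by rewrite lef_pV2 ?posrE.
have eN : N / (N - 1) <= 2 by rewrite ler_pdivrMr; lra.
have eN1 : (N - 1)^-1 <= 2 * e.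
  have -> : (N - 1)^-1 = e * (N / (N - 1)) by rewrite /e mulrA mulVf ?mul1r // gt_eqF.
  by rewrite [leRHS]mulrC ler_pM2l.
clear ik Ek bd f0 f2 f3 f4 f5 E1 Enat En.
(* With e = 1 / N, the constant terms of the [bcoef] part cancel, as (t / N - 1)^2 has mean of order
   1 / N. From N / (N - 1) <= 2, 1 / (N - 1) <= 2 e and e <= 1/2, the two brackets are at most 4 + 3
   + 3/2 <= 9 and 4 e + e + 9 e = 14 e. *)
set X := (X in X <= _).
have -> : X = K * N `^ complex.Re z * (F * (d * (2 * (N / (N - 1)) + 3 + (1 + e)) +
   d^-1 * (2 * (N - 1)^-1 + e + (1 + e) * (1 + 2 * e) * (3 * e)))).
  rewrite /X /e; field; rewrite !gt_eqF // ?subr_gt0; lra.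
rewrite ler_wpM2l ?mulr_ge0 ?powR_ge0 // ler_pM2l // lerD //.
  by rewrite mulrC ler_pM2r //; lra.
have -> : 14 / N / d = d^-1 * (14 * e) by rewrite mulrC.
rewrite ler_pM2l ?invr_gt0 //.
have : (1 + e) * (1 + 2 * e) <= 3.
  have : (1 + e) * (1 + 2 * e) <= (1 + 2^-1) * (1 + 2 * 2^-1) by apply: ler_pM; lra.
  lra.
move=> h; have : (1 + e) * (1 + 2 * e) * (3 * e) <= 3 * (3 * e).
  by rewrite ler_wpM2r //; lra.
lra.
Qed.

End GammaAsymptotics.

(** * Nonvanishing and duplication of Gamma *)

Section GammaDuplication.
Context {R : realType}.
Implicit Types (z w : R[i]) (n : nat).

Lemma natr_complex n : (n%:R : R[i]) = (n%:R : R)%:C.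
Proof. by rewrite (rmorph_nat (real_complex R)). Qed.

Lemma Re_half (s : R[i]) : complex.Re (s / 2%:R) = complex.Re s / 2.
Proof.
have -> : s / 2%:R = s * (2^-1)%:C by rewrite fmorphV natr_complex.
by rewrite cReM (_ : complex.Im (2^-1)%:C = 0) // mulr0 subr0.
Qed.

Lemma pochhammerS z n : pochhammer z n.+1 = pochhammer z n * (z + n%:R).
Proof. by rewrite /pochhammer big_ord_recr. Qed.

Lemma pochhammer0 z : pochhammer z 0 = 1.
Proof. by rewrite /pochhammer big_ord0. Qed.

Lemma cGamma_poch z n : 0 < complex.Re z -> cGamma (z + n%:R) = pochhammer z n * cGamma z.
Proof.
move=> z0; elim: n => [|n IH]; first by rewrite addr0 pochhammer0 mul1r.
rewrite -addn1 natrD addrA cGammaS; last first.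
  by rewrite cReD natr_complex /= ltr_wpDr.
by rewrite IH addn1 pochhammerS; ring.
Qed.

(** Gamma (N + z) / (N^z Gamma (N)) at N = n + 2. From N = 2 on, the density t^(N - 1) e^(-t) still
    integrates the term 2 / t of [cpow_sub1_bound]. *)
Definition gamma_ratio z n : R[i] := cGamma (n.+2%:R + z) / (cpow n.+2%:R z * n.+1`!%:R).

Lemma gamma_ratioE z n :
  cGamma (n.+2%:R + z) = gamma_ratio z n * cpow n.+2%:R z * n.+1`!%:R.
Proof.
rewrite /gamma_ratio -mulrA divfK // mulf_neq0 ?cpow_neq0 //.
Qed.

Lemma inv_sqrt_cvg0 : (fun n => (Num.sqrt n.+2%:R)^-1 : R) @ \oo --> 0.
Proof.
apply/cvgrPdist_le => e e0.
exists (Num.truncn (e^-1 ^+ 2)) => // n /= hn.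
have s0 : 0 < Num.sqrt n.+2%:R :> R by rewrite sqrtr_gt0 ltr0Sn.
rewrite sub0r normrN ger0_norm ?invr_ge0 ?(ltW s0) //.
rewrite -[leRHS]invrK lef_pV2 ?posrE ?invr_gt0 //.
rewrite -(@ler_pXn2r _ 2) ?nnegrE ?invr_ge0 ?(ltW e0) ?(ltW s0) // sqr_sqrtr ?ler0n //.
by rewrite ltW // (lt_le_trans (truncnS_gt _)) // ler_nat ltnS leqW.
Qed.

Lemma gamma_ratio_cvg z : 0 <= complex.Re z <= 2 -> ccvg (gamma_ratio z) 1.
Proof.
move=> hz; set K := `|complex.Re z| + `|complex.Im z|.
apply: (@ccvg_squeeze _ _ _ (fun n => 2 * K * 23 * (Num.sqrt n.+2%:R)^-1)).
  move=> n; set N : R := n.+2%:R.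
  have N0 : 0 < N by rewrite ltr0Sn.
  have s0 : 0 < Num.sqrt N by rewrite sqrtr_gt0.
  have F0 : 0 < n.+1`!%:R :> R by rewrite ltr0n fact_gt0.
  (* The choice d = 1 / sqrt N balances 9 d and 14 / (N d), with sum 23 / sqrt N. *)
  have d0 : 0 < (Num.sqrt N)^-1 by rewrite invr_gt0.
  have := gamma_asymp n d0 hz; rewrite -/N -/K.
  have P0 : 0 < N `^ complex.Re z by rewrite powR_gt0.
  have -> : 9 * (Num.sqrt N)^-1 + 14 / N / (Num.sqrt N)^-1 = 23 * (Num.sqrt N)^-1.
    have -> : 14 / N = 14 / (Num.sqrt N ^+ 2) by rewrite (sqr_sqrtr (ltW N0)).
    by field; exact: lt0r_neq0.
  have -> : cGamma (n.+2%:R + z) - cpow N z * n.+1`!%:R =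
     (gamma_ratio z n - 1) * (cpow N z * n.+1`!%:R).
    by rewrite mulrBl mul1r gamma_ratioE mulrA.
  rewrite !cabsM cabs_cpow // cabs_nat => h.
  rewrite -(ler_pM2r (mulr_gt0 P0 F0)) (le_trans h) // le_eqVlt; apply/orP; left.
  by apply/eqP; ring.
rewrite -[X in _ --> X](mulr0 (2 * K * 23)); apply: cvgM; first exact: cvg_cst.
exact: inv_sqrt_cvg0.
Qed.

(** A zero at z would propagate by the functional equation to all z + N, so [gamma_ratio z] would be
    0 throughout although it tends to 1. *)
Lemma cGamma_neq0 z : 0 < complex.Re z -> complex.Re z <= 2 -> cGamma z != 0.
Proof.
move=> z0 z2; apply/eqP => h.
have hz : 0 <= complex.Re z <= 2 by rewrite (ltW z0).
have H := gamma_ratio_cvg hz.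
have E : gamma_ratio z = fun=> 0.
  by apply/funext => n; rewrite /gamma_ratio addrC cGamma_poch // h mulr0 mul0r.
rewrite E in H; have := ccvg_unique H (ccvg_cst 0).
by apply/eqP; rewrite oner_eq0.
Qed.

(** The factors 2 z + 2 k and 2 z + 2 k + 1 are twice z + k and z + 1/2 + k. *)
Lemma pochhammer_double z n :
  pochhammer (2%:R * z) n.*2 = 4%:R ^+ n * pochhammer z n * pochhammer (z + 2%:R^-1) n.
Proof.
elim: n => [|n IH]; first by rewrite !pochhammer0 expr0 !mulr1.
rewrite doubleS !pochhammerS IH exprS -addn1 -muln2 !natrD !natrM.
have h2 : (2%:R : R[i]) != 0 by rewrite pnatr_eq0.
by field.
Qed.

Lemma ccvg_sub (u : nat -> R[i]) l (h : nat -> nat) : (forall n, (n <= h n)%N) ->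
  ccvg u l -> ccvg (fun n => u (h n)) l.
Proof.
move=> hn; have H : h @ \oo --> \oo.
  move=> A [N _ NA]; exists N => // n /= Nn; apply: NA => /=.
  exact: leq_trans Nn (hn n).
by move=> [u1 u2]; split; [apply: (cvg_comp _ _ H u1)|apply: (cvg_comp _ _ H u2)].
Qed.

(** The factor of the duplication identity at level n that does not depend on z. Its limit 2
    sqrt(pi) is not computed directly; [cGamma_duplication] eliminates it by means of z = 1/2. *)
Let kappa n : R[i] := 4%:R ^+ n.+2 * cpow n.+2%:R 2%:R^-1 * n.+1`!%:R ^+ 2 / (n.*2.+2).+1`!%:R.

(** [pochhammer_double] at length N = n + 2, with each Pochhammer symbol rewritten as a quotient of
    Gamma values. The index 2 n + 2 makes [gamma_ratio (2 z)] stand at 2 N = 2 n + 4. *)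
Let duplication_ratio z n : 0 < complex.Re z ->
  cGamma z * cGamma (z + 2%:R^-1) * cpow 2 (2%:R * z) * gamma_ratio (2%:R * z) n.*2.+2 =
  kappa n * gamma_ratio z n * gamma_ratio (z + 2%:R^-1) n * cGamma (2%:R * z).
Proof.
move=> z0.
have h2 : (2%:R : R[i]) = (2 : R)%:C by rewrite natr_complex.
have hh : (2%:R^-1 : R[i]) = (2^-1 : R)%:C by rewrite natr_complex -fmorphV.
have z2 : 0 < complex.Re (2%:R * z) by rewrite h2 cReM /= mul0r subr0 mulr_gt0.
have zh : 0 < complex.Re (z + 2%:R^-1) by rewrite hh cReD /= addr_gt0.
have N0 : 0 < n.+2%:R :> R by rewrite ltr0Sn.
have E1 := gamma_ratioE z n; have E2 := gamma_ratioE (z + 2%:R^-1) n.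
have E3 := gamma_ratioE (2%:R * z) n.*2.+2.
rewrite addrC (cGamma_poch _ z0) in E1.
rewrite addrC (cGamma_poch _ zh) in E2.
rewrite addrC (_ : n.*2.+4 = n.+2.*2)%N // (cGamma_poch _ z2) pochhammer_double in E3.
have D : (n.+2.*2)%:R = 2 * n.+2%:R :> R by rewrite -muln2 natrM mulrC.
rewrite D (cpowM _ _ N0) // in E3.
have c1 : cpow n.+2%:R (2%:R * z) = cpow n.+2%:R z ^+ 2.
  by rewrite mulr_natl mulr2n cpowD expr2.
rewrite c1 in E3; rewrite (cpowD n.+2%:R) in E2.
set P1 := pochhammer z n.+2 in E1 E3; set P2 := pochhammer _ n.+2 in E2 E3.
set F := (n.*2.+2).+1`!%:R in E3 *; rewrite /kappa -/F.
have F0 : F != 0 by rewrite pnatr_eq0 -lt0n fact_gt0.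
have cz : cpow n.+2%:R z != 0 :> R[i] by exact: cpow_neq0.
set X := cpow n.+2%:R z in E1 E2 E3 cz *.
apply: (mulIf (mulf_neq0 (mulf_neq0 (expf_neq0 2 cz) F0) (oner_neq0 _))).
rewrite mulr1.
transitivity (cGamma z * cGamma (z + 2%:R^-1) *
   (gamma_ratio (2%:R * z) n.*2.+2 * (cpow 2 (2%:R * z) * X ^+ 2) * F)); first ring.
rewrite -E3.
transitivity (4%:R ^+ n.+2 * (P1 * cGamma z) * (P2 * cGamma (z + 2%:R^-1)) * cGamma (2%:R * z)).
  ring.
rewrite E1 E2; field.
exact: F0.
Qed.

(* The quotient of the two sides is 1-periodic, so it is determined by the
   asymptotics of the ratio [Gamma (N + z) / (N ^ z Gamma N)]. *)
Lemma cGamma_duplication z : 0 < complex.Re z -> complex.Re z <= 1 ->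
  cGamma z * cGamma (z + 2%:R^-1) * cpow 2 (2%:R * z) =
  2%:R * (Num.sqrt pi)%:C * cGamma (2%:R * z).
Proof.
move=> z0 z1.
have h2 : (2%:R : R[i]) = (2 : R)%:C by rewrite natr_complex.
have hh : (2%:R^-1 : R[i]) = (2^-1 : R)%:C by rewrite natr_complex -fmorphV.
have half0 : 0 < complex.Re (2%:R^-1 : R[i]) by rewrite hh /= invr_gt0.
have sub n : (n <= n.*2.+2)%N by rewrite -addnn (leq_trans (leq_addr n n)) // leqW // leqW.
have r1 : ccvg (gamma_ratio z) 1 by apply: gamma_ratio_cvg; lra.
have r2 : ccvg (gamma_ratio (z + 2%:R^-1)) 1.
  by apply: gamma_ratio_cvg; rewrite hh cReD /=; lra.
have r3 : ccvg (fun n => gamma_ratio (2%:R * z) n.*2.+2) 1.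
  have H : ccvg (gamma_ratio (2%:R * z)) 1.
    by apply: gamma_ratio_cvg; rewrite h2 cReM /= mul0r subr0; lra.
  exact: (@ccvg_sub (gamma_ratio (2%:R * z)) 1 (fun n => n.*2.+2) sub H).
have r4 : ccvg (gamma_ratio 2%:R^-1) 1.
  by apply: gamma_ratio_cvg; rewrite hh /=; lra.
have r5 : ccvg (gamma_ratio (2%:R^-1 + 2%:R^-1)) 1.
  by apply: gamma_ratio_cvg; rewrite hh cReD /=; lra.
have r6 : ccvg (fun n => gamma_ratio (2%:R * 2%:R^-1) n.*2.+2) 1.
  have H : ccvg (gamma_ratio (2%:R * 2%:R^-1 : R[i])) 1.
    by apply: gamma_ratio_cvg; rewrite divff ?pnatr_eq0 //=; lra.
  exact: (@ccvg_sub (gamma_ratio (2%:R * 2%:R^-1)) 1 (fun n => n.*2.+2) sub H).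
have D1 n := duplication_ratio n z0.
(* At z = 1/2 the Gamma values are 1 and sqrt(pi), so [D2] expresses [kappa n] through ratios that
   tend to 1. *)
have D2 n := duplication_ratio n half0.
have e1 : 2%:R^-1 + 2%:R^-1 = 1 :> R[i].
  have n2 : (2%:R : R[i]) != 0 by rewrite pnatr_eq0.
  by field.
have e2 : 2%:R * 2%:R^-1 = 1 :> R[i] by rewrite divff // pnatr_eq0.
rewrite e1 e2 cGamma1 cGamma_half in D2.
rewrite e1 in r5; rewrite e2 in r6.
rewrite (cpow1 (_ : 0 < 2 :> R)) // in D2.
set L := cGamma z * _ * _ in D1 *.
have := ccvgM (ccvgM (ccvgZ L r3) r4) r5.
have -> : (fun n => L * gamma_ratio (2%:R * z) n.*2.+2 * gamma_ratio 2%:R^-1 n * gamma_ratio 1 n) =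
   (fun n => ((Num.sqrt pi)%:C * 2%:C * gamma_ratio 1 n.*2.+2) * gamma_ratio z n *
      gamma_ratio (z + 2%:R^-1) n * cGamma (2%:R * z)).
  apply/funext => n; rewrite D1.
  transitivity ((kappa n * gamma_ratio 2%:R^-1 n * gamma_ratio 1 n * 1) * gamma_ratio z n *
    gamma_ratio (z + 2%:R^-1) n * cGamma (2%:R * z)); first by ring.
  by rewrite -D2; ring.
move=> H1.
have H2 := ccvgM (ccvgM (ccvgM (ccvgZ ((Num.sqrt pi)%:C * 2%:C) r6) r1) r2) (ccvg_cst (cGamma (2%:R * z))).
have := ccvg_unique H1 H2; rewrite !mulr1 => ->.
by rewrite h2 [_ * 2%:C]mulrC.
Qed.

End GammaDuplication.

(** * Confluent hypergeometric series *)

Lemma binomial_fact (F : numFieldType) (x y : F) n :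
  \sum_(i < n.+1) (x ^+ i / i`!%:R) * (y ^+ (n - i) / (n - i)`!%:R) = (x + y) ^+ n / n`!%:R.
Proof.
rewrite addrC exprDn mulr_suml; apply: eq_bigr => i _.
have i_n : (i <= n)%N by rewrite -ltnS.
have f0 k : (k`!%:R : F) != 0 by rewrite pnatr_eq0 -lt0n fact_gt0.
rewrite -(bin_fact i_n) !natrM -mulr_natr.
have b0 : ('C(n, i)%:R : F) != 0 by rewrite pnatr_eq0 -lt0n bin_gt0.
by field; rewrite b0 !f0.
Qed.

Lemma triangle_sum (F : pzRingType) (a b : nat -> F) N :
  \sum_(n < N) \sum_(i < n.+1) a i * b (n - i)%N =
  \sum_(i < N) a i * \sum_(j < N - i) b j.
Proof.
elim: N => [|N IH]; first by rewrite !big_ord0.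
rewrite big_ord_recr /= IH.
have -> : \sum_(i < N) a i * (\sum_(j < N - i) b j) =
    \sum_(i < N.+1) a i * (\sum_(j < N - i) b j).
  by rewrite big_ord_recr /= subnn big_ord0 mulr0 addr0.
rewrite -big_split /=; apply: eq_bigr => i _.
by rewrite -mulrDr subSn ?big_ord_recr // -ltnS.
Qed.

Section ExpSeries.
Context {R : realType}.
Implicit Types (X Y : R) (z w b c : R[i]) (n : nat).

Lemma expR_sum_cvg X : (fun N => \sum_(i < N) X ^+ i / i`!%:R) @ \oo --> expR X.
Proof.
have H : cvgn (series (exp_coeff X)) by exact: is_cvg_series_exp_coeff.
rewrite (_ : (fun N => _) = series (exp_coeff X)); first exact: H.
by apply/funext => N; rewrite /series /= big_mkord.
Qed.

Lemma expR_sum_le X N : 0 <= X -> \sum_(i < N) X ^+ i / i`!%:R <= expR X.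
Proof.
move=> X0; have H := @expR_sum_cvg X.
rewrite -(cvg_lim (@Rhausdorff R) H).
apply: (@nondecreasing_cvgn_le _ (fun N => \sum_(i < N) X ^+ i / i`!%:R)).
  apply/nondecreasing_seqP => n; rewrite big_ord_recr /= lerDl.
  by rewrite divr_ge0 // exprn_ge0.
by apply/cvg_ex; exists (expR X).
Qed.

Lemma sum_tail_le (u : nat -> R[i]) (e : nat -> R) k N : (forall n, cabs (u n) <= e n) ->
  (k <= N)%N -> cabs (\sum_(i < N) u i - \sum_(i < k) u i) <=
  \sum_(i < N) e i - \sum_(i < k) e i.
Proof.
move=> ue; elim: N => [|N IH].
  by rewrite leqn0 => /eqP ->; rewrite !subrr cabs0.
rewrite leq_eqVlt => /orP[/eqP ->|]; first by rewrite !subrr cabs0.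
rewrite ltnS => /IH h; rewrite !big_ord_recr /= [X in cabs X]addrAC [leRHS]addrAC.
by rewrite (le_trans (cabsD _ _)) // lerD.
Qed.

(** The sum over a square of indices minus that over the triangle is compared with the same
    difference for the majorants, which tends to e^X e^Y - e^(X + Y) = 0. *)
Lemma cauchy_product (u v : nat -> R[i]) X Y U V :
  (forall n, cabs (u n) <= X ^+ n / n`!%:R) -> (forall n, cabs (v n) <= Y ^+ n / n`!%:R) ->
  ccvg (fun N => \sum_(i < N) u i) U -> ccvg (fun N => \sum_(i < N) v i) V ->
  ccvg (fun N => \sum_(n < N) \sum_(i < n.+1) u i * v (n - i)%N) (U * V).
Proof.
move=> uX vY cU cV.
pose eX n := X ^+ n / n`!%:R; pose eY n := Y ^+ n / n`!%:R; pose eXY n := (X + Y) ^+ n / n`!%:R.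
have T : ccvg (fun N => (\sum_(i < N) u i) * (\sum_(i < N) v i) -
    \sum_(n < N) \sum_(i < n.+1) u i * v (n - i)%N) 0.
  apply: (@cabs_le_cvg0 _ _ (fun N => (\sum_(i < N) eX i) * (\sum_(i < N) eY i) - \sum_(i < N) eXY i)).
    move=> N; rewrite triangle_sum mulr_suml -sumrB.
    have -> : \sum_(i < N) eXY i = \sum_(i < N) eX i * \sum_(j < N - i) eY j.
      by rewrite -triangle_sum; apply: eq_bigr => n _; rewrite binomial_fact.
    rewrite mulr_suml -sumrB.
    apply: (le_trans (cabs_sum (fun i => u i * \sum_(j < N) v j - u i * \sum_(j < N - i) v j) N)).
    apply: ler_sum => i _; rewrite -!mulrBr cabsM; apply: ler_pM; rewrite ?cabs_ge0 //.
    by apply: sum_tail_le => //; exact: leq_subr.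
  have H : (fun N => (\sum_(i < N) eX i) * (\sum_(i < N) eY i) - \sum_(i < N) eXY i) @ \oo -->
      expR X * expR Y - expR (X + Y).
    by apply: cvgB; [apply: cvgM|]; exact: expR_sum_cvg.
  by move: H; rewrite expRD subrr; exact.
have := ccvgD (ccvgM cU cV) (ccvgN T); rewrite oppr0 addr0.
by under eq_fun do rewrite opprB addrC subrK.
Qed.

Lemma exp_dominated_cvg (u : nat -> R[i]) X : (forall n, cabs (u n) <= X ^+ n / n`!%:R) ->
  exists l, ccvg (fun N => \sum_(i < N) u i) l.
Proof.
move=> uX.
have real (r : nat -> R) : (forall n, `|r n| <= X ^+ n / n`!%:R) ->
    cvgn (fun N => \sum_(i < N) r i).
  move=> rX; have H : cvgn (series r).
    apply: normed_cvg; apply: (series_le_cvg _ _ rX) => //.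
      by move=> n; exact: le_trans (rX n).
    exact: is_cvg_series_exp_coeff.
  by move: H; rewrite /series /=; under eq_fun do rewrite big_mkord.
have H1 := real (fun n => complex.Re (u n)) (fun n => le_trans (Re_le_cabs _) (uX n)).
have H2 := real (fun n => complex.Im (u n)) (fun n => le_trans (Im_le_cabs _) (uX n)).
exists (limn (fun N => \sum_(i < N) complex.Re (u i)) +i*
        limn (fun N => \sum_(i < N) complex.Im (u i))).
split => /=.
  by under eq_fun do rewrite (cRe_sum u).
by under eq_fun do rewrite (cIm_sum u).
Qed.

Lemma iXn n : 'i%C ^+ n = ((~~ odd n)%:R * (-1) ^+ n./2) +i* ((odd n)%:R * (-1) ^+ n.-1./2) :> R[i].
Proof.
have E k : 'i%C ^+ k.*2 = ((-1) ^+ k)%:C :> R[i].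
  by rewrite -mul2n exprM sqr_i rmorphXn /= rmorphN rmorph1.
rewrite -{1}(odd_double_half n); case: (boolP (odd n)) => o /=.
  rewrite add1n exprS E; have -> : n.-1./2 = n./2.
    by rewrite -{1}(odd_double_half n) o add1n /= doubleK.
  by apply: complexP; rewrite ?cReM ?cImM /= ?mul0r ?mul1r ?mulr0 ?subr0 ?add0r ?addr0 ?sub0r ?oppr0.
by rewrite add0n E mul1r mul0r.
Qed.

(** [cexp] is defined through real functions, so its power series is the Cauchy product of those of
    e^x and of cos y + i sin y. *)
Lemma cexp_series z : ccvg (fun N => \sum_(n < N) z ^+ n / n`!%:R) (cexp z).
Proof.
case: z => x y.
have E n : (x +i* y) ^+ n / n`!%:R =
    \sum_(i < n.+1) ((x%:C) ^+ i / i`!%:R) * (('i%C * y%:C) ^+ (n - i) / (n - i)`!%:R) :> R[i].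
  by rewrite binomial_fact {1}(complexE (x +i* y)).
have -> : cexp (x +i* y) = (expR x)%:C * (cos y +i* sin y).
  by apply: complexP; rewrite ?cReM ?cImM /=; ring.
under eq_fun do under eq_bigr do rewrite E.
have nE k : (k`!%:R : R[i])^-1 = (k`!%:R^-1 : R)%:C by rewrite natr_complex fmorphV.
apply: (@cauchy_product (fun i => (x%:C) ^+ i / i`!%:R) (fun i => ('i%C * y%:C) ^+ i / i`!%:R) `|x| `|y|).
- by move=> n; rewrite cabsM cabsV cabs_nat cabsX cabs_real.
- by move=> n; rewrite cabsM cabsV cabs_nat cabsX cabsM cabs_i mul1r cabs_real.
- have H := @expR_sum_cvg x; split => /=.
    rewrite (_ : (fun N => _) = (fun N => \sum_(i < N) x ^+ i / i`!%:R)) //.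
    apply/funext => N; rewrite (cRe_sum (fun i => (x%:C) ^+ i / i`!%:R)); apply: eq_bigr => i _.
    by rewrite nE -rmorphXn -rmorphM.
  rewrite (_ : (fun N => _) = fun=> 0); first exact: cvg_cst.
  apply/funext => N; rewrite (cIm_sum (fun i => (x%:C) ^+ i / i`!%:R)) big1 // => i _.
  by rewrite nE -rmorphXn -rmorphM.
- have T n : ('i%C * y%:C) ^+ n / n`!%:R = cos_coeff y n +i* sin_coeff y n.
    rewrite exprMn iXn nE -rmorphXn; apply: complexP;
      rewrite ?cReM ?cImM /= ?mulr0 ?mul0r ?subr0 ?addr0 ?add0r /cos_coeff /sin_coeff /=.
      by [].
    by [].
  split => /=.
    have H : cvgn (series (cos_coeff y)) by exact: is_cvg_series_cos_coeff.
    rewrite (_ : (fun N => _) = series (cos_coeff y)); first by rewrite cos.unlock; exact: H.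
    apply/funext => N; rewrite /series /= big_mkord (cRe_sum (fun i => ('i%C * y%:C) ^+ i / i`!%:R)).
    by apply: eq_bigr => i _; rewrite T.
  have H : cvgn (series (sin_coeff y)) by exact: is_cvg_series_sin_coeff.
  rewrite (_ : (fun N => _) = series (sin_coeff y)); first by rewrite sin.unlock; exact: H.
  apply/funext => N; rewrite /series /= big_mkord (cIm_sum (fun i => ('i%C * y%:C) ^+ i / i`!%:R)).
  by apply: eq_bigr => i _; rewrite T.
Qed.

Lemma pochhammerD c i k : pochhammer c (i + k) = pochhammer c i * pochhammer (c + i%:R) k.
Proof.
elim: k => [|k IH]; first by rewrite addn0 pochhammer0 mulr1.
by rewrite addnS !pochhammerS IH natrD -!mulrA addrA.
Qed.

Lemma pochhammerSl c k : pochhammer c k.+1 = c * pochhammer (c + 1) k.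
Proof. by rewrite -add1n pochhammerD pochhammerS pochhammer0 addr0 mul1r. Qed.

(** The Chu-Vandermonde identity with denominators cleared. In the induction Pascal's rule splits
    the sum: one part gains the last factor c + n, the other releases the first factor b with a
    sign, and (c + n) (c - b)_n - b (c - b)_n = (c - b)_(n + 1). *)
Lemma chu_vandermonde n b c :
  \sum_(i < n.+1) 'C(n, i)%:R * (-1) ^+ i * pochhammer b i * pochhammer (c + i%:R) (n - i) =
  pochhammer (c - b) n.
Proof.
elim: n b c => [|n IH] b c.
  by rewrite big_ord_recr big_ord0 /= !pochhammer0 bin0 expr0 !mulr1 add0r.
have E i : (i < n.+2)%N -> 'C(n.+1, i)%:R * (-1) ^+ i * pochhammer b i * pochhammer (c + i%:R) (n.+1 - i) =
   (c + n%:R) * ('C(n, i)%:R * (-1) ^+ i * pochhammer b i * pochhammer (c + i%:R) (n - i)) +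
   (if i is j.+1 then - b * ('C(n, j)%:R * (-1) ^+ j * pochhammer (b + 1) j * pochhammer (c + 1 + j%:R) (n - j)) else 0) :> R[i].
  case: i => [|i] hi.
    by rewrite !bin0 !expr0 !pochhammer0 addr0 !subn0 pochhammerS addr0; ring.
  rewrite binS natrD exprS subSS pochhammerSl.
  have -> : c + 1 + i%:R = c + i.+1%:R by rewrite -addn1 natrD; ring.
  have [h|h] := ltnP i n.
    have -> : (n - i)%N = (n - i.+1).+1 by rewrite subnSK.
    rewrite [pochhammer _ (n - i.+1).+1]pochhammerS.
    have -> : c + i.+1%:R + (n - i.+1)%:R = c + n%:R.
      by rewrite -addrA -natrD subnKC.
    ring.
  have -> : (n - i)%N = 0%N by apply/eqP; rewrite subn_eq0.
  by rewrite (bin_small (_ : n < i.+1)%N) // pochhammer0; ring.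
rewrite (eq_bigr (fun i : 'I_n.+2 => (c + n%:R) * ('C(n, i)%:R * (-1) ^+ i * pochhammer b i * pochhammer (c + i%:R) (n - i)) +
   (if val i is j.+1 then - b * ('C(n, j)%:R * (-1) ^+ j * pochhammer (b + 1) j * pochhammer (c + 1 + j%:R) (n - j)) else 0))); last first.
  by move=> i _; exact: E.
rewrite big_split /= -mulr_sumr big_ord_recr /= bin_small // !mul0r addr0 IH.
rewrite big_ord_recl /= add0r -mulr_sumr.
rewrite (eq_bigr (fun j : 'I_n.+1 => 'C(n, j)%:R * (-1) ^+ j * pochhammer (b + 1) j * pochhammer (c + 1 + j%:R) (n - j))) //.
rewrite IH pochhammerS; have -> : c + 1 - (b + 1) = c - b by ring.
ring.
Qed.

Notation c32 := (3%:R / 2%:R : R[i]).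

Lemma c32E k : c32 + k%:R = (3 / 2 + k%:R : R)%:C.
Proof. by rewrite !natr_complex -fmorphV -rmorphM -rmorphD. Qed.

Lemma poch32_neq0 k : pochhammer c32 k != 0.
Proof.
elim: k => [|k IH]; first by rewrite pochhammer0 oner_eq0.
by rewrite pochhammerS mulf_neq0.
Qed.

Definition hyp_term b z n : R[i] := pochhammer b n / pochhammer c32 n * (z ^+ n / n`!%:R).

(** Successive factors satisfy |b + n| / (3/2 + n) <= 1 + |b|, so the series is dominated by an
    exponential one. *)
Lemma hyp_term_le b z n : cabs (hyp_term b z n) <= ((1 + cabs b) * cabs z) ^+ n / n`!%:R.
Proof.
rewrite /hyp_term !cabsM !cabsV cabs_nat cabsX exprMn -[leRHS]mulrA ler_wpM2r //.
  by rewrite divr_ge0 // exprn_ge0 // cabs_ge0.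
elim: n => [|n IH]; first by rewrite !pochhammer0 cabs1 invr1 mulr1 expr0.
rewrite !pochhammerS !cabsM exprS invfM mulrACA [leLHS]mulrC ler_pM //.
- by rewrite mulr_ge0 ?invr_ge0 ?cabs_ge0.
- by rewrite mulr_ge0 ?invr_ge0 ?cabs_ge0.
have p0 : 0 < 3 / 2 + n%:R :> R by rewrite ltr_wpDr // divr_gt0.
rewrite c32E cabs_real (gtr0_norm p0) ler_pdivrMr //.
apply: (le_trans (cabsD _ _)); rewrite cabs_nat mulrDr.
have b0 := cabs_ge0 b; have n0 : 0 <= n%:R :> R by [].
have : 0 <= cabs b * n%:R by rewrite mulr_ge0.
lra.
Qed.

Lemma hyp1F1_cvg b z : ccvg (fun N => \sum_(n < N) hyp_term b z n) (hyp1F1 b c32 z).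
Proof.
have [l hl] := exp_dominated_cvg (hyp_term_le b z).
by rewrite /hyp1F1 (cseriesE hl).
Qed.

(** In the Cauchy product of the series of e^(-z) and of the 1F1, the coefficient of each power is
    evaluated by [chu_vandermonde] with c = 3/2. *)
Lemma kummer b z : cexp (- z) * hyp1F1 b c32 z = hyp1F1 (c32 - b) c32 (- z).
Proof.
have H : ccvg (fun N => \sum_(n < N) \sum_(i < n.+1) hyp_term b z i * ((- z) ^+ (n - i) / (n - i)`!%:R))
   (hyp1F1 b c32 z * cexp (- z)).
  apply: (@cauchy_product _ (fun i => (- z) ^+ i / i`!%:R) ((1 + cabs b) * cabs z) (cabs z)).
  - exact: hyp_term_le.
  - by move=> n; rewrite cabsM cabsV cabs_nat cabsX cabsN.
  - exact: hyp1F1_cvg.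
  - exact: cexp_series.
rewrite mulrC; apply: (ccvg_unique H); have := hyp1F1_cvg (c32 - b) (- z).
congr ccvg; apply/funext => N; apply: eq_bigr => n _.
rewrite /hyp_term -chu_vandermonde !mulr_suml; apply: eq_bigr => i _.
have i_n : (i <= n)%N by rewrite -ltnS.
have f0 k : (k`!%:R : R[i]) != 0 by rewrite pnatr_eq0 -lt0n fact_gt0.
have P : pochhammer c32 n = pochhammer c32 i * pochhammer (c32 + i%:R) (n - i).
  by rewrite -pochhammerD subnKC.
have P1 := poch32_neq0 i.
have P2 : pochhammer (c32 + i%:R) (n - i) != 0.
  by have := poch32_neq0 n; rewrite P mulf_eq0 negb_or => /andP[].
have B : (n`!%:R : R[i]) = 'C(n, i)%:R * (i`!%:R * (n - i)`!%:R).
  by rewrite -(bin_fact i_n) !natrM.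
have b0 : ('C(n, i)%:R : R[i]) != 0 by rewrite pnatr_eq0 -lt0n bin_gt0.
have X : (- z) ^+ n = (-1) ^+ i * z ^+ i * (- z) ^+ (n - i).
  by rewrite -exprMn mulN1r -exprD subnKC.
have S : (-1 : R[i]) ^+ i * (-1) ^+ i = 1 by rewrite -exprD -signr_odd addnn odd_double.
rewrite P B X.
transitivity (pochhammer b i / pochhammer c32 i * (((-1) ^+ i * (-1) ^+ i) * z ^+ i / i`!%:R) * ((- z) ^+ (n - i) / (n - i)`!%:R)).
  by field; rewrite P1 P2 b0 !f0.
by rewrite S mul1r.
Qed.

(** In the partial sums of length 2 N for e^z and e^(-z) the even powers cancel and the odd ones
    double. *)
Lemma csinh_series z : ccvg (fun N => \sum_(k < N) z ^+ k.*2.+1 / (k.*2.+1)`!%:R) (csinh z).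
Proof.
have H1 := cexp_series z; have H2 := cexp_series (- z).
have H := ccvgZ 2%:R^-1 (ccvgD H1 (ccvgN H2)).
have dbl n : (n <= n.*2)%N by rewrite -addnn leq_addr.
have := ccvg_sub dbl H; rewrite [2%:R^-1 * _]mulrC.
congr ccvg; apply/funext => N.
elim: N => [|N IH]; first by rewrite double0 !big_ord0 subr0 mulr0.
have e1 : (- z) ^+ N.*2 = z ^+ N.*2 by rewrite exprNn -signr_odd odd_double expr0 mul1r.
have e2 : (- z) ^+ N.*2.+1 = - z ^+ N.*2.+1 by rewrite exprS e1 mulNr -exprS.
rewrite doubleS !big_ord_recr /= -IH e1 e2.
have h2 : (2%:R : R[i]) != 0 by rewrite pnatr_eq0.
have f0 k : (k`!%:R : R[i]) != 0 by rewrite pnatr_eq0 -lt0n fact_gt0.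
by field; rewrite !f0.
Qed.

(** From 1 / (2 k + 1)! <= 1 / (2 k)!. The factor |z| in front is what lets [gauss_sinh] reach down
    to Re p > -2. *)
Lemma csinh_sum_le z N :
  cabs (\sum_(k < N) z ^+ k.*2.+1 / (k.*2.+1)`!%:R) <= cabs z * expR (cabs z).
Proof.
have z0 := cabs_ge0 z.
apply: (le_trans (cabs_sum (fun k => z ^+ k.*2.+1 / (k.*2.+1)`!%:R) N)).
apply: (@le_trans _ _ (cabs z * \sum_(i < N.*2) cabs z ^+ i / i`!%:R)); last first.
  by rewrite ler_wpM2l // expR_sum_le.
elim: N => [|N IH]; first by rewrite !big_ord0 mulr0.
rewrite doubleS !big_ord_recr /= -addrA mulrDr lerD // mulrDr ler_wpDr //.
  by rewrite mulr_ge0 // divr_ge0 // exprn_ge0.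
rewrite cabsM cabsV cabs_nat cabsX exprS -mulrA ler_wpM2l // ler_wpM2l ?exprn_ge0 //.
by rewrite lef_pV2 ?posrE ?ltr0n ?fact_gt0 // ler_nat factS leq_pmull.
Qed.

Lemma cabs_csinh z : cabs (csinh z) <= cabs z * expR (cabs z).
Proof. exact: ccvg_le (csinh_series z) (csinh_sum_le z). Qed.

Lemma csinE z : csin z = csinh ('i%C * z) / 'i%C.
Proof. by rewrite /csin /csinh invfM mulrA. Qed.

Lemma cabs_csin z : cabs (csin z) <= cabs z * expR (cabs z).
Proof.
rewrite csinE cabsM cabsV cabs_i invr1 mulr1 (le_trans (cabs_csinh _)) //.
by rewrite cabsM cabs_i mul1r.
Qed.

(** The origin of the lower parameter 3/2: the factorials of the odd series become those of a 1F1 in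
    the variable w^2 / 4. *)
Lemma fact_double_succ k : ((k.*2.+1)`!%:R : R[i]) = k`!%:R * 4%:R ^+ k * pochhammer c32 k.
Proof.
elim: k => [|k IH]; first by rewrite double0 !fact0 factS fact0 pochhammer0 expr0 !mulr1.
rewrite doubleS factS natrM [(k.*2.+2)`!]factS natrM IH factS natrM pochhammerS exprS.
have h2 : (2%:R : R[i]) != 0 by rewrite pnatr_eq0.
have -> : (k.*2.+3%:R : R[i]) = 2%:R * k%:R + 3%:R.
  by rewrite -mul2n -natrM -natrD addn3.
have -> : (k.*2.+2%:R : R[i]) = 2%:R * k%:R + 2%:R.
  by rewrite -mul2n -natrM -natrD addn2.
rewrite -[k.+1]addn1 natrD.
by field.
Qed.

(** Termwise integration: the k-th power of u gives Gamma (b + k) / 2 = (b)_k Gamma (b) / 2 with b =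
    p / 2 + 1, and [fact_double_succ] recognises the 1F1. *)
Lemma gauss_sinh p w : - 2 < complex.Re p ->
  cintble (pos R) (fun u => cpow u p * (expR (- u ^+ 2))%:C * csinh (w * u%:C)) /\
  cintegral (pos R) (fun u => cpow u p * (expR (- u ^+ 2))%:C * csinh (w * u%:C)) =
  w / 2%:R * cGamma (p / 2%:R + 1) * hyp1F1 (p / 2%:R + 1) c32 (w ^+ 2 / 4%:R).
Proof.
move=> p2; set b := p / 2%:R + 1.
have h2 : (2%:R : R[i]) != 0 by rewrite pnatr_eq0.
have bE : complex.Re b = complex.Re p / 2 + 1.
  by rewrite /b cReD natr_complex -fmorphV cReM /= mulr0 subr0.
have b0 : 0 < complex.Re b by rewrite bE; lra.
have bk k : 0 < complex.Re (b + k%:R) by rewrite cReD natr_complex /= ltr_wpDr.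
pose F k u : R[i] := (w ^+ k.*2.+1 / (k.*2.+1)`!%:R) *
   (cpow u (2%:R * (b + k%:R) - 1) * (expR (- u ^+ 2))%:C).
have FE k u : 0 < u -> F k u = cpow u p * (expR (- u ^+ 2))%:C *
    ((w * u%:C) ^+ k.*2.+1 / (k.*2.+1)`!%:R).
  move=> u0; rewrite /F exprMn -(cpow1 u0).
  have -> : cpow u (2%:R * (b + k%:R) - 1) = cpow u p * cpow u 1 ^+ k.*2.+1.
    have -> : cpow u 1 ^+ k.*2.+1 = cpow u k.*2.+1%:R by rewrite cpow1 // cpow_nat // rmorphXn.
    rewrite -(cpowD u); congr (cpow u _).
    have -> : (k.*2.+1%:R : R[i]) = 2%:R * k%:R + 1 by rewrite -addn1 -mul2n natrD natrM.
    by rewrite /b; field.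
  by ring.
have iF k : cintble (pos R) (F k) by apply: cintbleZ => //; exact: (cGamma_sqr (bk k)).1.
pose g u := cabs w * (u `^ (complex.Re p + 1) * expR (cabs w * u - u ^+ 2)).
have ig : rintble (pos R) g by apply: rintbleZ => //; apply: gauss_rintble; lra.
have sumE n u : 0 < u -> \sum_(i < n) F i u = cpow u p * (expR (- u ^+ 2))%:C *
    \sum_(i < n) (w * u%:C) ^+ i.*2.+1 / (i.*2.+1)`!%:R.
  by move=> u0; rewrite mulr_sumr; apply: eq_bigr => i _; exact: FE.
have [] := @cintegral_series _ _ F
  (fun u => cpow u p * (expR (- u ^+ 2))%:C * csinh (w * u%:C)) g _ iF ig.
- by [].
- move=> n u /posP u0; rewrite sumE // cabsM cabsM cabs_cpow // cabs_real (ger0_norm (expR_ge0 _)).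
  have E : g u = u `^ complex.Re p * expR (- u ^+ 2) * (cabs (w * u%:C) * expR (cabs (w * u%:C))).
    rewrite /g cabsM cabs_real (gtr0_norm u0) powRD ?(gt_eqF u0) ?implybT // (powRr1 (ltW u0)) expRD.
    ring.
  by rewrite E ler_wpM2l ?mulr_ge0 ?powR_ge0 ?expR_ge0 // csinh_sum_le.
- move=> u /posP u0; have := ccvgZ (cpow u p * (expR (- u ^+ 2))%:C) (csinh_series (w * u%:C)).
  by congr ccvg; apply/funext => n; rewrite sumE.
move=> i1 c1; split => //; apply: (ccvg_unique c1).
have := ccvgZ (w / 2%:R * cGamma b) (hyp1F1_cvg b (w ^+ 2 / 4%:R)).
congr ccvg; apply/funext => n; rewrite mulr_sumr; apply: eq_bigr => k _.
rewrite /F cintegralZ //; last exact: (cGamma_sqr (bk k)).1.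
rewrite (cGamma_sqr (bk k)).2 cGamma_poch // fact_double_succ /hyp_term.
have f0 : (k`!%:R : R[i]) != 0 by rewrite pnatr_eq0 -lt0n fact_gt0.
have h4 : (4%:R : R[i]) != 0 by rewrite pnatr_eq0.
have -> : w ^+ k.*2.+1 = w * (w ^+ 2) ^+ k by rewrite exprS -mul2n exprM.
rewrite expr_div_n.
by field; rewrite f0 poch32_neq0 expf_neq0.
Qed.

Lemma gauss_sin p w : - 2 < complex.Re p ->
  cintble (pos R) (fun u => cpow u p * (expR (- u ^+ 2))%:C * csin (w * u%:C)) /\
  cintegral (pos R) (fun u => cpow u p * (expR (- u ^+ 2))%:C * csin (w * u%:C)) =
  w / 2%:R * cGamma (p / 2%:R + 1) * hyp1F1 (p / 2%:R + 1) c32 (- (w ^+ 2 / 4%:R)).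
Proof.
move=> p2; have [i1 E1] := gauss_sinh ('i%C * w) p2.
have i0 : ('i%C : R[i]) != 0 by rewrite -cabs_eq0 cabs_i oner_eq0.
have E u : cpow u p * (expR (- u ^+ 2))%:C * csin (w * u%:C) =
   'i%C^-1 * (cpow u p * (expR (- u ^+ 2))%:C * csinh ('i%C * w * u%:C)).
  by rewrite csinE mulrA [RHS]mulrC mulrA.
have -> : (fun u => cpow u p * (expR (- u ^+ 2))%:C * csin (w * u%:C)) =
   fun u => 'i%C^-1 * (cpow u p * (expR (- u ^+ 2))%:C * csinh ('i%C * w * u%:C)).
  by apply/funext => u.
split; first exact: cintbleZ.
have E2 : ('i%C * w) ^+ 2 / 4%:R = - (w ^+ 2 / 4%:R) by rewrite exprMn sqr_i mulN1r mulNr.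
rewrite E2 in E1.
transitivity ('i%C^-1 * cintegral (pos R)
    (fun u => cpow u p * (expR (- u ^+ 2))%:C * csinh ('i%C * w * u%:C))).
  exact: cintegralZ.
by rewrite E1 !mulrA mulVf // mul1r.
Qed.

End ExpSeries.

(** * Partial fractions of the hyperbolic cotangent *)

(** (1 - r^m) / (1 - r z^k) is the geometric sum of (r z^k)^j over j < m; after summation over k,
    the powers of z cancel except for j = 0. *)
Lemma sum_inv_sub_unity_root (F : fieldType) (z r : F) m : z ^+ m = 1 ->
  (forall j, (0 < j < m)%N -> z ^+ j != 1) -> (forall k, 1 - r * z ^+ k != 0) ->
  (1 - r ^+ m) * \sum_(k < m) (1 - r * z ^+ k)^-1 = m%:R.
Proof.
move=> zm zj h.
have E k : (1 - r ^+ m) * (1 - r * z ^+ k)^-1 = \sum_(j < m) r ^+ j * (z ^+ j) ^+ k.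
  have -> : 1 - r ^+ m = (1 - r * z ^+ k) * \sum_(j < m) (r * z ^+ k) ^+ j.
    have := subrX1 (r * z ^+ k) m; rewrite exprMn -exprM mulnC exprM zm expr1n mulr1 => H.
    by rewrite -[LHS]opprB H -mulNr opprB.
  rewrite mulrAC mulfV // mul1r; apply: eq_bigr => j _.
  by rewrite exprMn -!exprM mulnC.
rewrite mulr_sumr; under eq_bigr do rewrite E.
rewrite exchange_big /=; under eq_bigr do rewrite -mulr_sumr.
case: m zm zj E => [|m] zm zj E; first by rewrite big_ord0.
rewrite big_ord_recl [X in _ + X]big1 => [|j _].
  rewrite addr0 /= expr0 mul1r; under eq_bigr do rewrite expr1n.
  by rewrite sumr_const card_ord.
suff -> : \sum_(k < m.+1) (z ^+ lift ord0 j) ^+ k = 0 by rewrite mulr0.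
have jm : (0 < lift ord0 j < m.+1)%N by rewrite /= ltnS ltn_ord.
apply: (mulfI (_ : z ^+ lift ord0 j - 1 != 0)); first by rewrite subr_eq0 zj.
by rewrite -subrX1 -exprM mulnC exprM zm expr1n subrr mulr0.
Qed.

Section CothSeries.
Context {R : realType}.
Implicit Types (x y r : R) (z : R[i]).

Lemma cexp_natr z n : cexp z ^+ n = cexp (n%:R * z).
Proof.
elim: n => [|n IH]; first by rewrite expr0 mul0r cexp0.
by rewrite exprS IH -cexpD -[n.+1]addn1 natrD; congr cexp; ring.
Qed.

Lemma cReV z : complex.Re z^-1 = complex.Re z / (complex.Re z ^+ 2 + complex.Im z ^+ 2).
Proof. by case: z. Qed.

(* The Poisson kernel [Re ((1 + r z ^ k) / (1 - r z ^ k))] at [z = e ^ (2 pi i / m)]; its sum over k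
   becomes the partial fractions of coth as [m = 2 p + 1 --> oo] with [r = e ^ (- 2 pi y / m)]. *)
Definition poisson_term r m k : R :=
  (1 - r ^+ 2) / ((1 - r) ^+ 2 + 4 * r * sin (pi * k%:R / m%:R) ^+ 2).

(** Each term is 2 Re (1 / (1 - r z^k)) - 1, so the sum is 2 m / (1 - r^m) - m. That z is a
    primitive root of unity rests on sin(pi j / m) > 0 for 0 < j < m. *)
Lemma sum_poisson_term r m : 0 < r < 1 -> (0 < m)%N ->
  \sum_(k < m) poisson_term r m k = m%:R * (1 + r ^+ m) / (1 - r ^+ m).
Proof.
move=> /andP[r0 r1] m0; have m0' : 0 < m%:R :> R by rewrite ltr0n.
pose t : R := 2 * pi / m%:R.
pose z : R[i] := cexp (0 +i* t).
have zk k : z ^+ k = cos (k%:R * t) +i* sin (k%:R * t).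
  rewrite /z cexp_natr natr_complex; apply: complexP;
    by rewrite /= !mulr0 !mul0r ?subr0 ?add0r ?addr0 expR0 mul1r.
have tk k : k%:R * t = (pi * k%:R / m%:R) *+ 2 by rewrite /t -mulr_natr; ring.
have rz k : 1 - r%:C * z ^+ k != 0.
  rewrite subr_eq0; apply/eqP => H; have : cabs (1 : R[i]) = cabs (r%:C * z ^+ k) by rewrite H.
  rewrite cabs1 cabsM cabsX cabs_cexp cabs_real (_ : complex.Re (0 +i* t) = 0) //.
  rewrite expR0 expr1n mulr1 gtr0_norm //.
  by move=> E; move: r1; rewrite -E ltxx.
have zm : z ^+ m = 1.
  rewrite zk /t mulrC divfK ?gt_eqF // mulrC mulr_natr; apply: complexP => /=.
    by rewrite cos2pi.
  by rewrite sin2pi.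
have zj j : (0 < j < m)%N -> z ^+ j != 1.
  move=> /andP[j0 jm]; apply/eqP => H.
  have : complex.Re (z ^+ j) = 1 by rewrite H.
  rewrite zk /= tk cos_mulr2n cos2sin2.
  have : 0 < sin (pi * j%:R / m%:R) :> R.
    apply: sin_gt0_pi; rewrite divr_gt0 ?mulr_gt0 ?pi_gt0 ?ltr0n //=.
    by rewrite ltr_pdivrMr // ltr_pM2l ?pi_gt0 // ltr_nat.
  move=> s0; have := exprn_gt0 2 s0; rewrite mulr2n; lra.
have S := sum_inv_sub_unity_root zm zj rz.
have Tk k : poisson_term r m k = 2 * complex.Re (1 - r%:C * z ^+ k)^-1 - 1.
  rewrite cReV cReD cImD cReN cImN cReM cImM zk /= !mul0r subr0 addr0 sub0r tk cos_mulr2n sin_mulr2n.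
  rewrite /poisson_term; set s := sin _; set c := cos _.
  have c2 : c ^+ 2 = 1 - s ^+ 2 by rewrite /c cos2sin2.
  have D : (1 - r * (c ^+ 2 *+ 2 - 1)) ^+ 2 + (- (r * ((c * s) *+ 2))) ^+ 2 =
     (1 - r) ^+ 2 + 4 * r * s ^+ 2.
    have -> : (- (r * ((c * s) *+ 2))) ^+ 2 = 4 * r ^+ 2 * c ^+ 2 * s ^+ 2 by ring.
    rewrite c2; ring.
  rewrite D c2.
  have D0 : (1 - r) ^+ 2 + 4 * r * s ^+ 2 != 0.
    rewrite gt_eqF // ltr_wpDr ?exprn_gt0 ?subr_gt0 //.
    by rewrite mulr_ge0 ?sqr_ge0 // mulr_ge0 // ltW.
  by field; rewrite ?D0.
under eq_bigr do rewrite Tk.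
rewrite sumrB -mulr_sumr sumr_const card_ord -(cRe_sum (fun k => (1 - r%:C * z ^+ k)^-1)).
have q1 : 1 - r ^+ m != 0 by rewrite gt_eqF // subr_gt0 exprn_ilt1 ?(ltW r0) // -lt0n.
have -> : \sum_(i < m) (1 - r%:C * z ^+ i)^-1 = (m%:R / (1 - r ^+ m))%:C.
  apply: (mulfI (_ : (1 - r%:C ^+ m) != 0)).
    by rewrite -rmorphXn -(rmorph1 (real_complex R)) -rmorphB; apply: contra q1 => /eqP/complexI/eqP.
  rewrite S -rmorphXn -(rmorph1 (real_complex R)) -rmorphB -rmorphM /= mulrC divfK // natr_complex //.
by rewrite /= -[1 *+ m]/(m%:R); field.
Qed.

Lemma sin_le x : 0 <= x -> sin x <= x.
Proof.
move=> x0; have := @lipschitz1 R sin cos x (@is_derive_sin R) (@cos_max R) x0.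
by rewrite sin0 subr0; apply: le_trans; exact: ler_norm.
Qed.

Lemma sin_ge_xcos x : 0 <= x <= pi / 2 -> x * cos x <= sin x.
Proof.
move=> /andP[x0 xp]; rewrite -subr_ge0.
pose f u : R := sin u - u * cos u.
have df u : is_derive u (1 : R) f (u * sin u).
  have h := is_derive_mul (is_derive_id u (1 : R)) (is_derive_cos u).
  have H : is_derive u (1 : R) (sin - (fun x => x * cos x)) (cos u - (1 * cos u + u * - sin u)).
    exact: is_deriveB.
  by apply: (is_derive_eq H); ring.
have [|c /[!in_itv]/= /andP[c0 cx]] := @MVT_segment R f (fun u => u * sin u) 0 x x0 (fun u _ => df u).
  apply: continuous_subspaceT => u; apply: differentiable_continuous.
  apply/derivable1_diffP; exact: (@ex_derive _ _ _ _ _ _ _ (df u)).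
rewrite {1 2}/f sin0 mul0r subr0 subr0 => ->.
rewrite !mulr_ge0 // ?subr0 // sin_ge0_pi // c0 /= (le_trans cx) // (le_trans xp) //.
by rewrite ler_pdivrMr // ler_peMr ?pi_ge0 // ler1n.
Qed.

(** By [sin_ge_xcos] at x / 2, sin x = 2 sin(x/2) cos(x/2) >= x cos(x/2)^2 = x (1 + cos x) / 2, and
    cos x >= 0. *)
Lemma sin_ge_half x : 0 <= x <= pi / 2 -> x / 2 <= sin x.
Proof.
move=> /andP[x0 xp].
have xE : x = (x / 2) *+ 2 by rewrite -mulr_natr divfK.
have h : 0 <= x / 2 <= pi / 2.
  by rewrite divr_ge0 //= ler_pM2r // (le_trans xp) // ler_pdivrMr // ler_peMr ?pi_ge0 // ler1n.
have H := sin_ge_xcos h.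
have c1 : 0 <= cos (x / 2) by apply: cos_ge0_pihalf; have := pi_ge0 R; move: h => /andP[]; lra.
have c2 : 0 <= cos x by apply: cos_ge0_pihalf; have := pi_ge0 R; lra.
have E : cos x = cos (x / 2) ^+ 2 *+ 2 - 1 by rewrite {1}xE cos_mulr2n.
have -> : sin x = (cos (x / 2) * sin (x / 2)) *+ 2 by rewrite {1}xE sin_mulr2n.
have := ler_wpM2l c1 H.
have -> : cos (x / 2) * (x / 2 * cos (x / 2)) = x / 2 * cos (x / 2) ^+ 2 by ring.
have : 0 <= x * cos x by rewrite mulr_ge0.
have -> : x * cos x = 2 * (x * cos (x / 2) ^+ 2) - x by rewrite E; ring.
have -> : x / 2 * cos (x / 2) ^+ 2 = (x * cos (x / 2) ^+ 2) / 2 by ring.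
move: (cos (x / 2) * sin (x / 2)) (x * cos (x / 2) ^+ 2) => u v; lra.
Qed.

Lemma cvg_inv_odd : (fun p : nat => ((p + p).+1%:R)^-1 : R) @ \oo --> 0.
Proof.
have H : (fun p : nat => (p + p)%N) @ \oo --> \oo.
  move=> A [N _ NA]; exists N => // n /= Nn; apply: NA => /=.
  exact: leq_trans Nn (leq_addr _ _).
exact: (cvg_comp _ _ H (@cvg_harmonic R)).
Qed.

Lemma cvg_scaled_sub_expR c : 0 <= c ->
  (fun p : nat => (p + p).+1%:R * (1 - expR (- (c / (p + p).+1%:R))) : R) @ \oo --> c.
Proof.
move=> c0; apply: (@squeeze_cvgr _ _ _ _ (fun p => c / (1 + c * ((p + p).+1%:R)^-1)) (fun=> c)).
- apply: nearW => p; set m : R := (p + p).+1%:R; have m0 : 0 < m by rewrite ltr0n.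
  have cm : 0 <= c / m by rewrite divr_ge0 // ltW.
  apply/andP; split.
    have h1 : 0 < 1 + c / m by exact: ltr_wpDr.
    have : expR (- (c / m)) <= (1 + c / m)^-1.
      by rewrite expRN lef_pV2 ?posrE ?expR_gt0 // expR_ge1Dx.
    have E : c / (1 + c / m) = m * (1 - (1 + c / m)^-1).
      apply: (mulIf (lt0r_neq0 h1)); rewrite divfK ?lt0r_neq0 // -mulrA mulrBl mul1r.
      by rewrite mulVf ?lt0r_neq0 // addrAC subrr add0r mulrC divfK // gt_eqF.
    by move=> h; rewrite E ler_pM2l // lerB.
  have := expR_ge1Dx (- (c / m)) => h.
  have -> : c = m * (c / m) by rewrite mulrC divfK // gt_eqF.
  rewrite {1}(_ : m * (c / m) = c); last by rewrite mulrC divfK // gt_eqF.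
  rewrite ler_pM2l //; move: h; move: (c / m) (expR _) => u v; lra.
- have H : (fun p : nat => 1 + c * ((p + p).+1%:R)^-1) @ \oo --> 1 + c * 0.
    by apply: cvgD; [exact: cvg_cst|apply: cvgM; [exact: cvg_cst|exact: cvg_inv_odd]].
  rewrite mulr0 addr0 in H.
  have H2 : (fun p : nat => c / (1 + c * ((p + p).+1%:R)^-1)) @ \oo --> c / 1.
    by apply: cvgM; [exact: cvg_cst|apply: cvgV => //; exact: oner_neq0].
  by rewrite divr1 in H2.
- exact: cvg_cst.
Qed.

Lemma cvg_scaled_sin c : 0 <= c ->
  (fun p : nat => (p + p).+1%:R * sin (c / (p + p).+1%:R) : R) @ \oo --> c.
Proof.
move=> c0; apply: (@squeeze_cvgr _ _ _ _ (fun p => c * cos (c * ((p + p).+1%:R)^-1)) (fun=> c)).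
- have h : (fun p : nat => c * ((p + p).+1%:R)^-1) @ \oo --> c * 0.
    by apply: cvgM; [exact: cvg_cst|exact: cvg_inv_odd].
  rewrite mulr0 in h; move/cvgrPdist_le : h => /(_ (pi / 2)).
  move=> /(_ ltac:(by rewrite divr_gt0 // pi_gt0)); apply: filterS => p.
  set m : R := (p + p).+1%:R; have m0 : 0 < m by rewrite ltr0n.
  have cm : 0 <= c / m by rewrite divr_ge0 // ltW.
  rewrite sub0r normrN ger0_norm // => cp.
  have cE : c = m * (c / m) by rewrite mulrC divfK // gt_eqF.
  apply/andP; split.
    by rewrite {1}cE -mulrA ler_pM2l // sin_ge_xcos // cm.
  by rewrite [leRHS]cE ler_pM2l // sin_le.
- have h : (fun p : nat => c * ((p + p).+1%:R)^-1) @ \oo --> c * 0.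
    by apply: cvgM; [exact: cvg_cst|exact: cvg_inv_odd].
  have H : (fun p : nat => c * cos (c * ((p + p).+1%:R)^-1)) @ \oo --> c * cos (c * 0).
    apply: cvgM; first exact: cvg_cst.
    by apply: continuous_cvg => //; exact: continuous_cos.
  by rewrite mulr0 cos0 mulr1 in H.
- exact: cvg_cst.
Qed.

(** Pairs k with m - k; an odd m = 2 p + 1 leaves only k = 0 without a partner. *)
Lemma sum_symmetric (F : nat -> R) p :
  (forall i, (i < p)%N -> F (p + p - i)%N = F i.+1) ->
  \sum_(k < (p + p).+1) F k = F 0%N + 2 * \sum_(i < p) F i.+1.
Proof.
move=> sym; rewrite big_ord_recl; congr (_ + _).
rewrite big_split_ord /= mulr_natl mulr2n; congr (_ + _).
rewrite (reindex_inj rev_ord_inj) /=; apply: eq_bigr => i _.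
rewrite -(sym _ (ltn_ord i)); congr F.
by rewrite /bump /= add1n -addnS subnSK // addnBA // ltnW.
Qed.

Let r_ y (p : nat) : R := expR (- (2 * pi * y / (p + p).+1%:R)).
(** The terms of coth(pi y) = sum over all integers k of y / (pi (y^2 + k^2)); [T_] is the finite
    analogue with m = 2 p + 1 points, and [coth_ y] is coth(pi y). *)
Let g_ y (k : nat) : R := y / (pi * (y ^+ 2 + k%:R ^+ 2)).
Let T_ y p k : R := poisson_term (r_ y p) (p + p).+1 k / (p + p).+1%:R.
Let coth_ y : R := (1 + expR (- (2 * pi * y))) / (1 - expR (- (2 * pi * y))).

Let r_itv y p : 0 < y -> 0 < r_ y p < 1.
Proof.
move=> y0; rewrite /r_ expR_gt0 /= expR_lt1 oppr_lt0 divr_gt0 ?ltr0n //.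
by rewrite !mulr_gt0 // pi_gt0.
Qed.

Let T_sum y p : 0 < y -> T_ y p 0 + 2 * \sum_(i < p) T_ y p i.+1 = coth_ y.
Proof.
move=> y0; have m0 : 0 < (p + p).+1%:R :> R by rewrite ltr0n.
have rm : r_ y p ^+ (p + p).+1 = expR (- (2 * pi * y)).
  by rewrite /r_ -expRM_natr mulNr divfK // gt_eqF.
rewrite -sum_symmetric; last first.
  move=> i ip; rewrite /T_ /poisson_term; congr (_ / (_ + _ * _ ^+ 2) / _).
  have -> : pi * (p + p - i)%:R / (p + p).+1%:R = pi - pi * i.+1%:R / (p + p).+1%:R :> R.
    have i2 : (i <= p + p)%N by rewrite (leq_trans (ltnW ip)) // leq_addr.
    rewrite natrB // -[(p + p).+1]addn1 -[i.+1]addn1 !natrD; field.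
    by rewrite -natrD natr1 pnatr_eq0.
  by rewrite sinB sinpi cospi mul0r sub0r mulN1r opprK.
rewrite /T_ -mulr_suml sum_poisson_term // ?r_itv // rm /coth_; field.
rewrite gt_eqF /=; last by rewrite subr_gt0 expR_lt1 oppr_lt0 !mulr_gt0 ?pi_gt0.
by rewrite -natrD nat1r pnatr_eq0.
Qed.

Let T_ge0 y p k : 0 < y -> 0 <= T_ y p k.
Proof.
move=> y0; have /andP[r0 r1] := r_itv p y0.
rewrite /T_ /poisson_term !divr_ge0 //.
  by rewrite subr_ge0 expr_le1 ?ltW // ltW.
by rewrite addr_ge0 ?sqr_ge0 // mulr_ge0 ?sqr_ge0 // mulr_ge0 // ltW.
Qed.

Let T_cvg y k : 0 < y -> T_ y ^~ k @ \oo --> g_ y k.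
Proof.
move=> y0; have c0 : 0 <= 2 * pi * y by rewrite !mulr_ge0 ?pi_ge0 // ltW.
have H1 := cvg_scaled_sub_expR c0.
have k0 : 0 <= pi * k%:R :> R by rewrite mulr_ge0 ?pi_ge0.
have H2 := cvg_scaled_sin k0.
have Hr : r_ y @ \oo --> (1 : R).
  have h : (fun p : nat => - (2 * pi * y * ((p + p).+1%:R)^-1)) @ \oo --> - (2 * pi * y * 0).
    by apply: cvgN; apply: cvgM; [exact: cvg_cst|exact: cvg_inv_odd].
  have h2 : (fun p : nat => expR (- (2 * pi * y * ((p + p).+1%:R)^-1))) @ \oo --> expR (- (2 * pi * y * 0)).
    by apply: continuous_cvg => //; exact: continuous_expR.
  by rewrite mulr0 oppr0 expR0 in h2.
have E p : T_ y p k = ((p + p).+1%:R * (1 - r_ y p)) * (1 + r_ y p) /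
   (((p + p).+1%:R * (1 - r_ y p)) ^+ 2 + 4 * r_ y p * ((p + p).+1%:R * sin (pi * k%:R / (p + p).+1%:R)) ^+ 2).
  have /andP[r0 r1] := r_itv p y0.
  have m0 : 0 < (p + p).+1%:R :> R by rewrite ltr0n.
  rewrite /T_ /poisson_term; set m : R := (p + p).+1%:R in m0 *.
  set s := sin _; set r := r_ y p in r0 r1 *.
  have D : 0 < (1 - r) ^+ 2 + 4 * r * s ^+ 2.
    rewrite ltr_wpDr ?exprn_gt0 ?subr_gt0 //.
    by rewrite mulr_ge0 ?sqr_ge0 // mulr_ge0 // ltW.
  have -> : (m * (1 - r)) ^+ 2 + 4 * r * (m * s) ^+ 2 = m ^+ 2 * ((1 - r) ^+ 2 + 4 * r * s ^+ 2).
    by ring.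
  by field; rewrite !gt_eqF.
rewrite (_ : T_ y ^~ k = fun p => ((p + p).+1%:R * (1 - r_ y p)) * (1 + r_ y p) /
   (((p + p).+1%:R * (1 - r_ y p)) ^+ 2 + 4 * r_ y p * ((p + p).+1%:R * sin (pi * k%:R / (p + p).+1%:R)) ^+ 2)); last first.
  by apply/funext => p; exact: E.
have yk : 0 < y ^+ 2 + k%:R ^+ 2 by rewrite ltr_wpDr ?exprn_gt0 // sqr_ge0.
have -> : g_ y k = (2 * pi * y) * (1 + 1) / ((2 * pi * y) * (2 * pi * y) + 4 * 1 * ((pi * k%:R) * (pi * k%:R))).
  have -> : (2 * pi * y) * (2 * pi * y) + 4 * 1 * ((pi * k%:R) * (pi * k%:R)) =
     4 * pi ^+ 2 * (y ^+ 2 + k%:R ^+ 2) :> R by ring.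
  have yk' : 0 < k%:R ^+ 2 + y ^+ 2 by rewrite addrC.
  rewrite /g_; move: (pi_gt0 R); move: (pi : R) => q q0; field.
  by rewrite (gt_eqF yk) gt_eqF.
apply: cvgM.
  apply: cvgM => //; apply: cvgD => //; exact: cvg_cst.
apply: cvgV.
  rewrite gt_eqF // ltr_wpDr //.
    by rewrite mulr_ge0 // mulr_ge0.
  by rewrite !mulr_gt0 // pi_gt0.
apply: cvgD; first exact: cvgM.
apply: cvgM; last exact: cvgM.
by apply: cvgM => //; exact: cvg_cst.
Qed.

(** The majorant that is uniform in p and summable in k. The numerator is at most 4 pi y / m; the
    denominator is at least 4 r times a squared sine, where r >= e^(-2 pi y) and, since k < p keeps
    the angle within pi / 2, [sin_ge_half] applies. *)
Let T_le y p k : 0 < y -> (k < p)%N ->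
  T_ y p k.+1 <= 4 * y * expR (2 * pi * y) / pi / k.+1%:R ^+ 2.
Proof.
move=> y0 kp; have /andP[r0 r1] := r_itv p y0.
have m0 : 0 < (p + p).+1%:R :> R by rewrite ltr0n.
rewrite /T_ /poisson_term; set m : R := (p + p).+1%:R in m0 *.
set r := r_ y p in r0 r1 *; set s := sin _.
have k0 : 0 < k.+1%:R :> R by rewrite ltr0n.
have p0 := pi_gt0 R.
have sk : pi * k.+1%:R / m / 2 <= s.
  apply: sin_ge_half; apply/andP; split; first by rewrite divr_ge0 ?mulr_ge0 // ltW.
  rewrite -mulrA ler_pM2l // ler_pdivrMr // mulrC ler_pdivlMr // -natrM ler_nat.
  by rewrite muln2 -addnn leqW // leq_add.
have sk0 : 0 < pi * k.+1%:R / m / 2 by rewrite !divr_gt0 // mulr_gt0.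
have s0 : 0 < s by exact: lt_le_trans sk.
have h1 : 1 - r ^+ 2 <= 4 * pi * y / m.
  have : 1 - r <= 2 * pi * y / m.
    have hr : 1 + - (2 * pi * y / m) <= r by exact: expR_ge1Dx.
    by rewrite lerBlDr -lerBlDl; move: hr; rewrite -[1 + _]/(1 - _).
  move=> h; have -> : 1 - r ^+ 2 = (1 - r) * (1 + r) by ring.
  have -> : 4 * pi * y / m = (2 * pi * y / m) * 2 by ring.
  apply: ler_pM => //; lra.
have h2 : expR (- (2 * pi * y)) <= r.
  rewrite ler_expR lerN2 ler_pdivrMr // ler_peMr ?mulr_ge0 ?(ltW p0) ?(ltW y0) //.
  by rewrite /m ler1n.
have h3 : 4 * expR (- (2 * pi * y)) * (pi * k.+1%:R / m / 2) ^+ 2 <= (1 - r) ^+ 2 + 4 * r * s ^+ 2.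
  apply: (@le_trans _ _ (4 * r * s ^+ 2)); last by rewrite lerDr sqr_ge0.
  apply: ler_pM; rewrite ?sqr_ge0 //.
    by rewrite ler_pM2l.
  by rewrite ler_pXn2r // nnegrE ltW.
have d0 : 0 < 4 * expR (- (2 * pi * y)) * (pi * k.+1%:R / m / 2) ^+ 2.
  by rewrite mulr_gt0 ?exprn_gt0 // mulr_gt0 ?expR_gt0.
have D0 := lt_le_trans d0 h3.
apply: (@le_trans _ _ ((4 * pi * y / m) / (4 * expR (- (2 * pi * y)) * (pi * k.+1%:R / m / 2) ^+ 2) / m)).
  rewrite ler_pM2r ?invr_gt0 //; apply: ler_pM.
  - by rewrite subr_ge0 expr_le1 ?(ltW r0) ?(ltW r1).
  - by rewrite invr_ge0 ltW.
  - exact: h1.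
  - by rewrite lef_pV2 ?posrE.
rewrite expRN le_eqVlt; apply/orP; left; apply/eqP.
move: (expR_gt0 (2 * pi * y)) (pi_gt0 R) m0 k0; move: (expR _) => e e0.
move: (pi : R) (m : R) (k.+1%:R : R) => q m' k' q0 m0' k0'; field.
by rewrite !gt_eqF.
Qed.

(** Telescoping of 1 / (a + 1)^2 <= 1 / a - 1 / (a + 1). *)
Lemma sum_inv_sqr_tail K p : \sum_(i < p) ((K + i).+2%:R ^+ 2)^-1 <= K.+1%:R^-1 :> R.
Proof.
suff : \sum_(i < p) ((K + i).+2%:R ^+ 2)^-1 <= K.+1%:R^-1 - (K + p).+1%:R^-1 :> R.
  by move=> h; rewrite (le_trans h) // lerBlDr lerDl invr_ge0.
elim: p => [|p IH]; first by rewrite big_ord0 addn0 subrr.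
rewrite big_ord_recr /= (le_trans (lerD IH (lexx _))) //.
have a0 : 0 < (K + p).+1%:R :> R by rewrite ltr0n.
rewrite addnS -[(K + p).+2%:R]natr1; set a : R := (K + p).+1%:R in a0 *.
rewrite -subr_ge0.
have -> : K.+1%:R^-1 - (a + 1)^-1 - (K.+1%:R^-1 - a^-1 + ((a + 1) ^+ 2)^-1) =
   (a * (a + 1) ^+ 2)^-1 by field; rewrite ?gt_eqF //; lra.
by rewrite invr_ge0 mulr_ge0 ?sqr_ge0 // ltW.
Qed.

Lemma coth_series y : 0 < y ->
  (fun N => \sum_(n < N) (n.+1%:R ^+ 2 + y ^+ 2)^-1) @ \oo -->
  - (2 * y ^+ 2)^-1 + pi / (2 * y) + pi / (y * (expR (2 * pi * y) - 1)).
Proof.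
move=> y0; have p0 := pi_gt0 R.
set C := 4 * y * expR (2 * pi * y) / pi.
have C0 : 0 <= C by rewrite !mulr_ge0 ?invr_ge0 ?expR_ge0 ?ltW.
have cvgA K : (fun p => T_ y p 0 + 2 * \sum_(i < K) T_ y p i.+1) @ \oo -->
    g_ y 0 + 2 * \sum_(i < K) g_ y i.+1.
  apply: cvgD; first exact: T_cvg.
  apply: cvgM; first exact: cvg_cst.
  elim: K => [|K IH].
    under eq_fun do rewrite big_ord0; rewrite big_ord0; exact: cvg_cst.
  by under eq_fun do rewrite big_ord_recr /=; rewrite big_ord_recr /=; apply: cvgD => //; exact: T_cvg.
have up K : g_ y 0 + 2 * \sum_(i < K) g_ y i.+1 <= coth_ y.
  apply: (@closed_cvg _ _ _ _ _ (fun x => x <= coth_ y) _ _ _ (cvgA K)); first exact: closed_le.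
  exists K => // p /= Kp.
  rewrite -(T_sum p y0) lerD2l ler_pM2l //.
  have [q ->] : exists q, p = (K + q)%N by exists (p - K)%N; rewrite subnKC.
  rewrite big_split_ord /= lerDl sumr_ge0 // => i _; exact: T_ge0.
have lo K : coth_ y - 2 * C / K.+1%:R <= g_ y 0 + 2 * \sum_(i < K.+1) g_ y i.+1.
  apply: (@closed_cvg _ _ _ _ _ (fun x => coth_ y - 2 * C / K.+1%:R <= x) _ _ _ (cvgA K.+1)).
    exact: closed_ge.
  exists K.+1 => // p /= Kp.
  rewrite -(T_sum p y0) lerBlDr -addrA lerD2l -(mulrA 2) -mulrDr ler_pM2l //.
  have [q pq] : exists q, p = (K.+1 + q)%N by exists (p - K.+1)%N; rewrite subnKC.
  have -> : \sum_(i < p) T_ y p i.+1 = \sum_(i < K.+1) T_ y p i.+1 + \sum_(i < q) T_ y p (K.+1 + i).+1.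
    by move: (fun i => T_ y p i.+1) => F; rewrite pq big_split_ord.
  rewrite lerD2l.
  apply: (@le_trans _ _ (\sum_(i < q) C * ((K + i).+2%:R ^+ 2)^-1)).
    apply: ler_sum => i _; rewrite addSn; apply: T_le => //.
    by rewrite pq addSn ltnS ltn_add2l.
  by rewrite -mulr_sumr ler_wpM2l // sum_inv_sqr_tail.
have G : (fun K => g_ y 0 + 2 * \sum_(i < K.+1) g_ y i.+1) @ \oo --> coth_ y.
  apply: (@squeeze_cvgr _ _ _ _ (fun K => coth_ y - 2 * C / K.+1%:R) (fun=> coth_ y)).
  - by apply: nearW => K; rewrite lo up.
  - have H : (fun K => coth_ y - 2 * C * K.+1%:R^-1) @ \oo --> coth_ y - 2 * C * 0.
      apply: cvgB; first exact: cvg_cst.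
      by apply: cvgM; [exact: cvg_cst|exact: (@cvg_harmonic R)].
    by rewrite mulr0 subr0 in H.
  - exact: cvg_cst.
have E1 : 0 < expR (2 * pi * y) - 1 by rewrite subr_gt0 expR_gt1 !mulr_gt0.
have -> : - (2 * y ^+ 2)^-1 + pi / (2 * y) + pi / (y * (expR (2 * pi * y) - 1)) =
   pi / (2 * y) * (coth_ y - g_ y 0).
  rewrite /coth_ /g_ expRN expr0n /= addr0.
  move: E1 (expR_gt0 (2 * pi * y)); move: (expR _) => e E1 e0.
  move: (pi_gt0 R); move: (pi : R) => q q0; field.
  by rewrite (gt_eqF y0) (gt_eqF E1) (gt_eqF e0) gt_eqF.
have H : (fun K => pi / (2 * y) * ((g_ y 0 + 2 * \sum_(i < K.+1) g_ y i.+1) - g_ y 0)) @ \oo -->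
    pi / (2 * y) * (coth_ y - g_ y 0).
  by apply: cvgM; [exact: cvg_cst|apply: cvgB => //; exact: cvg_cst].
rewrite -(cvg_shiftS (fun N => \sum_(n < N) (n.+1%:R ^+ 2 + y ^+ 2)^-1)).
rewrite (_ : (fun n => _) = (fun K => pi / (2 * y) * ((g_ y 0 + 2 * \sum_(i < K.+1) g_ y i.+1) - g_ y 0))) //.
apply/funext => K /=; rewrite addrAC subrr add0r !mulr_sumr; apply: eq_bigr => i _.
have d0 : 0 < i.+1%:R ^+ 2 + y ^+ 2 by rewrite ltr_wpDr ?exprn_gt0 ?sqr_ge0 // ltr0n.
rewrite /g_ [y ^+ 2 + _]addrC; move: (pi_gt0 R) d0; move: (pi : R) (i.+1%:R : R) => q k q0 d0.
by field; rewrite (gt_eqF d0) (gt_eqF y0) gt_eqF.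
Qed.

End CothSeries.

(** * Sums of inverse powers *)

Section StieltjesTransform.
Context {R : realType}.
Notation mu := (@lebesgue_measure R).
Implicit Types (t r q c A x : R) (s z : R[i]).

(** Fubini and substitution deliver integrability with a constant factor attached, which this
    removes. *)
Lemma cintbleZ_inv D (f : R -> R[i]) (c : R[i]) : measurable D -> c != 0 ->
  cintble D (fun x => c * f x) -> cintble D f.
Proof.
move=> mD c0 i; apply: eq_cintble (cintbleZ c^-1 mD i) => // x _.
by rewrite (mulKf c0).
Qed.

Lemma rGamma_scale q c : 0 < q -> 0 < c ->
  rintble (pos R) (fun r => r `^ (q - 1) * expR (- (c * r))) /\
  \int[mu]_(r in pos R) (r `^ (q - 1) * expR (- (c * r))) =
  complex.Re (cGamma q%:C) * c `^ (- q).
Proof.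
move=> q0 c0; have [[i1 _] E] := @cGamma_scale R q%:C c q0 c0.
have e r : pos R r -> cpow r (q%:C - 1) * (expR (- (c * r)))%:C =
    (r `^ (q - 1) * expR (- (c * r)))%:C.
  move=> /posP r0; rewrite -(rmorph1 (real_complex R)) -rmorphB.
  by rewrite cpow_real // -rmorphM.
split; first by apply: eq_rintble i1 => // r /e ->.
move: E; rewrite (eq_cintegral e) cintegral_real -rmorphN cpow_real //.
move=> /(congr1 (@complex.Re R)); rewrite cReM.
by rewrite (_ : complex.Im (c `^ (- q))%:C = 0) // mulr0 subr0.
Qed.

Lemma measurable_scale_exp : measurable_fun setT (fun p : R * R => expR (- (p.1 * p.2))).
Proof.
apply: measurableT_comp => //; apply: measurableT_comp => //.
by apply: measurable_funM; [exact: measurable_fst|exact: measurable_snd].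
Qed.

(** A Beta integral. In the double integral of t^(be - 1) e^(-A t) r^(al - 1) e^(-t r), integrating
    over r first yields Gamma (al) t^(-al), over t first Gamma (be) (r + A)^(-be). The bound Re be
    <= 2 comes from [cGamma_neq0]. *)
Lemma stieltjes (al be : R[i]) A : 0 < A -> 0 < complex.Re al ->
  complex.Re al < complex.Re be -> complex.Re be <= 2 ->
  cintble (pos R) (fun r => cpow r (al - 1) * cpow (r + A) (- be)) /\
  cintegral (pos R) (fun r => cpow r (al - 1) * cpow (r + A) (- be)) =
  cGamma al * cGamma (be - al) / cGamma be * cpow A (al - be).
Proof.
move=> A0 al0 alb be2; have be0 := lt_trans al0 alb.
have ba0 : 0 < complex.Re (be - al) by rewrite cReD cReN subr_gt0.
have Gb := cGamma_neq0 be0 be2.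
pose F t r : R[i] := cpow t (be - 1) * (expR (- (A * t)))%:C *
  (cpow r (al - 1) * (expR (- (t * r)))%:C).
have mF : cmeas setT (fun p : R * R => F p.1 p.2).
  apply: cmeasM; apply: cmeasM.
  - by apply: cmeas_cpow; exact: measurable_fst.
  - apply: cmeas_real; apply: measurableT_comp => //; apply: measurableT_comp => //.
    by apply: measurable_funM => //; exact: measurable_fst.
  - by apply: cmeas_cpow; exact: measurable_snd.
  - by apply: cmeas_real; exact: measurable_scale_exp.
pose G := complex.Re (cGamma (complex.Re al)%:C).
(* The exact inner integral of |F|: the same computation with exponents replaced by their real
   parts. *)
pose h t := G * (t `^ (complex.Re be - complex.Re al - 1) * expR (- (A * t))).
have ih : rintble (pos R) h.
  by apply: rintbleZ => //; apply: (rGamma_scale _ A0).1; rewrite subr_gt0.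
have bF t : pos R t -> (\int[mu]_(r in pos R) (cabs (F t r))%:E <= (h t)%:E)%E.
  move=> /posP t0; have [i1 E1] := @rGamma_scale (complex.Re al) t al0 t0.
  pose k r := (t `^ (complex.Re be - 1) * expR (- (A * t))) *
      (r `^ (complex.Re al - 1) * expR (- (t * r))).
  have -> : (\int[mu]_(r in pos R) (cabs (F t r))%:E = \int[mu]_(r in pos R) (k r)%:E)%E.
    apply: eq_integral => r /[1!inE] /posP r0; congr EFin; rewrite /F /k.
    rewrite !cabsM !cabs_cpow // !cabs_real !(ger0_norm (expR_ge0 _)).
    by rewrite !cReD !cReN.
  rewrite -[X in (X <= _)%E]fineK; last first.
    by apply: integrable_fin_num => //; exact: rintbleZ.
  rewrite lee_fin -/(Rintegral _ _ _) RintegralZl // E1 /h.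
  rewrite (_ : complex.Re be - complex.Re al - 1 = (complex.Re be - 1) + - complex.Re al); last by ring.
  rewrite (powRD (r := complex.Re be - 1)) ?(gt_eqF t0) ?implybT //.
  by rewrite le_eqVlt; apply/orP; left; apply/eqP; rewrite /G; ring.
have [i1 i2 E] := @cfubini R _ _ F h (measurable_itv _) (measurable_itv _) mF ih bF.
have I1 t : pos R t -> cintegral (pos R) (F t) =
    cGamma al * (cpow t ((be - al) - 1) * (expR (- (A * t)))%:C).
  move=> /posP t0; have [j1 e1] := cGamma_scale al0 t0.
  transitivity (cpow t (be - 1) * (expR (- (A * t)))%:C * (cGamma al * cpow t (- al))).
    by rewrite -e1; exact: cintegralZ.
  rewrite (_ : be - al - 1 = (be - 1) + - al); last by ring.
  by rewrite (cpowD t (be - 1)); ring.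
have I2 r : pos R r -> cintegral (pos R) (F ^~ r) =
    cGamma be * (cpow r (al - 1) * cpow (r + A) (- be)).
  move=> /posP r0; have rA : 0 < r + A by rewrite addr_gt0.
  have [j1 e1] := cGamma_scale be0 rA.
  transitivity (cintegral (pos R) (fun t => cpow r (al - 1) *
      (cpow t (be - 1) * (expR (- ((r + A) * t)))%:C))).
    apply: eq_cintegral => t _; rewrite /F.
    have -> : - ((r + A) * t) = - (A * t) + - (t * r) by ring.
    by rewrite expRD rmorphM /=; ring.
  rewrite (_ : cGamma be * _ = cpow r (al - 1) * (cGamma be * cpow (r + A) (- be))); last by ring.
  by rewrite -e1; exact: cintegralZ.
have i3 : cintble (pos R) (fun r => cpow r (al - 1) * cpow (r + A) (- be)).
  exact: (cintbleZ_inv (measurable_itv _) Gb (eq_cintble (measurable_itv _) I2 i2)).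
split; first exact: i3.
move: E; rewrite (eq_cintegral I1) (eq_cintegral I2).
have [j1 e1] := cGamma_scale ba0 A0.
rewrite !cintegralZ // e1 opprB => H.
by apply: (mulfI Gb); rewrite -H; field.
Qed.

End StieltjesTransform.

Section InversePowerSum.
Context {R : realType}.
Notation mu := (@lebesgue_measure R).
Implicit Types (t r q c A x y : R) (s z : R[i]).

Lemma expR_sub1_ge y : y <= expR y - 1.
Proof. by rewrite lerBrDl expR_ge1Dx. Qed.

Lemma planck_le y : 0 < y -> pi / (y * (expR (2 * pi * y) - 1)) <= (2 * y ^+ 2)^-1.
Proof.
move=> y0; have p0 := pi_gt0 R.
have E := expR_sub1_ge (2 * pi * y).
have q0 : 0 < 2 * pi * y by rewrite !mulr_gt0.
have -> : (2 * y ^+ 2)^-1 = pi / (y * (2 * pi * y)).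
  by move: (pi_gt0 R); move: (pi : R) => q p0'; field; rewrite !gt_eqF.
rewrite ler_pM2l // lef_pV2 ?posrE ?mulr_gt0 //; first by rewrite ler_pM2l.
exact: lt_le_trans q0 E.
Qed.

(** The partial sums increase to the limit in [coth_series], whose first and third summands add up
    to at most 0 by [planck_le]. *)
Lemma coth_partial_le y N : 0 < y ->
  \sum_(n < N) (n.+1%:R ^+ 2 + y ^+ 2)^-1 <= pi / (2 * y).
Proof.
move=> y0; have p0 := pi_gt0 R.
have nd : nondecreasing_seq (fun N => \sum_(n < N) (n.+1%:R ^+ 2 + y ^+ 2)^-1 : R).
  apply/nondecreasing_seqP => n; rewrite big_ord_recr /= lerDl invr_ge0.
  by rewrite addr_ge0 ?sqr_ge0.
have C := coth_series y0.
have cv : cvgn (fun N => \sum_(n < N) (n.+1%:R ^+ 2 + y ^+ 2)^-1 : R).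
  by apply/cvg_ex; eexists; exact: C.
have := nondecreasing_cvgn_le nd cv N; rewrite (cvg_lim _ C) //.
move=> h; apply: (le_trans h).
have := planck_le y0.
move: (pi / (y * (expR (2 * pi * y) - 1))) (pi / (2 * y)) ((2 * y ^+ 2)^-1) => u v z; lra.
Qed.

(** K is the integral at A = 1, whence its sign. Its value stays hidden: integrability and the
    scaling in A are what the later bounds use. *)
Lemma rstieltjes c b : c < 1 -> 1 - c < b -> b <= 2 -> exists2 K, 0 <= K & forall A, 0 < A ->
  rintble (pos R) (fun r => r `^ (- c) * (r + A) `^ (- b)) /\
  \int[mu]_(r in pos R) (r `^ (- c) * (r + A) `^ (- b)) = K * A `^ (1 - c - b).
Proof.
move=> c1 cb b2.
pose K := complex.Re (cGamma (1 - c)%:C * cGamma (b%:C - (1 - c)%:C) / cGamma b%:C).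
have main A : 0 < A ->
    rintble (pos R) (fun r => r `^ (- c) * (r + A) `^ (- b)) /\
    \int[mu]_(r in pos R) (r `^ (- c) * (r + A) `^ (- b)) = K * A `^ (1 - c - b).
  move=> A0; have al0 : 0 < complex.Re (1 - c)%:C by rewrite subr_gt0.
  have [[i1 _] E] := @stieltjes R (1 - c)%:C b%:C A A0 al0 cb b2.
  have e r : pos R r -> cpow r ((1 - c)%:C - 1) * cpow (r + A) (- b%:C) =
      (r `^ (- c) * (r + A) `^ (- b))%:C.
    move=> /posP r0; have rA : 0 < r + A by rewrite addr_gt0.
    have -> : (1 - c)%:C - 1 = (- c)%:C by rewrite rmorphB rmorphN /= addrAC subrr add0r.
    by rewrite -rmorphN !cpow_real // -rmorphM.
  split; first by apply: eq_rintble i1 => // r /e ->.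
  move: E; rewrite (eq_cintegral e) cintegral_real.
  rewrite (_ : (1 - c)%:C - b%:C = (1 - c - b)%:C); last by rewrite [RHS]rmorphB.
  rewrite (cpow_real _ A0).
  move=> /(congr1 (@complex.Re R)); rewrite cReM.
  by rewrite (_ : complex.Im (A `^ (1 - c - b))%:C = 0) // mulr0 subr0.
exists K => //; have [_] := main 1 ltr01; rewrite powR1 mulr1 => <-.
by apply: Rintegral_ge0 => r _; rewrite mulr_ge0 ?powR_ge0.
Qed.

Lemma powR_cont c x : 0 < x -> {for x, continuous (fun t : R => t `^ c)}.
Proof.
move=> x0; apply: differentiable_continuous; apply/derivable1_diffP.
by apply: derivable_powR; rewrite in_itv/= x0.
Qed.

(** Under r = t^2 - 1 the integral becomes half that of r^(-q/2) / (r + 1), which [rstieltjes]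
    covers. *)
Lemma tail_rintble q : 0 < q < 2 ->
  rintble `]1, +oo[ (fun t => (t ^+ 2 - 1) `^ (- (q / 2)) / t).
Proof.
move=> /andP[q0 q2].
have h1 : q / 2 < 1 by lra.
have h2 : 1 - q / 2 < 1 by lra.
have [K _ H] := rstieltjes h1 h2 (ler1n _ 2).
have [i1 _] := H 1 ltr01.
have t0 t : 1 < t -> 0 < t by apply: lt_trans.
have [] := @rsubst R (fun t => t ^+ 2 - 1) (fun t => 2 * t) (fun y => Num.sqrt (y + 1)) 1 0
  _ _ _ _ _ _ _ (fun r => r `^ (- (q / 2)) * (r + 1) `^ (- 1)).
- move=> t; rewrite -[2 * t]subr0; apply: is_deriveB; exact: is_derive_sqr.
- move=> t; apply: cvgM; first exact: cvg_cst.
  exact: cvg_id.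
- move=> t u /[!in_itv]/= /[!andbT] t1 u1 tu; rewrite ltrD2r ltr_pXn2r // nnegrE ltW ?t0 //.
- by move=> t t1; rewrite subr_gt0 exprn_egt1.
- by move=> t /t0 t1; rewrite mulr_ge0 // ltW.
- by move=> y y0; rewrite -[ltLHS]sqrtr1 ltr_sqrt ?ltrDr // addr_gt0.
- by move=> y y0; rewrite sqr_sqrtr ?addrK // addr_ge0 // ltW.
- move=> r /[!in_itv]/= /[!andbT] r0; apply: cvgM; first exact: powR_cont.
  have c1 : {for r, continuous (fun x : R => x + 1)} by apply: cvgD; [exact: cvg_id|exact: cvg_cst].
  have c2 : {for r + 1, continuous (fun t : R => t `^ (- 1))} by apply: powR_cont; rewrite addr_gt0.
  exact: (continuous_comp c1 c2).
- exact: i1.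
move=> i2 _; have := rintbleZ (2^-1) (measurable_itv _) i2.
apply: eq_rintble => // t; rewrite /= in_itv/= andbT => t1.
have t2 := t0 _ t1; rewrite subrK (powRN _ 1) powRr1 ?sqr_ge0 //.
by field; rewrite gt_eqF.
Qed.

Section Sum.
Variables (s : R[i]) (x : R).
Hypotheses (s1 : 1 < complex.Re s) (s2 : complex.Re s < 2) (x0 : 0 < x).

Let G0 : cGamma (s / 2%:R) != 0.
Proof. by apply: cGamma_neq0; rewrite Re_half; move: s1 s2; lra. Qed.

Let G1 : cGamma (1 - s / 2%:R) != 0.
Proof. by apply: cGamma_neq0; rewrite cReD cReN Re_half (_ : complex.Re 1 = 1) //; move: s1 s2; lra. Qed.

Lemma inv_term A : 0 < A ->
  cintble (pos R) (fun r => cpow r (- (s / 2%:R)) * ((r + A)^-1)%:C) /\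
  cintegral (pos R) (fun r => cpow r (- (s / 2%:R)) * ((r + A)^-1)%:C) =
  cGamma (1 - s / 2%:R) * cGamma (s / 2%:R) * cpow A (- (s / 2%:R)).
Proof.
move=> A0; have h1 : 0 < complex.Re (1 - s / 2%:R).
  by rewrite cReD cReN Re_half (_ : complex.Re 1 = 1) //; move: s1 s2; lra.
have h2 : complex.Re (1 - s / 2%:R) < complex.Re 1.
  by rewrite cReD cReN Re_half (_ : complex.Re 1 = 1) //; move: s1 s2; lra.
have [i E] := stieltjes A0 h1 h2 (ler1n _ 2).
have e r : pos R r -> cpow r (1 - s / 2%:R - 1) * cpow (r + A) (- 1) =
    cpow r (- (s / 2%:R)) * ((r + A)^-1)%:C.
  move=> /posP r0; rewrite cpowN cpow1 ?addr_gt0 // -fmorphV.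
  by congr (cpow _ _ * _); ring.
split; first exact: eq_cintble i.
rewrite -(eq_cintegral e) E cGamma1 divr1.
by congr (_ * cGamma _ * cpow _ _); ring.
Qed.

(** [stieltjes] with al = 1 - s/2 and be = 1/2: its condition Re al < Re be is Re s > 1, and Re al >
    0 is Re s < 2. *)
Lemma inv_sqrt_term A : 0 < A ->
  cintble (pos R) (fun r => cpow r (- (s / 2%:R)) * ((Num.sqrt (r + A))^-1)%:C) /\
  cintegral (pos R) (fun r => cpow r (- (s / 2%:R)) * ((Num.sqrt (r + A))^-1)%:C) =
  cGamma (1 - s / 2%:R) * cGamma ((s - 1) / 2%:R) / (Num.sqrt pi)%:C * cpow A ((1 - s) / 2%:R).
Proof.
move=> A0; have hE : 2%:R^-1 = (2^-1)%:C :> R[i] by rewrite fmorphV natr_complex.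
have h1 : 0 < complex.Re (1 - s / 2%:R).
  by rewrite cReD cReN Re_half (_ : complex.Re 1 = 1) //; move: s1 s2; lra.
have h2 : complex.Re (1 - s / 2%:R) < complex.Re (2%:R^-1 : R[i]).
  by rewrite cReD cReN Re_half (_ : complex.Re 1 = 1) // hE [ltRHS]/=; move: s1 s2; lra.
have h3 : complex.Re (2%:R^-1 : R[i]) <= 2 by rewrite hE [leLHS]/=; lra.
have [i E] := stieltjes A0 h1 h2 h3.
have e r : pos R r -> cpow r (1 - s / 2%:R - 1) * cpow (r + A) (- 2%:R^-1) =
    cpow r (- (s / 2%:R)) * ((Num.sqrt (r + A))^-1)%:C.
  move=> /posP r0; rewrite cpowN hE cpow_real ?addr_gt0 // -fmorphV powR12_sqrt ?addr_ge0 ?ltW //.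
  by congr (cpow _ _ * _); ring.
split; first exact: eq_cintble i.
rewrite -(eq_cintegral e) E cGamma_half.
have -> : 2%:R^-1 - (1 - s / 2%:R) = (s - 1) / 2%:R by field.
by have -> : 1 - s / 2%:R - 2%:R^-1 = (1 - s) / 2%:R by field.
Qed.

Let y r := Num.sqrt (r + x ^+ 2).

Let y2 r : 0 < r -> y r ^+ 2 = r + x ^+ 2.
Proof. by move=> r0; rewrite sqr_sqrtr // addr_ge0 ?sqr_ge0 // ltW. Qed.

Let y0 r : 0 < r -> 0 < y r.
Proof. by move=> r0; rewrite sqrtr_gt0 ltr_wpDr ?sqr_ge0. Qed.

Let F (n : nat) r : R[i] := cpow r (- (s / 2%:R)) * ((r + (n.+1%:R ^+ 2 + x ^+ 2))^-1)%:C.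

Let A0 n : 0 < n.+1%:R ^+ 2 + x ^+ 2.
Proof. by rewrite ltr_wpDr ?sqr_ge0 // exprn_gt0 // ltr0n. Qed.

Let FE N r : 0 < r -> \sum_(i < N) F i r =
  cpow r (- (s / 2%:R)) * (\sum_(n < N) (n.+1%:R ^+ 2 + y r ^+ 2)^-1)%:C.
Proof.
move=> r0; rewrite rmorph_sum mulr_sumr; apply: eq_bigr => i _.
by rewrite /F y2 //; congr (_ * (_ ^-1)%:C); ring.
Qed.

(** [coth_partial_le] at y = sqrt(r + x^2): one majorant for all partial sums under the
    r-integral. *)
Let k r := pi / 2 * cabs (cpow r (- (s / 2%:R)) * ((Num.sqrt (r + x ^+ 2))^-1)%:C).

Let ik : rintble (pos R) k.
Proof.
by apply: rintbleZ => //; apply: cintble_cabs => //; apply: (inv_sqrt_term _).1; rewrite exprn_gt0.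
Qed.

Let Fk N r : pos R r -> cabs (\sum_(i < N) F i r) <= k r.
Proof.
move=> /posP r0; rewrite FE // cabsM cabs_real ger0_norm; last first.
  by apply: sumr_ge0 => i _; rewrite invr_ge0 addr_ge0 ?sqr_ge0.
rewrite /k cabsM cabs_real ger0_norm ?invr_ge0 ?sqrtr_ge0 // mulrCA.
rewrite ler_wpM2l ?cabs_ge0 // (le_trans (coth_partial_le N (y0 r0))) //.
by rewrite /y invfM mulrA.
Qed.

Let G2 : cGamma (1 - s / 2%:R) * cGamma (s / 2%:R) != 0.
Proof. by rewrite mulf_neq0. Qed.

Let sum_FE N : \sum_(n < N) cintegral (pos R) (F n) =
  cGamma (1 - s / 2%:R) * cGamma (s / 2%:R) *
  \sum_(n < N) cpow (n.+1%:R ^+ 2 + x ^+ 2) (- (s / 2%:R)).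
Proof. by rewrite mulr_sumr; apply: eq_bigr => n _; rewrite (inv_term (A0 n)).2. Qed.

Lemma inv_power_partial_le N :
  cabs (\sum_(n < N) cpow (n.+1%:R ^+ 2 + x ^+ 2) (- (s / 2%:R))) <=
  2 / cabs (cGamma (1 - s / 2%:R) * cGamma (s / 2%:R)) * (\int[mu]_(r in pos R) k r).
Proof.
have [i1 E1] := @cintegral_sum R (pos R) F N (measurable_itv _) (fun n => (inv_term (A0 n)).1).
have := cabs_cintegral (measurable_itv _) i1 ik (fun r h => Fk N h).
rewrite E1 sum_FE cabsM => h.
rewrite mulrAC ler_pdivlMr ?lt_neqAle ?cabs_ge0 ?andbT; last by rewrite eq_sym cabs_eq0.
by rewrite mulrC.
Qed.

Definition binet_integrand t : R[i] :=
  ((expR (2 * pi * x * t) - 1)%:C * cpow (t ^+ 2 - 1) (s / 2%:R))^-1.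

Let g3 r : R[i] := cpow r (- (s / 2%:R)) * (pi / (y r * (expR (2 * pi * y r) - 1)))%:C.

Let e0 (u : R) : 0 < u -> 0 < expR (2 * pi * u) - 1.
Proof. by move=> u0; rewrite subr_gt0 expR_gt1 !mulr_gt0 ?pi_gt0. Qed.

Let y_cont r : {for r, continuous y}.
Proof.
apply: continuous_comp; last exact: sqrt_continuous.
by apply: cvgD; [exact: cvg_id|exact: cvg_cst].
Qed.

Let g3_int : cintble (pos R) g3.
Proof.
have x20 : 0 < x ^+ 2 by rewrite exprn_gt0.
have [i1 _] := inv_term x20.
have h := rintbleZ (2^-1) (measurable_itv _) (cintble_cabs (measurable_itv _) i1).
apply: (cintble_le (measurable_itv _) _ h).
  apply: cmeasM; first exact: cmeas_cpow.
  apply: cmeas_real; apply: measurable_funM => //; apply: measurable_inv.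
  have my : measurable_fun (pos R) y.
    by apply: measurable_funTS; apply: continuous_measurable_fun => r; exact: y_cont.
  apply: measurable_funM => //; apply: measurable_funB => //.
  by apply: measurableT_comp => //; apply: measurable_funM.
move=> r /posP r0; rewrite /g3 !cabsM mulrCA ler_wpM2l ?cabs_ge0 //.
rewrite !cabs_real !ger0_norm.
- by rewrite (le_trans (planck_le (y0 r0))) // y2 // invfM.
- by rewrite invr_ge0 addr_ge0 ?(ltW r0) ?(ltW x20).
- by rewrite divr_ge0 ?pi_ge0 // mulr_ge0 ?(ltW (y0 r0)) // ltW // e0 // y0.
Qed.

(** With r = x^2 (t^2 - 1), [y r] becomes x t, so dr / y = 2 x dt, and r^(-s/2) contributes x^(-s),
    whence the factor 2 pi x^(1 - s). Integrability is transported from [g3_int]. *)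
Lemma binet_integrable : cintble `]1, +oo[ binet_integrand /\
  cintegral (pos R) g3 = (2 * pi)%:C * cpow x (1 - s) * cintegral `]1, +oo[ binet_integrand.
Proof.
have x20 : 0 < x ^+ 2 by rewrite exprn_gt0.
have t0 t : 1 < t -> 0 < t by apply: lt_trans.
have [] := @csubst R (fun t => x ^+ 2 * (t ^+ 2 - 1)) (fun t => x ^+ 2 * (2 * t))
  (fun r => Num.sqrt (r / x ^+ 2 + 1)) 1 0 _ _ _ _ _ _ _ g3.
- move=> t; apply: is_derive_scale; rewrite -[2 * t]subr0; apply: is_deriveB; exact: is_derive_sqr.
- move=> t; apply: cvgM; first exact: cvg_cst.
  by apply: cvgM; [exact: cvg_cst|exact: cvg_id].
- move=> t u /[!in_itv]/= /[!andbT] t1 u1 tu.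
  by rewrite ltr_pM2l // ltrD2r ltr_pXn2r // nnegrE ltW ?t0.
- by move=> t t1; rewrite mulr_gt0 // subr_gt0 exprn_egt1.
- by move=> t /t0 t1; rewrite mulr_ge0 ?(ltW x20) // mulr_ge0 // ltW.
- move=> r r0; have h : 0 < r / x ^+ 2 by rewrite divr_gt0.
  by rewrite -[ltLHS]sqrtr1 ltr_sqrt ?ltrDr // addr_gt0.
- move=> r r0; have h : 0 < r / x ^+ 2 by rewrite divr_gt0.
  by rewrite sqr_sqrtr ?addrK ?addr_ge0 ?(ltW h) // mulrC divfK // gt_eqF.
- move=> r r0; apply: ccontM; first by apply: ccont_cpow => //; exact: cvg_id.
  apply: ccont_real; apply: cvgM; first exact: cvg_cst.
  apply: cvgV; first by rewrite mulf_neq0 // gt_eqF ?(e0 (y0 r0)) ?(y0 r0).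
  apply: cvgM; first exact: y_cont.
  apply: cvgB; last exact: cvg_cst.
  apply: continuous_cvg; first exact: continuous_expR.
  by apply: cvgM; [exact: cvg_cst|exact: y_cont].
- exact: g3_int.
pose c : R[i] := (2 * pi)%:C * cpow x (1 - s).
have e t : (`]1, +oo[%classic : set R) t ->
    (x ^+ 2 * (2 * t))%:C * g3 (x ^+ 2 * (t ^+ 2 - 1)) = c * binet_integrand t.
  rewrite /= in_itv/= andbT => t1; have t2 := t0 _ t1.
  have yE : y (x ^+ 2 * (t ^+ 2 - 1)) = x * t.
    rewrite /y (_ : x ^+ 2 * (t ^+ 2 - 1) + x ^+ 2 = (x * t) ^+ 2); last by ring.
    by rewrite sqrtr_sqr gtr0_norm // mulr_gt0.
  have s0 : 0 < t ^+ 2 - 1 by rewrite subr_gt0 exprn_egt1.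
  have xt : 0 < x * t by rewrite mulr_gt0.
  have E0 := e0 xt.
  rewrite /g3 yE cpowM // cpowXl // (_ : 2%:R * - (s / 2%:R) = - s); last by field.
  rewrite /c cpowD cpow1 // /binet_integrand (cpowN (t ^+ 2 - 1)) -(mulrA (2 * pi)).
  move: E0; move: (expR _ - 1) => E E0.
  rewrite [in RHS]invfM -(fmorphV (real_complex R)).
  rewrite -[RHS]mulrA.
  have -> : x%:C * cpow x (- s) * (E^-1%:C * (cpow (t ^+ 2 - 1) (s / 2%:R))^-1) =
    cpow x (- s) * (cpow (t ^+ 2 - 1) (s / 2%:R))^-1 * (x * E^-1)%:C by rewrite rmorphM /=; ring.
  have -> : x ^+ 2 * (2 * t) = 2 * x ^+ 2 * t by ring.
  rewrite [LHS]mulrCA -rmorphM [RHS]mulrCA -rmorphM; congr (_ * _%:C).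
  by move: (pi : R) => q; field; rewrite !gt_eqF.
have c0 : c != 0.
  by rewrite mulf_neq0 ?cpow_neq0 // -cabs_eq0 cabs_real normr_eq0 gt_eqF // mulr_gt0 // pi_gt0.
move=> i1 E; have i2 : cintble `]1, +oo[ binet_integrand.
  exact: (cintbleZ_inv (measurable_itv _) c0 (eq_cintble (measurable_itv _) e i1)).
split => //; rewrite E (eq_cintegral e); exact: cintegralZ.
Qed.

Lemma inv_power_sum :
  ccvg (fun N => \sum_(n < N) cpow (n.+1%:R ^+ 2 + x ^+ 2) (- (s / 2%:R)))
    (- (cpow x (- s) / 2%:R)
     + (Num.sqrt pi)%:C / 2%:R * (cGamma ((s - 1) / 2%:R) / cGamma (s / 2%:R)) * cpow x (1 - s)
     + (2 * pi)%:C / (cGamma (1 - s / 2%:R) * cGamma (s / 2%:R)) * cpow x (1 - s)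
       * cintegral `]1, +oo[ binet_integrand).
Proof.
have x20 : 0 < x ^+ 2 by rewrite exprn_gt0.
have [j1 E1] := inv_term x20; have [j2 E2] := inv_sqrt_term x20; have [j3 E3] := binet_integrable.
pose g1 r : R[i] := cpow r (- (s / 2%:R)) * ((r + x ^+ 2)^-1)%:C.
pose g2 r : R[i] := cpow r (- (s / 2%:R)) * ((Num.sqrt (r + x ^+ 2))^-1)%:C.
pose f r : R[i] := (- (2^-1)%:C * g1 r + (pi / 2)%:C * g2 r) + g3 r.
have lim r : pos R r -> ccvg (fun n => \sum_(i < n) F i r) (f r).
  move=> /posP r0; have H := coth_series (y0 r0).
  rewrite (_ : (fun n => _) = fun n => cpow r (- (s / 2%:R)) *
      (\sum_(i < n) (i.+1%:R ^+ 2 + y r ^+ 2)^-1)%:C); last first.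
    by apply/funext => n; rewrite FE.
  have -> : f r = cpow r (- (s / 2%:R)) * (- (2 * y r ^+ 2)^-1 + pi / (2 * y r) +
      pi / (y r * (expR (2 * pi * y r) - 1)))%:C.
    rewrite /f /g1 /g2 /g3 -/(y r) y2 //.
    have -> : - (2 * (r + x ^+ 2))^-1 = - 2^-1 * (r + x ^+ 2)^-1 by rewrite invfM mulNr.
    have -> : pi / (2 * y r) = pi / 2 / y r by rewrite invfM mulrA.
    by rewrite !rmorphD !rmorphM !rmorphN /=; ring.
  apply: ccvgZ; split; [exact: H|exact: cvg_cst].
have [i1 C1] := cintegral_series (measurable_itv _) (fun n => (inv_term (A0 n)).1) ik Fk lim.
have h1 : cintble (pos R) (fun r => - (2^-1)%:C * g1 r) by exact: cintbleZ.
have h2 : cintble (pos R) (fun r => (pi / 2)%:C * g2 r) by exact: cintbleZ.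
have h12 : cintble (pos R) (fun r => - (2^-1)%:C * g1 r + (pi / 2)%:C * g2 r) by exact: cintbleD.
have If : cintegral (pos R) f = - (2^-1)%:C * cintegral (pos R) g1 +
    (pi / 2)%:C * cintegral (pos R) g2 + cintegral (pos R) g3.
  transitivity (cintegral (pos R) (fun r => - (2^-1)%:C * g1 r + (pi / 2)%:C * g2 r) +
      cintegral (pos R) g3).
    exact: (cintegralD (measurable_itv _) h12 g3_int).
  congr (_ + _); transitivity (cintegral (pos R) (fun r => - (2^-1)%:C * g1 r) +
      cintegral (pos R) (fun r => (pi / 2)%:C * g2 r)).
    exact: (cintegralD (measurable_itv _) h1 h2).
  by congr (_ + _); [exact: (cintegralZ _ (measurable_itv _) j1)|exact: (cintegralZ _ (measurable_itv _) j2)].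
have C2 := ccvgZ (cGamma (1 - s / 2%:R) * cGamma (s / 2%:R))^-1 C1.
move: C2; rewrite (_ : (fun n => _) =
    fun N => \sum_(n < N) cpow (n.+1%:R ^+ 2 + x ^+ 2) (- (s / 2%:R))); last first.
  by apply/funext => N; rewrite sum_FE mulKf.
rewrite -/g1 in E1; rewrite -/g2 in E2.
congr ccvg; rewrite If E1 E2 E3 !cpowXl //.
have -> : 2%:R * - (s / 2%:R) = - s by field.
have -> : 2%:R * ((1 - s) / 2%:R) = 1 - s by field.
have q0 : (Num.sqrt pi)%:C != 0 :> R[i].
  by rewrite -cabs_eq0 cabs_real normr_eq0 gt_eqF // sqrtr_gt0 pi_gt0.
(* pi is written as a square so that it cancels against the 1 / sqrt(pi) = 1 / Gamma (1/2) of
   [inv_sqrt_term]. *)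
have -> : (pi / 2 : R)%:C = (Num.sqrt pi)%:C ^+ 2 / 2%:R :> R[i].
  by rewrite -rmorphXn sqr_sqrtr ?pi_ge0 // rmorphM fmorphV natr_complex.
have -> : (2^-1 : R)%:C = 2%:R^-1 :> R[i] by rewrite fmorphV natr_complex.
move: G0 G1 q0.
move: (cintegral _ _) (cGamma (1 - _)) (cGamma ((s - 1) / _)) (cGamma (s / _)) (cpow x (- s)) (cpow x (1 - s)) ((2 * pi)%:C)
  (Num.sqrt pi)%:C => I C1' C2' C3' p1 p2 tp q h0 h1' q0; field.
by rewrite ?h0 ?h1' ?q0.
Qed.

End Sum.

End InversePowerSum.

(** * The double integrals *)

Section DoubleSeries.
Context {R : realType}.
Notation mu := (@lebesgue_measure R).

Lemma eq_ccvg (u v : nat -> R[i]) l m : u =1 v -> l = m -> ccvg u l -> ccvg v m.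
Proof. by move=> /funext -> ->. Qed.

Lemma cmeas_section (F : R -> R -> R[i]) D x :
  cmeas setT (fun p : R * R => F p.1 p.2) -> cmeas D (F x).
Proof.
move=> mF; apply: (@cmeas_comp _ _ _ _ R (fun p : R * R => F p.1 p.2) (fun y => (x, y)) D mF).
by apply: measurable_funTS; exact: pair1_measurable.
Qed.

(** Dominated convergence in the inner variable, then in the outer one, under a single product
    majorant; the same majorant justifies exchanging the order in each term. *)
Lemma cintegral2_series D1 D2 (F : nat -> R -> R -> R[i]) (f : R -> R -> R[i]) (g1 g2 : R -> R) :
  measurable D1 -> measurable D2 ->
  (forall n, cmeas setT (fun p : R * R => F n p.1 p.2)) ->
  rintble D1 g1 -> rintble D2 g2 ->
  (forall n x y, D1 x -> D2 y -> cabs (\sum_(i < n) F i x y) <= g1 x * g2 y) ->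
  (forall x y, D1 x -> D2 y -> ccvg (fun n => \sum_(i < n) F i x y) (f x y)) ->
  [/\ forall n, cintegral D1 (fun x => cintegral D2 (F n x)) =
                cintegral D2 (fun y => cintegral D1 (F n ^~ y)),
      forall x, D1 x -> cintble D2 (f x),
      cintble D1 (fun x => cintegral D2 (f x)) &
      ccvg (fun N => \sum_(n < N) cintegral D1 (fun x => cintegral D2 (F n x)))
        (cintegral D1 (fun x => cintegral D2 (f x)))].
Proof.
move=> m1 m2 mF i1 i2 bF cF.
(* Each term is a difference of two consecutive partial sums, hence the factor 2. *)
have bF1 n x y : D1 x -> D2 y -> cabs (F n x y) <= (2 * g1 x) * g2 y.
  move=> Dx Dy; have -> : F n x y = \sum_(i < n.+1) F i x y + - \sum_(i < n) F i x y.
    by rewrite big_ord_recr /= addrAC subrr add0r.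
  rewrite (le_trans (cabsD _ _)) // cabsN -mulrA mulr_natl mulr2n.
  by apply: lerD; exact: bF.
have j1 : rintble D1 (fun x => 2 * g1 x) by exact: rintbleZ.
have iF n x : D1 x -> cintble D2 (F n x).
  move=> Dx; apply: (cintble_le m2 (cmeas_section _ _ (mF n)) (rintbleZ (2 * g1 x) m2 i2)).
  by move=> y Dy; exact: bF1.
have fub n := cfubini_prod m1 m2 (mF n) j1 i2 (bF1 n).
have inner x : D1 x -> cintble D2 (f x) /\
    ccvg (fun n => \sum_(i < n) cintegral D2 (F i x)) (cintegral D2 (f x)).
  move=> Dx; apply: (@cintegral_series R D2 (fun n => F n x) (f x) (fun y => g1 x * g2 y)) => //.
  - by move=> n; exact: iF.
  - exact: rintbleZ.
  - by move=> n y Dy; exact: bF.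
  - by move=> y Dy; exact: cF.
have [i3 c3] : cintble D1 (fun x => cintegral D2 (f x)) /\
    ccvg (fun N => \sum_(n < N) cintegral D1 (fun x => cintegral D2 (F n x)))
        (cintegral D1 (fun x => cintegral D2 (f x))).
  apply: (@cintegral_series R D1 (fun n x => cintegral D2 (F n x)) _
    (fun x => 2 * (\int[mu]_(y in D2) g2 y) * g1 x)) => //.
  - by move=> n; have [] := fub n.
  - exact: rintbleZ.
  - move=> n x Dx; have [k1 E1] := cintegral_sum n m2 (fun i => iF i x Dx).
    have := cabs_cintegral m2 k1 (rintbleZ (g1 x) m2 i2) (fun y Dy => bF n x y Dx Dy).
    by rewrite E1 RintegralZl // => h; rewrite (le_trans h) // mulrAC mulrA.
  - by move=> x Dx; exact: (inner x Dx).2.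
split; [by move=> n; have [] := fub n| |exact: i3|exact: c3].
by move=> x Dx; exact: (inner x Dx).1.
Qed.

End DoubleSeries.

Section Bounds.
Context {R : realType}.
Notation mu := (@lebesgue_measure R).

(** K is independent of x and N by the scaling in [rstieltjes], taken at A = x^2; the remaining
    power of x = a v / u is a product of powers of u and v. *)
Lemma inv_power_bound (s : R[i]) : 1 < complex.Re s -> complex.Re s < 2 ->
  exists2 K, 0 <= K & forall x N, 0 < x ->
  cabs (\sum_(n < N) cpow (n.+1%:R ^+ 2 + x ^+ 2) (- (s / 2%:R))) <= K * x `^ (1 - complex.Re s).
Proof.
move=> s1 s2; have [|||K K0 H] := @rstieltjes R (complex.Re s / 2) (2^-1).
- by move: s1 s2; lra.
- by move: s1 s2; lra.
- lra.
exists (2 / cabs (cGamma (1 - s / 2%:R) * cGamma (s / 2%:R)) * (pi / 2 * K)).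
  by rewrite !mulr_ge0 // ?invr_ge0 ?cabs_ge0 ?pi_ge0.
move=> x N x0; rewrite (le_trans (inv_power_partial_le s1 s2 x0 N)) // -[leRHS]mulrA.
rewrite ler_wpM2l ?divr_ge0 ?cabs_ge0 //.
have [i E] := H (x ^+ 2) (exprn_gt0 2 x0).
have e r : pos R r -> cabs (cpow r (- (s / 2%:R)) * ((Num.sqrt (r + x ^+ 2))^-1)%:C) =
    r `^ (- (complex.Re s / 2)) * (r + x ^+ 2) `^ (- 2^-1).
  move=> /posP r0; have rx : 0 < r + x ^+ 2 by rewrite ltr_wpDr ?sqr_ge0.
  rewrite cabsM cabs_cpow // cabs_real ger0_norm ?invr_ge0 ?sqrtr_ge0 //.
  rewrite (powRN _ 2^-1) powR12_sqrt ?(ltW rx) //; congr (_ `^ _ * _); by rewrite cReN Re_half.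
have i' : rintble (pos R) (fun r => cabs (cpow r (- (s / 2%:R)) * ((Num.sqrt (r + x ^+ 2))^-1)%:C)).
  by apply: eq_rintble i => // r /e ->.
rewrite RintegralZl // -[leRHS]mulrA.
rewrite (_ : \int[mu]_(r in pos R) cabs _ = K * x `^ (1 - complex.Re s)) //.
transitivity (\int[mu]_(r in pos R) (r `^ (- (complex.Re s / 2)) * (r + x ^+ 2) `^ (- 2^-1))).
  by apply: eq_Rintegral => r /[1!inE] /e.
rewrite E -powR_mulrn ?(ltW x0) // -powRrM; congr (_ * _ `^ _); by field.
Qed.

Lemma cabs_csinh_real (w : R[i]) u : 0 < u ->
  cabs (csinh (w * u%:C)) <= cabs w * u * expR (cabs w * u).
Proof.
by move=> u0; rewrite (le_trans (cabs_csinh _)) // cabsM cabs_real (gtr0_norm u0).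
Qed.

Lemma cabs_csin_real (w : R[i]) u : 0 < u ->
  cabs (csin (w * u%:C)) <= cabs w * u * expR (cabs w * u).
Proof.
by move=> u0; rewrite (le_trans (cabs_csin _)) // cabsM cabs_real (gtr0_norm u0).
Qed.

End Bounds.

(** * The series of double integrals defining zeta_w *)

Section ZetaIntegrand.
Context {R : realType}.
Notation mu := (@lebesgue_measure R).
Variables (w s : R[i]) (a : R).
Hypotheses (a0 : 0 < a) (s1 : 1 < complex.Re s) (s2 : complex.Re s < 2).

Let Su p u : R[i] := cpow u p * (expR (- u ^+ 2))%:C * csinh (w * u%:C).
Let Sv p v : R[i] := cpow v p * (expR (- v ^+ 2))%:C * csin (w * v%:C).

(** The integrand of [zeta_] at a + 1, kept literally so that the series in the theorem is an
    instance. The argument u comes first because the dominated limit is taken with u outside. *)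
Let f n u v : R[i] := cpow (u * v) (s - 1) * (expR (- (u ^+ 2 + v ^+ 2)))%:C
        * csin (w * v%:C) * csinh (w * u%:C)
        / cpow (n.+1%:R ^+ 2 * u ^+ 2 + (a + 1 - 1) ^+ 2 * v ^+ 2) (s / 2%:R).

Let expD (u v : R) : (expR (- (u ^+ 2 + v ^+ 2)))%:C = (expR (- u ^+ 2))%:C * (expR (- v ^+ 2))%:C :> R[i].
Proof. by rewrite opprD expRD rmorphM. Qed.

Let A n x : R := n.+1%:R ^+ 2 + x ^+ 2.

Let fE n u v : 0 < u -> 0 < v ->
  f n u v = Su (- 1) u * Sv (s - 1) v * cpow (A n (a * v / u)) (- (s / 2%:R)).
Proof.
move=> u0 v0; rewrite /f.
have A0 : 0 < A n (a * v / u) by rewrite ltr_wpDr ?sqr_ge0 // exprn_gt0.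
have -> : n.+1%:R ^+ 2 * u ^+ 2 + (a + 1 - 1) ^+ 2 * v ^+ 2 = u ^+ 2 * A n (a * v / u).
  by rewrite /A; move: (n.+1%:R : R) => m; field; rewrite gt_eqF.
rewrite (cpowM _ u0 v0) (cpowM _ (exprn_gt0 2 u0) A0) (cpowXl _ _ u0) (cpowN (A n _)) expD.
rewrite (_ : 2%:R * (s / 2%:R) = s); last by field.
have -> : cpow u (s - 1) = cpow u s * cpow u (- 1) by rewrite cpowD.
rewrite /Su /Sv; have := cpow_neq0 u s; have := cpow_neq0 (A n (a * v / u)) (s / 2%:R).
move: (cpow u s) (cpow (A _ _) _) (cpow u _) (cpow v _) (csin _) (csinh _) ((expR _)%:C) ((expR _)%:C).
by move=> p1 p2 p3 p4 p5 p6 p7 p8 h1 h2; field; rewrite h1 h2.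
Qed.

Let cmeas_f n : cmeas setT (fun p : R * R => f n p.1 p.2).
Proof.
have m1 : measurable_fun setT (fun p : R * R => p.1) by exact: measurable_fst.
have m2 : measurable_fun setT (fun p : R * R => p.2) by exact: measurable_snd.
rewrite /f (_ : (fun p : R * R => _) = fun p : R * R =>
  cpow (p.1 * p.2) (s - 1) * (expR (- (p.1 ^+ 2 + p.2 ^+ 2)))%:C
        * csin (w * (p.2)%:C) * csinh (w * (p.1)%:C)
        * cpow (n.+1%:R ^+ 2 * p.1 ^+ 2 + (a + 1 - 1) ^+ 2 * p.2 ^+ 2) (- (s / 2%:R))); last first.
  by apply/funext => p; rewrite cpowN.
apply: cmeasM; last first.
  apply: cmeas_cpow; apply: measurable_funD; apply: measurable_funM => //; exact: measurable_funX.
apply: cmeasM; last first.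
  by apply: cmeas_csinh; apply: cmeasM; [exact: cmeas_cst|exact: cmeas_real].
apply: cmeasM; last first.
  by apply: cmeas_csin; apply: cmeasM; [exact: cmeas_cst|exact: cmeas_real].
apply: cmeasM; first by apply: cmeas_cpow; exact: measurable_funM.
apply: cmeas_real; apply: measurableT_comp => //; apply: measurableT_comp => //.
by apply: measurable_funD; exact: measurable_funX.
Qed.

Let g q u : R := u `^ q * expR (cabs w * u - u ^+ 2).

Let cabs_Su p u : 0 < u -> cabs (Su p u) <= cabs w * g (complex.Re p + 1) u.
Proof.
move=> u0; rewrite /Su cabsM cabsM cabs_cpow // cabs_real (ger0_norm (expR_ge0 _)).
have -> : cabs w * g (complex.Re p + 1) u =
    u `^ complex.Re p * expR (- u ^+ 2) * (cabs w * u * expR (cabs w * u)).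
  by rewrite /g powRD ?(gt_eqF u0) ?implybT // (powRr1 (ltW u0)) expRD; ring.
by rewrite ler_wpM2l ?mulr_ge0 ?powR_ge0 ?expR_ge0 // cabs_csinh_real.
Qed.

Let cabs_Sv p u : 0 < u -> cabs (Sv p u) <= cabs w * g (complex.Re p + 1) u.
Proof.
move=> u0; rewrite /Sv cabsM cabsM cabs_cpow // cabs_real (ger0_norm (expR_ge0 _)).
have -> : cabs w * g (complex.Re p + 1) u =
    u `^ complex.Re p * expR (- u ^+ 2) * (cabs w * u * expR (cabs w * u)).
  by rewrite /g powRD ?(gt_eqF u0) ?implybT // (powRr1 (ltW u0)) expRD; ring.
by rewrite ler_wpM2l ?mulr_ge0 ?powR_ge0 ?expR_ge0 // cabs_csin_real.
Qed.

(** Exponents of the majorant: u^0 from [Su (- 1)] and v^(Re s) from [Sv (s - 1)], the factors u and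
    v gained from sinh and sin included, times (v / u)^(1 - Re s); this makes u^(Re s - 1) and
    v^1. *)
Let f_bound : exists K, forall n u v, pos R u -> pos R v ->
  cabs (\sum_(i < n) f i u v) <= K * g (complex.Re s - 1) u * g 1 v.
Proof.
have [K K0 H] := inv_power_bound s1 s2.
exists (K * cabs w ^+ 2 * a `^ (1 - complex.Re s)) => n u v /posP u0 /posP v0.
have x0 : 0 < a * v / u by rewrite divr_gt0 // mulr_gt0.
have -> : \sum_(i < n) f i u v = Su (- 1) u * Sv (s - 1) v *
    \sum_(i < n) cpow (A i (a * v / u)) (- (s / 2%:R)).
  by rewrite mulr_sumr; apply: eq_bigr => i _; exact: fE.
rewrite cabsM cabsM.
have h1 := cabs_Su (- 1) u0; have h2 := cabs_Sv (s - 1) v0.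
apply: (le_trans (ler_pM _ (cabs_ge0 _) (ler_pM (cabs_ge0 _) (cabs_ge0 _) h1 h2) (H _ n x0))).
  by rewrite mulr_ge0 ?cabs_ge0.
have -> : complex.Re (- 1 : R[i]) + 1 = 0 by rewrite cReN addNr.
have -> : complex.Re (s - 1) + 1 = complex.Re s by rewrite cReD cReN subrK.
rewrite le_eqVlt; apply/orP; left; apply/eqP.
rewrite powRM ?divr_ge0 ?invr_ge0 ?mulr_ge0 ?(ltW a0) ?(ltW v0) ?(ltW u0) //.
rewrite powRM ?(ltW a0) ?(ltW v0) // /g.
have -> : u^-1 `^ (1 - complex.Re s) = u `^ (complex.Re s - 1).
  by rewrite -powR_inv1 ?(ltW u0) // -powRrM; congr powR; ring.
have -> : v `^ 1 = v `^ complex.Re s * v `^ (1 - complex.Re s).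
  by rewrite -powRD ?(gt_eqF v0) ?implybT //; congr powR; ring.
by rewrite powRr0; ring.
Qed.

Let J x := cintegral `]1, +oo[ (binet_integrand s x).

Let c1 : R[i] := - (cpow a (- s) / 2%:R).
Let c2 : R[i] := (Num.sqrt pi)%:C / 2%:R * (cGamma ((s - 1) / 2%:R) / cGamma (s / 2%:R)) * cpow a (1 - s).
Let c3 : R[i] := (2 * pi)%:C / (cGamma (1 - s / 2%:R) * cGamma (s / 2%:R)) * cpow a (1 - s).

(** [inv_power_sum] at x = a v / u times [Su (- 1) u * Sv (s - 1) v]: x^(-s) moves the exponents to
    s - 1 and -1, x^(1 - s) moves them to s - 2 and 0, and the powers of a go into [c1], [c2],
    [c3]. *)
Let h u v : R[i] := c1 * Su (s - 1) u * Sv (- 1) v + c2 * Su (s - 2%:R) u * Sv 0 v +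
  c3 * (Su (s - 2%:R) u * Sv 0 v * J (a * v / u)).

Let f_cvg u v : pos R u -> pos R v -> ccvg (fun n => \sum_(i < n) f i u v) (h u v).
Proof.
move=> /posP u0 /posP v0.
have x0 : 0 < a * v / u by rewrite divr_gt0 // mulr_gt0.
have := ccvgZ (Su (- 1) u * Sv (s - 1) v) (inv_power_sum s1 s2 x0).
congr ccvg.
  apply/funext => n; rewrite mulr_sumr; apply: eq_bigr => i _; by rewrite fE.
have E p : cpow (a * v / u) p = cpow a p * cpow v p * cpow u (- p).
  by rewrite cpowM ?invr_gt0 ?mulr_gt0 // cpowM // cpowVl.
rewrite !E -/(J _) /h /c1 /c2 /c3 /Su /Sv opprK opprB.
have -> : cpow u (s - 1) = cpow u (- 1) * cpow u s by rewrite -(cpowD u) addrC.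
have -> : cpow u (s - 2%:R) = cpow u (- 1) * (cpow u (- 1) * cpow u s).
  by rewrite -!(cpowD u); congr cpow; ring.
have -> : cpow v 0 = cpow v (s - 1) * cpow v (1 - s).
  by rewrite -(cpowD v) addrA subrK subrr.
have -> : cpow v (- 1) = cpow v (s - 1) * cpow v (- s).
  by rewrite -(cpowD v) addrAC subrr add0r.
move: (cGamma _ / cGamma _) ((2 * pi)%:C / _) (Num.sqrt pi)%:C (J _) (csin _) (csinh _).
move: (expR (- u ^+ 2))%:C (expR (- v ^+ 2))%:C.
move: (cpow a (- s)) (cpow a (1 - s)) (cpow u s) (cpow u (- 1)) (cpow v (s - 1)) (cpow v (1 - s)) (cpow v (- s)).
by move=> *; field.
Qed.

Let g_rintble q : -1 < q -> rintble (pos R) (g q).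
Proof. exact: gauss_rintble. Qed.

Let tail q t : R := (t ^+ 2 - 1) `^ (- (q / 2)) / t.

Let cmeas_Sv p D : cmeas D (Sv p).
Proof.
apply: cmeas_setT; apply: cmeasM; first apply: cmeasM.
- by apply: cmeas_cpow.
- by apply: cmeas_real; apply: measurableT_comp => //; apply: measurableT_comp => //; exact: measurable_funX.
- by apply: cmeas_csin; apply: cmeasM; [exact: cmeas_cst|exact: cmeas_real].
Qed.

Let tau u t v : R[i] := cpow u (s - 2%:R) * (expR (- (u ^+ 2 + v ^+ 2)))%:C
          * csin (w * v%:C) * csinh (w * u%:C)
          / ((expR (2 * pi * a * v * t / u) - 1)%:C
             * cpow (t ^+ 2 - 1) (s / 2%:R)).

Let tauE u t v : 0 < u -> tau u t v = Su (s - 2%:R) u * Sv 0 v * binet_integrand s (a * v / u) t.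
Proof.
move=> u0; rewrite /tau /Su /Sv /binet_integrand cpow0 mul1r expD.
rewrite (_ : 2 * pi * (a * v / u) * t = 2 * pi * a * v * t / u); last by move: (pi : R) => q; field; rewrite gt_eqF.
move: (_ ^-1) => X; ring.
Qed.

Let tail_int : rintble `]1, +oo[ (tail (complex.Re s)).
Proof. by apply: tail_rintble; rewrite s2 (lt_trans ltr01). Qed.

(** As e^X - 1 >= X, the singularity at small x is only 1 / x = u / (a v), and |sin(w v)| makes up
    for the v in the denominator. *)
Let binet_le x t : 0 < x -> 1 < t ->
  cabs (binet_integrand s x t) <= (2 * pi * x)^-1 * tail (complex.Re s) t.
Proof.
move=> x0 t1; have t0 : 0 < t by apply: lt_trans t1.
have q0 : 0 < t ^+ 2 - 1 by rewrite subr_gt0 exprn_egt1.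
have h0 : 0 < 2 * pi * x * t by rewrite !mulr_gt0 // pi_gt0.
have h1 := expR_sub1_ge (2 * pi * x * t).
rewrite /binet_integrand invfM cabsM !cabsV cabs_cpow // Re_half cabs_real.
rewrite ger0_norm; last exact: le_trans (ltW h0) h1.
rewrite /tail powRN [leRHS]mulrCA -(invfM (2 * pi * x)) [leLHS]mulrC ler_wpM2l ?invr_ge0 ?powR_ge0 //.
by rewrite lef_pV2 ?posrE // (lt_le_trans h0 h1).
Qed.

(** For fixed u, this puts v innermost as in the theorem and supplies the integrability in v that
    [h_int] requires. *)
Let swap_vt u : pos R u ->
  cintble (pos R) (fun v => Su (s - 2%:R) u * Sv 0 v * J (a * v / u)) /\
      cintegral (pos R) (fun v => Su (s - 2%:R) u * Sv 0 v * J (a * v / u)) =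
      cintegral `]1, +oo[ (fun t => cintegral (pos R) (tau u t)).
Proof.
move=> /posP u0.
have m1 : measurable_fun setT (fun p : R * R => p.1) by exact: measurable_fst.
have m2 : measurable_fun setT (fun p : R * R => p.2) by exact: measurable_snd.
have xv v : 0 < v -> 0 < a * v / u by move=> v0; rewrite divr_gt0 // mulr_gt0.
(* The integrand [tau] with its inverse distributed over the product, a form whose measurability on
   the whole plane follows factor by factor. *)
pose F v t : R[i] := Su (s - 2%:R) u * Sv 0 v *
  (((expR (2 * pi * (a * v / u) * t) - 1)^-1)%:C * cpow (t ^+ 2 - 1) (- (s / 2%:R))).
have FE v t : F v t = Su (s - 2%:R) u * Sv 0 v * binet_integrand s (a * v / u) t.
  by rewrite /F /binet_integrand invfM fmorphV cpowN.
have mF : cmeas setT (fun p : R * R => F p.1 p.2).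
  apply: cmeasM; first apply: cmeasM; [exact: cmeas_cst| |].
    exact: (cmeas_comp (cmeas_Sv 0 setT) m1).
  apply: cmeasM; last first.
    by apply: cmeas_cpow; apply: measurable_funB => //; exact: measurable_funX.
  apply: cmeas_real; apply: measurable_inv; apply: measurable_funB => //.
  apply: measurableT_comp => //; apply: measurable_funM => //; apply: measurable_funM => //.
  by apply: measurable_funM => //; apply: measurable_funM.
pose K := cabs (Su (s - 2%:R) u) * cabs w * (u / (2 * pi * a)).
have bF v t : pos R v -> (`]1, +oo[%classic : set R) t ->
    cabs (F v t) <= (K * g 0 v) * tail (complex.Re s) t.
  move=> /posP v0 t1'; have t1 : 1 < t by move: t1'; rewrite /= in_itv/= andbT.
  have x0 : 0 < a * v / u by rewrite divr_gt0 // mulr_gt0.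
  rewrite FE cabsM cabsM.
  apply: (le_trans (ler_pM _ (cabs_ge0 _) (ler_wpM2l (cabs_ge0 _) (cabs_Sv 0 v0)) (binet_le x0 t1))).
    by rewrite mulr_ge0 ?cabs_ge0.
  rewrite le_eqVlt; apply/orP; left; apply/eqP.
  rewrite /K /g powRr0 (_ : complex.Re 0 + 1 = 1) ?add0r // (powRr1 (ltW v0)).
  move: (pi_gt0 R); move: (pi : R) => q q0.
  by field; rewrite !gt_eqF.
have [i1 i2 E] := cfubini_prod (measurable_itv _) (measurable_itv _) mF
   (rintbleZ K (measurable_itv _) (g_rintble (ltrN10 R))) tail_int bF.
have IE v : pos R v -> cintegral `]1, +oo[ (F v) = Su (s - 2%:R) u * Sv 0 v * J (a * v / u).
  move=> /posP /xv x0; rewrite (eq_cintegral (fun t _ => FE v t)).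
  exact: (cintegralZ _ (measurable_itv _) (binet_integrable s1 s2 x0).1).
split; first exact: (eq_cintble (measurable_itv _) IE i1).
rewrite -(eq_cintegral IE) E; apply: eq_cintegral => t _; apply: eq_cintegral => v _.
by rewrite FE tauE.
Qed.

Let Q u := cintegral `]1, +oo[ (fun t => cintegral (pos R) (tau u t)).

Let Re1 : complex.Re (1 : R[i]) = 1. Proof. by []. Qed.

Let h_int u : pos R u -> cintegral (pos R) (h u) =
  (c1 * cintegral (pos R) (Sv (- 1))) * Su (s - 1) u +
  (c2 * cintegral (pos R) (Sv 0)) * Su (s - 2%:R) u + c3 * Q u.
Proof.
move=> pu; have [i3 E3] := swap_vt pu.
have p1 : - 2 < complex.Re (- 1 : R[i]) by rewrite cReN Re1; lra.
have p2 : - 2 < complex.Re (0 : R[i]) by rewrite (_ : complex.Re 0 = 0) //; lra.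
have i1 : cintble (pos R) (Sv (- 1)) := (gauss_sin w p1).1.
have i2 : cintble (pos R) (Sv 0) := (gauss_sin w p2).1.
have j1 := cintbleZ (c1 * Su (s - 1) u) (measurable_itv _) i1.
have j2 := cintbleZ (c2 * Su (s - 2%:R) u) (measurable_itv _) i2.
have j3 := cintbleZ c3 (measurable_itv _) i3.
rewrite (cintegralD (measurable_itv _) (cintbleD (measurable_itv _) j1 j2) j3).
rewrite (cintegralD (measurable_itv _) j1 j2).
rewrite (cintegralZ _ (measurable_itv _) i1) (cintegralZ _ (measurable_itv _) i2).
rewrite (cintegralZ _ (measurable_itv _) i3) E3 -/(Q u).
by congr (_ + _ + _); rewrite mulrAC.
Qed.

Lemma zeta_series_integral :
  cseries (fun n => cintegral (pos R) (fun v => cintegral (pos R) (fun u => f n u v))) =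
  c1 * cintegral (pos R) (Sv (- 1)) * cintegral (pos R) (Su (s - 1)) +
  c2 * cintegral (pos R) (Sv 0) * cintegral (pos R) (Su (s - 2%:R)) +
  c3 * cintegral (pos R) Q.
Proof.
have [K fK] := f_bound.
have r1 : rintble (pos R) (fun u => K * g (complex.Re s - 1) u).
  by apply: rintbleZ => //; apply: g_rintble; move: s1; lra.
have r2 : rintble (pos R) (g 1) by apply: g_rintble; lra.
have [Esw i1 i2 C] := cintegral2_series (measurable_itv _) (measurable_itv _) cmeas_f r1 r2 fK f_cvg.
apply: cseriesE.
(* [zeta_] has v outside while the limit was taken with u outside; [Esw] exchanges them in each
   term. *)
apply: (eq_ccvg _ _ C) => [N|]; first by apply: eq_bigr => n _; exact: Esw.
rewrite (eq_cintegral h_int).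
have p1 : - 2 < complex.Re (s - 1) by rewrite cReD cReN Re1; move: s1; lra.
have p2 : - 2 < complex.Re (s - 2%:R).
  by rewrite cReD cReN natr_complex (_ : complex.Re (2%:R : R)%:C = 2) //; move: s1; lra.
have j1 : cintble (pos R) (Su (s - 1)) := (gauss_sinh w p1).1.
have j2 : cintble (pos R) (Su (s - 2%:R)) := (gauss_sinh w p2).1.
have k1 := cintbleZ (c1 * cintegral (pos R) (Sv (- 1))) (measurable_itv _) j1.
have k2 := cintbleZ (c2 * cintegral (pos R) (Sv 0)) (measurable_itv _) j2.
have k12 := cintbleD (measurable_itv _) k1 k2.
(* Integrability of [c3 * Q] comes from subtracting the first two terms from the v-integral of [h],
   which the dominated limit showed to be integrable in u. *)
have k3 : cintble (pos R) (fun u => c3 * Q u).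
  have i3 := eq_cintble (measurable_itv _) h_int i2.
  apply: eq_cintble (cintbleD (measurable_itv _) i3 (cintbleZ (- 1) (measurable_itv _) k12)) => // u _.
  by rewrite mulN1r addrAC subrr add0r.
have c30 : c3 != 0.
  have G0 : cGamma (s / 2%:R) != 0.
    by apply: cGamma_neq0; rewrite Re_half; move: s1 s2; lra.
  have G1 : cGamma (1 - s / 2%:R) != 0.
    by apply: cGamma_neq0; rewrite cReD cReN Re_half Re1; move: s1 s2; lra.
  rewrite /c3 mulf_neq0 ?cpow_neq0 // mulf_neq0 ?invr_eq0 ?mulf_neq0 //.
  by rewrite -cabs_eq0 cabs_real normr_eq0 gt_eqF // mulr_gt0 // pi_gt0.
have k4 := cintbleZ_inv (measurable_itv _) c30 k3.
rewrite (cintegralD (measurable_itv _) k12 k3) (cintegralD (measurable_itv _) k1 k2).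
rewrite (cintegralZ _ (measurable_itv _) j1) (cintegralZ _ (measurable_itv _) j2).
by rewrite (cintegralZ _ (measurable_itv _) k4).
Qed.

End ZetaIntegrand.

(** * Identification of A_w and of the constants *)

Section FinalConstants.
Context {R : realType}.
Implicit Types (w s : R[i]) (a : R).

Lemma sqrt_pi_neq0 : (Num.sqrt pi)%:C != 0 :> R[i].
Proof. by rewrite -cabs_eq0 cabs_real normr_eq0 gt_eqF // sqrtr_gt0 pi_gt0. Qed.

(** At p = -1 the sine integral is a multiple of 1F1 (1/2; 3/2; -w^2/4), which by [kummer] with b =
    1 equals e^(-w^2/4) 1F1 (1; 3/2; w^2/4), the first two factors of A_w; its Gamma value is Gamma
    (1/2) = sqrt(pi). *)
Lemma A_sin_sinh w s : 0 < complex.Re s ->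
  cintegral (pos R) (fun v => cpow v (- 1) * (expR (- v ^+ 2))%:C * csin (w * v%:C)) *
  cintegral (pos R) (fun u => cpow u (s - 1) * (expR (- u ^+ 2))%:C * csinh (w * u%:C)) =
  w ^+ 2 / 4%:R * (Num.sqrt pi)%:C * cGamma ((s + 1) / 2%:R) * A_ w (s - 1).
Proof.
move=> s0.
have p1 : - 2 < complex.Re (- 1 : R[i]) by rewrite cReN (_ : complex.Re 1 = 1) //; lra.
have p2 : - 2 < complex.Re (s - 1) by rewrite cReD cReN (_ : complex.Re 1 = 1) //; lra.
rewrite (gauss_sin w p1).2 (gauss_sinh w p2).2 /A_.
have -> : - 1 / 2%:R + 1 = 2%:R^-1 :> R[i] by field.
have -> : (s - 1) / 2%:R + 1 = (s + 1) / 2%:R by field.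
have -> : 1 + (s - 1) / 2%:R = (s + 1) / 2%:R by field.
rewrite kummer cGamma_half.
have -> : 3%:R / 2%:R - 1 = 2%:R^-1 :> R[i] by field.
move: (hyp1F1 _ _ _) (hyp1F1 _ _ _) (cGamma _) (Num.sqrt pi)%:C => h1 h2 G q.
by field.
Qed.

(** Passing from w to i w flips the sign of w^2/4. The sine integral at p = 0 is already the factor
    with upper parameter 1; [kummer] with b = s/2 converts the sinh integral to upper parameter 1 +
    (1 - s)/2, and its exponential cancels the one in A_{iw}. *)
Lemma A_iw_sin_sinh w s : 0 < complex.Re s ->
  cintegral (pos R) (fun v => cpow v 0 * (expR (- v ^+ 2))%:C * csin (w * v%:C)) *
  cintegral (pos R) (fun u => cpow u (s - 2%:R) * (expR (- u ^+ 2))%:C * csinh (w * u%:C)) =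
  w ^+ 2 / 4%:R * cGamma (s / 2%:R) * A_ ('i%C * w) (1 - s).
Proof.
move=> s0.
have p1 : - 2 < complex.Re (0 : R[i]) by rewrite (_ : complex.Re 0 = 0) //; lra.
have p2 : - 2 < complex.Re (s - 2%:R).
  by rewrite cReD cReN natr_complex (_ : complex.Re (2%:R : R)%:C = 2) //; lra.
rewrite (gauss_sin w p1).2 (gauss_sinh w p2).2 /A_.
have -> : 0 / 2%:R + 1 = 1 :> R[i] by rewrite mul0r add0r.
have -> : (s - 2%:R) / 2%:R + 1 = s / 2%:R by field.
have -> : ('i%C * w) ^+ 2 / 4%:R = - (w ^+ 2 / 4%:R) by rewrite exprMn sqr_i mulN1r mulNr.
have := kummer (s / 2%:R) (w ^+ 2 / 4%:R).
have -> : 3%:R / 2%:R - s / 2%:R = 1 + (1 - s) / 2%:R by field.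
move=> <-; rewrite cGamma1 opprK.
have E : cexp (w ^+ 2 / 4%:R) * cexp (- (w ^+ 2 / 4%:R)) = 1 by rewrite -cexpD subrr cexp0.
move: E; move: (cexp _) (cexp _) (hyp1F1 _ _ _) (hyp1F1 _ _ _) (cGamma _) => e1 e2 h1 h2 G E.
rewrite (_ : e2 * h2 * (e1 * h1) = h1 * h2 * (e2 * e1)); last by ring.
by rewrite E; field.
Qed.

End FinalConstants.

Theorem theorem1p4 (R : realType) (w : R[i]) (a : R) (s : R[i])
    (hw : w != 0) (ha : 0 < a) (hs1 : 1 < complex.Re s)
    (hs2 : complex.Re s < 2) :
  zeta_ w s (a + 1) =
    - (cpow a (- s) / 2%:R) * A_ w (s - 1)
    + cpow a (1 - s) / (s - 1) * A_ ('i%C * w) (1 - s)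
    + cpow 2 (s + 2%:R) * cpow a (1 - s)
      / (w ^+ 2 * cGamma (1 - s / 2%:R) * cGamma s)
      * cintegral `]0, +oo[ (fun u =>
        cintegral `]1, +oo[ (fun t =>
        cintegral `]0, +oo[ (fun v =>
          cpow u (s - 2%:R) * (expR (- (u ^+ 2 + v ^+ 2)))%:C
          * csin (w * v%:C) * csinh (w * u%:C)
          / ((expR (2 * pi * a * v * t / u) - 1)%:C
             * cpow (t ^+ 2 - 1) (s / 2%:R))))).
Proof.
have s0 : 0 < complex.Re s by lra.
rewrite /zeta_ zeta_series_integral //.
rewrite -(mulrA (- _)) A_sin_sinh // -[X in _ + X + _]mulrA A_iw_sin_sinh //.
have h1 : 0 < complex.Re (s / 2%:R) by rewrite Re_half; lra.
have h2 : complex.Re (s / 2%:R) <= 1 by rewrite Re_half; lra.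
(* For the last term: duplication at s/2 trades Gamma (s/2) Gamma ((s + 1)/2) for Gamma (s) and
   produces the power 2^s. *)
have D := cGamma_duplication h1 h2.
have e1 : s / 2%:R + 2%:R^-1 = (s + 1) / 2%:R by field.
have e2 : 2%:R * (s / 2%:R) = s by field.
rewrite e1 e2 in D.
have e3 : (s + 1) / 2%:R = (s - 1) / 2%:R + 1 by field.
have h3 : 0 < complex.Re ((s - 1) / 2%:R).
  rewrite (_ : (s - 1) / 2%:R = s / 2%:R - (2^-1)%:C); last first.
    by rewrite fmorphV natr_complex; field.
  by rewrite cReD cReN Re_half (_ : complex.Re (2^-1)%:C = 2^-1) //; lra.
(* The origin of 1 / (s - 1) in the second term: Gamma ((s + 1)/2) = (s - 1)/2 Gamma ((s - 1)/2). *)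
have S := cGammaS h3; rewrite -e3 in S.
have G1 : cGamma ((s + 1) / 2%:R) != 0.
  apply: cGamma_neq0; rewrite e3 cReD (_ : complex.Re 1 = 1) //; first by lra.
  rewrite (_ : (s - 1) / 2%:R = s / 2%:R - (2^-1)%:C); last first.
    by rewrite fmorphV natr_complex; field.
  by rewrite cReD cReN Re_half (_ : complex.Re (2^-1)%:C = 2^-1) //; lra.
have G2 : cGamma (s / 2%:R) != 0 by apply: cGamma_neq0 => //; lra.
have G3 : cGamma (1 - s / 2%:R) != 0.
  by apply: cGamma_neq0; rewrite cReD cReN Re_half (_ : complex.Re 1 = 1) //; lra.
have G4 : cGamma s != 0 by apply: cGamma_neq0 => //; lra.
have sp := @sqrt_pi_neq0 R.
have pE : (2 * pi)%:C = 2%:R * (Num.sqrt pi)%:C ^+ 2 :> R[i].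
  by rewrite rmorphM -rmorphXn sqr_sqrtr ?pi_ge0 // natr_complex.
have s10 : s - 1 != 0.
  apply/eqP => /(congr1 (@complex.Re R)).
  by rewrite cReD cReN (_ : complex.Re 1 = 1) // (_ : complex.Re 0 = 0) //; move: hs1; lra.
have -> : cpow 2 (s + 2%:R) = 4%:R * cpow 2 s.
  rewrite cpowD cpow_nat // (_ : 2 ^+ 2 = 4%:R :> R) ?natr_complex; last by rewrite -natrX.
  by rewrite mulrC.
rewrite pE !mulrDr; congr (_ + _ + _).
- move: (A_ w (s - 1)) (cGamma _) G1 (Num.sqrt pi)%:C sp (cpow a _) => X G G0 q q0 p.
  by field; rewrite hw q0 G0.
- move: S G1; move: (cGamma ((s + 1) / _)) => G -> G0.
  have G5 : cGamma ((s - 1) / 2%:R) != 0 by apply: contra G0 => /eqP ->; rewrite mulr0.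
  move: (A_ _ _) (cGamma ((s - 1) / _)) G5 (cGamma _) G2 (Num.sqrt pi)%:C sp (cpow a _) => X G' G5 H H0 q q0 p.
  by field; rewrite hw q0 H0 s10 G5.
- rewrite !mulrA; congr (_ * _).
  have -> : cpow 2 s = 2%:R * (Num.sqrt pi)%:C * cGamma s / (cGamma (s / 2%:R) * cGamma ((s + 1) / 2%:R)).
    by rewrite -D mulrC mulKf // mulf_neq0.
  move: (cGamma ((s + 1) / _)) G1 (cGamma (s / _)) G2 (cGamma (1 - _)) G3 (cGamma s) G4 (Num.sqrt pi)%:C sp (cpow a _).
  move=> g1 G1' g2 G2' g3 G3' g4 G4' q q0 p.
  by field; rewrite hw q0 G1' G2' G3' G4'.
Qed.
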